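(* Let $u$ be the solution of the parabolic problem (P) described in the context and assume $\varepsilon(t)>0$ for $t\in[0,T]$. Let $(U_h^n)_{n=0}^N\subset\mathcal S_h$ be the Crank–Nicolson fully discrete approximations, i.e. $U_h^0=R_h^\star u_0$ and, for $n=1,\dots,N$ and all $\chi\in\mathcal S_h$, \begin{align*} \mathcal B\Big(\tfrac{U_h^n-U_h^{n-1}}{k_n},\chi\Big)=&\Big\{\tfrac{a^{n-\frac12}}{\varepsilon^{n-\frac12}}(\mathcal AU_h^n)'(1)-\Big[\tfrac{\delta^{n-\frac12}}{\varepsilon^{n-\frac12}}+\beta^{n-\frac12}(1)\Big]\mathcal AU_h^n(1)-\Big[\tfrac{g^{n-\frac12}}{\varepsilon^{n-\frac12}}+f^{n-\frac12}(1)\Big]\Big\}\chi'(1)\\ &+f^{n-\frac12}(0)\,\chi'(0)-a^{n-\frac12}\mathcal B^\star(\mathcal AU_h^n,\chi)+\mathcal B(\beta^{n-\frac12}\mathcal AU_h^n,\chi)+\mathcal B(f^{n-\frac12},\chi). \end{align*} Then there exists a constant $C_R\ge0$ such that, if $\max_{1\le n\le N}(k_nC_R)\le\frac13$, there exists a constant $C>0$ such that $$\max_{1\le n\le N}\|U_h^n-u(t^n,\cdot)\|_1\le C\,(k^2+h^r)\,\Upsilon_R(u)\qquad\forall\,h\in(0,h_\star],$$ where $$\Upsilon_R(u):=\sum_{\ell=0}^1\max_{[0,T]}\|\partial_t^\ell u\|_{r+1}+\sum_{\ell=2}^3\max_{[0,T]}|\partial_t^\ell u|_1+\sum_{m=0}^1\max_{t\in[0,T]}|\partial_t^2\partial_x^mu(t,1)|+\max_{[0,T]}|\partial_t^2u|_2.$$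 The constants $C_R$ and $C$ are independent of $h$ and of the partition of $[0,T]$.
   Context: Function spaces: $D=(0,1)$; functions are real-valued; $(f_1,f_2)=\int_Df_1f_2\,dx$ and $\|\cdot\|$ is the $L^2(D)$ norm; $\|f\|_s=\big(\sum_{\ell=0}^s\|\partial_x^\ell f\|^2\big)^{1/2}$ is the norm of $H^s(D)$; $|v|_1=\|v'\|$, $|v|_2=\|v''\|$; $\mathbb H^1(D)=\{v\in H^1(D):v(0)=0\}$, $\mathbb H^s(D)=H^s(D)\cap\mathbb H^1(D)$ for $s\ge2$; $\mathcal B(v,w)=(v',w')$, $\mathcal B^\star(v,w)=(v'',w'')$, $\gamma^\star(v,w)=(v'',w'')+(v',w')$. Finite elements: $r\in\mathbb N$ with $r\ge3$, $h_\star>0$ are fixed. For each $h\in(0,h_\star]$, $\mathcal S_h$ is a finite-dimensional subspace of $\mathbb H^2(D)$ consisting of $C^1$ functions that are polynomials of degree at most $r$ on each interval of a (non-uniform) partition of $D$ with maximum length $h$ (in particular the function $x\mapsto x^3$ is in $\mathcal S_h$). With a constant independent of $h$, $\inf_{\chi\in\mathcal S_h}\|v-\chi\|_2\le C h^{s-1}\|v\|_{s+1}$ for $v\in\mathbb H^{s+1}(D)$, $s=1,\dots,r$. The elliptic projection $R_h^\star:H^2(D)\to\mathcal S_h$ is defined by $\gamma^\star(R_h^\star v,\chi)=\gamma^\star(v,\chi)$ for all $\chi\in\mathcal S_h$. Time partition: $0=t^0<t^1<\dots<t^N=T$, $k_n=t^n-t^{n-1}$, $k=\max_{1\le n\le N}k_n$,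 $t^{n-\frac12}=\frac12(t^{n-1}+t^n)$; $\mathcal AV^n=\frac12(V^n+V^{n-1})$; a superscript $n-\frac12$ on $a,\varepsilon,\delta,g,\beta,f$ denotes evaluation at $t=t^{n-\frac12}$ (so e.g. $\beta^{n-\frac12}(1)=\beta(t^{n-\frac12},1)$). Problem (P): $T>0$; $\beta,f:[0,T]\times[0,1]\to\mathbb R$, $\delta,g,\varepsilon:[0,T]\to\mathbb R$, $a:[0,T]\to(0,\infty)$ with $\inf_{[0,T]}a>0$, $u_0:[0,1]\to\mathbb R$ are given smooth functions; $u:[0,T]\times[0,1]\to\mathbb R$ satisfies $u_t=a(t)u_{xx}+\beta(t,x)u+f(t,x)$ on $[0,T]\times[0,1]$; $u(t,0)=0$ and $a(t)u_x(t,1)=\varepsilon(t)u_t(t,1)+\delta(t)u(t,1)+g(t)$ for $t\in[0,T]$; $u(0,x)=u_0(x)$ for $x\in[0,1]$. The solution $u$ is assumed sufficiently smooth. *)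

(* Defs.v *)
From HB Require Import structures.
From mathcomp Require Import all_boot all_order all_algebra.
From mathcomp Require Import all_classical all_reals all_analysis.
Set Implicit Arguments.
Unset Strict Implicit.
Unset Printing Implicit Defensive.
Import Order.TTheory GRing.Theory Num.Theory.
Import numFieldNormedType.Exports.
Local Open Scope classical_set_scope.
Local Open Scope ring_scope.

(* Functions on [0, 1] (resp. [0, T]) are represented by total functions
   R -> R whose values outside the interval are irrelevant: derivatives are
   relative to the interval (two-sided inside, one-sided at the endpoints), and
   integrals are over D = (0, 1). *)

Definition diff_quot (R : realType) (f : R -> R) (x y : R) : R :=
  (f y - f x) / (y - x).

Definition derivable_in (R : realType) (A : set R) (f : R -> R) (x : R) : Prop :=
  cvg (diff_quot f x y @[y --> within A x^']).

Definition deriv_in (R : realType) (A : set R) (f : R -> R) (x : R) : R :=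
  lim (diff_quot f x y @[y --> within A x^']).

Definition Cn_in (R : realType) (A : set R) (n : nat) (f : R -> R) : Prop :=
  (forall i, (i < n)%N -> forall x, A x -> derivable_in A (iter i (deriv_in A) f) x)
  /\ {within A, continuous (iter n (deriv_in A) f)}.

Definition smooth_in (R : realType) (A : set R) (f : R -> R) : Prop :=
  forall n, Cn_in A n f.

Definition dx (R : realType) (v : R -> R) : R -> R := deriv_in `[0, 1] v.

(* Functions of (t, x) on [0, T] x [0, 1]; the time variable comes first. *)

Definition pdt (R : realType) (T : R) (w : R -> R -> R) : R -> R -> R :=
  fun t x => deriv_in `[0, T] (fun s => w s x) t.

Definition pdx (R : realType) (w : R -> R -> R) : R -> R -> R :=
  fun t x => dx (w t) x.

Fixpoint Cn_rect (R : realType) (T : R) (n : nat) (w : R -> R -> R) : Prop :=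
  {within `[0, T] `*` `[0, 1], continuous (fun z : R * R => w z.1 z.2)} /\
  if n is m.+1 then
    [/\ forall t x, t \in `[0, T] -> x \in `[0, 1] ->
          derivable_in `[0, T] (fun s => w s x) t /\ derivable_in `[0, 1] (w t) x,
        Cn_rect T m (pdt T w) & Cn_rect T m (pdx w)]
  else True.

Definition smooth_rect (R : realType) (T : R) (w : R -> R -> R) : Prop :=
  forall n, Cn_rect T n w.

Definition ip (R : realType) (f g : R -> R) : R :=
  (\int[@lebesgue_measure R]_(x in (`]0, 1[ : set R)) (f x * g x))%R.

Definition L2norm (R : realType) (f : R -> R) : R := Num.sqrt (ip f f).

Definition in_L2 (R : realType) (f : R -> R) : Prop :=
  measurable_fun (`]0, 1[ : set R) f /\
  (@lebesgue_measure R).-integrable (`]0, 1[ : set R) (fun x => (f x ^+ 2)%:E).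

(* The H^s norm of the function whose successive derivatives are d 0, d 1, ... *)
Definition Hnorm (R : realType) (s : nat) (d : nat -> R -> R) : R :=
  Num.sqrt (\sum_(l < s.+1) L2norm (d l) ^+ 2).

Definition derivs (R : realType) (v : R -> R) : nat -> R -> R :=
  fun l => iter l (@dx R) v.

Definition semi1 (R : realType) (v : R -> R) : R := L2norm (dx v).
Definition semi2 (R : realType) (v : R -> R) : R := L2norm (dx (dx v)).

Definition formB (R : realType) (v w : R -> R) : R := ip (dx v) (dx w).
Definition formBstar (R : realType) (v w : R -> R) : R :=
  ip (dx (dx v)) (dx (dx w)).
Definition gammastar (R : realType) (v w : R -> R) : R :=
  formBstar v w + formB v w.

Definition test_fun (R : realType) (phi : R -> R) : Prop :=
  (forall n x, derivable (derive1n n phi) x 1) /\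
  exists a b, [/\ 0 < a, b < 1 & forall x, x \notin `[a, b] -> phi x = 0].

Definition weak_derivative (R : realType) (l : nat) (v g : R -> R) : Prop :=
  forall phi, test_fun phi -> ip v (derive1n l phi) = (-1) ^+ l * ip g phi.

(* v belongs to H^s(D), with weak derivatives d 1, ..., d s. *)
Definition in_H (R : realType) (s : nat) (v : R -> R) (d : nat -> R -> R) : Prop :=
  d 0%N = v /\
  forall l, (l <= s)%N -> in_L2 (d l) /\ weak_derivative l v (d l).

(* The condition v(0) = 0 refers to the continuous representative of v. *)
Definition in_H0 (R : realType) (s : nat) (v : R -> R) (d : nat -> R -> R) : Prop :=
  [/\ in_H s v d, {within `[0, 1], continuous v} & v 0 = 0].

Definition is_partition (R : realType) (b : R) (N : nat) (t : nat -> R) : Prop :=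
  [/\ t 0%N = 0, t N = b & forall n, (n < N)%N -> t n < t n.+1].

Definition step (R : realType) (t : nat -> R) (n : nat) : R := t n - t n.-1.

Definition mesh (R : realType) (N : nat) (t : nat -> R) : R :=
  \big[Num.max/0]_(1 <= n < N.+1) step t n.

Definition finite_dim_subspace (R : realType) (S : set (R -> R)) : Prop :=
  exists (m : nat) (b : 'I_m -> R -> R),
    S = [set (fun x => \sum_(i < m) c i * b i x) | c in [set: 'I_m -> R]].

Definition fe_space (R : realType) (r : nat) (h : R) (S : set (R -> R)) : Prop :=
  [/\ finite_dim_subspace S,
      forall chi, S chi -> Cn_in `[0, 1] 1 chi /\ chi 0 = 0,
      exists (M : nat) (xs : nat -> R),
        [/\ is_partition 1 M xs, mesh M xs = h &
            forall chi, S chi -> forall i, (i < M)%N ->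
              exists2 p : {poly R}, (size p <= r.+1)%N &
                forall x, x \in `[xs i, xs i.+1] -> chi x = p.[x]] &
      exists2 chi, S chi & forall x, x \in `[0, 1] -> chi x = x ^+ 3].

Definition approx_property (R : realType) (r : nat) (hstar : R)
    (S : R -> set (R -> R)) : Prop :=
  exists C : R, forall h, 0 < h <= hstar ->
    forall s, (1 <= s <= r)%N -> forall v d, in_H0 s.+1 v d ->
      inf [set Hnorm 2 (fun l x => d l x - derivs chi l x) | chi in S h]
        <= C * h ^+ s.-1 * Hnorm s.+1 d.

(* w = R_h^* v *)
Definition is_elliptic_proj (R : realType) (S : set (R -> R)) (v w : R -> R) : Prop :=
  S w /\ forall chi, S chi -> gammastar w chi = gammastar v chi.

Definition problem_data (R : realType) (T : R) (a delta g eps : R -> R)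
    (beta f : R -> R -> R) (u0 : R -> R) : Prop :=
  [/\ smooth_rect T beta /\ smooth_rect T f,
      [/\ smooth_in `[0, T] a, smooth_in `[0, T] delta, smooth_in `[0, T] g
        & smooth_in `[0, T] eps],
      smooth_in `[0, 1] u0,
      forall t, t \in `[0, T] -> 0 < a t &
      0 < inf [set a t | t in `[0, T]]].

Definition solves_P (R : realType) (T : R) (a delta g eps : R -> R)
    (beta f : R -> R -> R) (u0 : R -> R) (u : R -> R -> R) : Prop :=
  [/\ forall t x, t \in `[0, T] -> x \in `[0, 1] ->
        pdt T u t x = a t * iter 2 (@pdx R) u t x + beta t x * u t x + f t x,
      forall t, t \in `[0, T] -> u t 0 = 0,
      forall t, t \in `[0, T] ->
        a t * pdx u t 1 = eps t * pdt T u t 1 + delta t * u t 1 + g t &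
      forall x, x \in `[0, 1] -> u 0 x = u0 x].

Definition avg (R : realType) (V : nat -> R -> R) (n : nat) : R -> R :=
  fun x => (V n x + V n.-1 x) / 2.

Definition tmid (R : realType) (t : nat -> R) (n : nat) : R := (t n.-1 + t n) / 2.

Definition crank_nicolson (R : realType) (a delta g eps : R -> R)
    (beta f : R -> R -> R) (u0 : R -> R) (S : set (R -> R))
    (N : nat) (t : nat -> R) (U : nat -> R -> R) : Prop :=
  [/\ forall n, (n <= N)%N -> S (U n),
      is_elliptic_proj S u0 (U 0%N) &
      forall n, (1 <= n <= N)%N -> forall chi, S chi ->
        let tm := tmid t n in
        let AU := avg U n in
        formB (fun x => (U n x - U n.-1 x) / step t n) chi =
          (a tm / eps tm * dx AU 1
           - (delta tm / eps tm + beta tm 1) * AU 1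
           - (g tm / eps tm + f tm 1)) * dx chi 1
          + f tm 0 * dx chi 0
          - a tm * formBstar AU chi
          + formB (fun x => beta tm x * AU x) chi
          + formB (f tm) chi].

(* max over [0, T] of a continuous function *)
Definition maxT (R : realType) (T : R) (F : R -> R) : R :=
  sup [set F t | t in `[0, T]].

Definition Upsilon (R : realType) (r : nat) (T : R) (u : R -> R -> R) : R :=
  \sum_(0 <= l < 2) maxT T (fun t => Hnorm r.+1 (derivs (iter l (pdt T) u t)))
  + \sum_(2 <= l < 4) maxT T (fun t => semi1 (iter l (pdt T) u t))
  + \sum_(0 <= m < 2) maxT T (fun t => `|iter 2 (pdt T) (iter m (@pdx R) u) t 1|)
  + maxT T (fun t => semi2 (iter 2 (pdt T) u t)).

(* Main.v *)
Require Import Defs.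
From mathcomp Require Import all_boot all_order all_algebra.
From mathcomp Require Import all_classical all_reals all_analysis.
From mathcomp Require Import measurable_realfun.
From mathcomp Require Import ring lra.
Import Order.TTheory GRing.Theory Num.Theory.
Import numFieldNormedType.Exports.
Set Implicit Arguments.
Unset Strict Implicit.
Unset Printing Implicit Defensive.
Local Open Scope classical_set_scope.
Local Open Scope ring_scope.

(** The error at time [t n] is split as [(U n - w n) + (w n - u (t n))], where [w n] is
the elliptic projection of [u (t n)].

The second part is controlled by [elliptic_estimate]. The projection error is orthogonal
to the discrete space for the energy form, so its energy norm has the order [h ^ (r - 1)]
of the best approximation, and a duality argument ([dual_function]) gains one more power
of [h] for the first derivative. Since the cubic [x ^ 3] is a discrete function, the slope
of the projection error at the right end is a combination of its mean values and has the
same order [h ^ r] ([elliptic_endpoint]); a trace inequality would lose half a power.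

For the first part, the equation is multiplied by [- chi''] and integrated by parts, the
boundary condition eliminating the time derivative at the right end ([weak_form]). The
result has the shape of the scheme at the midpoint of the step. Subtracting it from the
scheme and testing with the average of [U n - w n] and [U (n - 1) - w (n - 1)] bounds the
increment of the squared seminorm of the error ([one_step]): the boundary term at the right
end is absorbed by the diffusion term with the help of a trace inequality, and the remaining
terms are consistency errors. Those due to the projection are of order [h ^ r] because
orthogonality replaces second derivatives of the projection error by first derivatives.
Those due to the time discretisation are of order [k ^ 2], by the midpoint expansions
[midpoint_average] and [midpoint_difference], applied to point values of [u] and to inner
products of its derivatives with fixed functions. The initial error vanishes, the discrete
Gronwall inequality ([discrete_gronwall]) sums the steps, and the Poincare inequality turns
the seminorm into the norm of order one.

Second derivatives of finite element functions exist only inside the cells of the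
partition. All integrations by parts are therefore done for pairs [pder F f] of a continuous
function and a piecewise continuous derivative. *)

(** * One-sided derivatives on an interval *)

Section Interval_derivative.
Context {R : realType}.
Implicit Types (f g F G : R -> R) (a b x l m c : R).

Lemma cvg_within_dnbhsP (A : set R) (f : R -> R) x l :
  f y @[y --> within A x^'] --> l <->
  forall e, 0 < e -> exists2 d, 0 < d &
    forall y, A y -> y != x -> `|y - x| < d -> `|f y - l| < e.
Proof.
split=> [/cvgrPdist_lt H e e0|H].
  have := H e e0; rewrite near_withinE => /nbhs_ballP[d /= d0 Hd].
  exists d => // y Ay yx yd; rewrite distrC; apply: Hd => //.
  by rewrite /ball /= distrC.
apply/cvgrPdist_lt => e e0; have [d d0 Hd] := H e e0.
rewrite near_withinE; apply/nbhs_ballP; exists d => //= y yd yx Ay.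
by rewrite distrC; apply: Hd => //; rewrite distrC.
Qed.

Lemma within_continuousP (A : set R) f :
  {within A, continuous f} <->
  forall x, A x -> forall e, 0 < e -> exists2 d, 0 < d &
    forall y, A y -> `|y - x| < d -> `|f y - f x| < e.
Proof.
split=> [/subspace_continuousP H x Ax e e0|H].
  have /cvgrPdist_lt/(_ e e0) := H x Ax.
  rewrite near_withinE => /nbhs_ballP[d /= d0 Hd].
  exists d => // y Ay yd; rewrite distrC; apply: Hd => //.
  by rewrite /ball /= distrC.
apply/subspace_continuousP => x Ax; apply/cvgrPdist_lt => e e0.
have [d d0 Hd] := H x Ax e e0.
rewrite near_withinE; apply/nbhs_ballP; exists d => //= y yd Ay.
by rewrite distrC; apply: Hd => //; rewrite distrC.
Qed.

Lemma within_continuousW (A B : set R) f : B `<=` A ->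
  {within A, continuous f} -> {within B, continuous f}.
Proof. by move=> BA; apply: continuous_subspaceW. Qed.

Lemma eq_within_continuous (A : set R) f g : (forall x, A x -> f x = g x) ->
  {within A, continuous f} -> {within A, continuous g}.
Proof.
move=> fg /within_continuousP cf; apply/within_continuousP => x Ax e e0.
by have [d d0 Hd] := cf x Ax e e0; exists d => // y Ay; rewrite -!fg//; apply: Hd.
Qed.

Lemma is_deriveP f x l :
  is_derive x 1 f l <->
  forall e, 0 < e -> exists2 d, 0 < d &
    forall y, y != x -> `|y - x| < d -> `|diff_quot f x y - l| < e.
Proof.
split=> [[fx fl] e e0|H].
  move: fx => /cvg_ex[/= l' fl'].
  have ll' : l = l' by rewrite -fl; apply/cvg_lim.
  move: fl' => /cvgrPdist_lt/(_ e e0); rewrite near_withinE.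
  move=> /nbhs_ballP[d /= d0 Hd]; exists d => // y yx yd.
  have := Hd (y - x); rewrite /ball/= sub0r normrN => /(_ yd).
  rewrite subr_eq0 => /(_ yx).
  by rewrite distrC -ll' scaler1 subrK /diff_quot /GRing.scale /= mulrC.
have cv : h^-1 *: (f (h *: 1 + x) - f x) @[h --> 0^'] --> l.
  apply/cvgrPdist_lt => e e0; have [d d0 Hd] := H e e0.
  rewrite near_withinE; apply/nbhs_ballP; exists d => //= y.
  rewrite /ball/= sub0r normrN => yd y0.
  have := Hd (y + x); rewrite addrK => /(_ _ yd).
  rewrite -subr_eq0 addrK => /(_ y0).
  by rewrite distrC /diff_quot addrK scaler1 /GRing.scale/= mulrC.
by apply: DeriveDef; [apply/cvg_ex; exists l|exact/cvg_lim].
Qed.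

Lemma itv_dnbhs_proper a b x : a < b -> x \in `[a, b] ->
  ProperFilter (within `[a, b] x^').
Proof.
rewrite in_itv/= => ab /andP[ax xb].
apply: Build_ProperFilter_ex => P.
rewrite -[X in X -> _]/(\forall y \near within `[a, b] x^', P y).
rewrite !near_withinE => /nbhs_ballP[e /= e0]; rewrite /ball/= => He.
have [xb'|bx] := ltP x b.
  pose d := Num.min (e / 2) (b - x).
  have d0 : 0 < d by rewrite lt_min divr_gt0//= subr_gt0.
  have de : d < e by rewrite /d gt_min ltr_pdivrMr// mulr_natr mulr2n ltrDl e0.
  have db : d <= b - x by rewrite /d ge_min lexx orbT.
  exists (x + d); apply: He => /=.
  - by rewrite opprD addNKr normrN gtr0_norm.
  - by rewrite addrC -subr_eq0 addrK gt_eqF.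
  - by rewrite in_itv/=; apply/andP; split; lra.
pose d := Num.min (e / 2) (x - a).
have d0 : 0 < d by rewrite lt_min divr_gt0//= subr_gt0; lra.
have de : d < e by rewrite /d gt_min ltr_pdivrMr// mulr_natr mulr2n ltrDl e0.
have db : d <= x - a by rewrite /d ge_min lexx orbT.
exists (x - d); apply: He => /=.
- by rewrite opprB addrC subrK gtr0_norm.
- by rewrite -subr_eq0 addrC addKr oppr_eq0 gt_eqF.
- by rewrite in_itv/=; apply/andP; split; lra.
Qed.

Lemma derivable_in_cvg a b f x : derivable_in `[a, b] f x ->
  diff_quot f x y @[y --> within `[a, b] x^'] --> deriv_in `[a, b] f x.
Proof. by []. Qed.

Lemma cvg_deriv_in a b f x l : a < b -> x \in `[a, b] ->
  diff_quot f x y @[y --> within `[a, b] x^'] --> l ->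
  derivable_in `[a, b] f x /\ deriv_in `[a, b] f x = l.
Proof.
move=> ab xab fl; have PF := itv_dnbhs_proper ab xab.
split; first by apply/cvg_ex; exists l.
exact/cvg_lim.
Qed.

Lemma deriv_in_interior a b f x : x \in `]a, b[ -> derivable_in `[a, b] f x ->
  is_derive x 1 f (deriv_in `[a, b] f x).
Proof.
rewrite in_itv/= => /andP[ax xb] /derivable_in_cvg /cvg_within_dnbhsP H.
apply/is_deriveP => e e0; have [d d0 Hd] := H e e0.
exists (Num.min d (Num.min (x - a) (b - x))).
  by rewrite !lt_min d0 !subr_gt0 ax.
move=> y yx; rewrite !lt_min => /and3P[yd y1 y2]; apply: Hd => //=.
move: y1 y2; rewrite in_itv/= !ltr_norml => /andP[y1 y2] /andP[y3 y4].
by apply/andP; split; lra.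
Qed.

Lemma is_derive_deriv_in a b f x l : x \in `]a, b[ -> is_derive x 1 f l ->
  derivable_in `[a, b] f x /\ deriv_in `[a, b] f x = l.
Proof.
move=> xab /is_deriveP H.
have xab' : x \in `[a, b] by move: xab; exact: subset_itv_oo_cc.
apply: cvg_deriv_in => //.
  by move: xab; rewrite in_itv/= => /andP[]; apply: lt_trans.
apply/cvg_within_dnbhsP => e e0; have [d d0 Hd] := H e e0.
by exists d => // y _; apply: Hd.
Qed.

Lemma eq_deriv_in (A : set R) f g x : (forall y, A y -> f y = g y) -> A x ->
  (derivable_in A f x -> derivable_in A g x) /\
  deriv_in A f x = deriv_in A g x.
Proof.
move=> fg Ax.
have imp (f1 f2 : R -> R) P : (forall y, A y -> f1 y = f2 y) ->
    (\forall y \near within A x^', P (diff_quot f1 x y)) ->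
    (\forall y \near within A x^', P (diff_quot f2 x y)).
  move=> f12; rewrite !near_withinE; apply: filterS => y h yx Ay.
  by move: (h yx Ay); rewrite /diff_quot !f12.
have E : diff_quot f x @ within A x^' = diff_quot g x @ within A x^'.
  apply/funext => P; apply/propext; split; apply: imp => // y Ay.
  by rewrite fg.
by rewrite /derivable_in /deriv_in E.
Qed.

Lemma deriv_in_lin a b f g x c m : a < b -> x \in `[a, b] ->
  derivable_in `[a, b] f x -> derivable_in `[a, b] g x ->
  derivable_in `[a, b] (fun y => c * f y + m * g y) x /\
  deriv_in `[a, b] (fun y => c * f y + m * g y) x =
    c * deriv_in `[a, b] f x + m * deriv_in `[a, b] g x.
Proof.
move=> ab xab /derivable_in_cvg df /derivable_in_cvg dg.
have PF := itv_dnbhs_proper ab xab.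
apply: cvg_deriv_in => //.
have -> : diff_quot (fun y => c * f y + m * g y) x =
  (fun y => c * diff_quot f x y + m * diff_quot g x y).
  by apply/funext => y; rewrite /diff_quot; ring.
by apply: cvgD; apply: cvgMr.
Qed.

Lemma derivable_in_continuous a b f x : x \in `[a, b] ->
  derivable_in `[a, b] f x ->
  forall e, 0 < e -> exists2 d, 0 < d &
    forall y, `[a, b]%classic y -> `|y - x| < d -> `|f y - f x| < e.
Proof.
move=> xab /derivable_in_cvg /cvg_within_dnbhsP H e e0.
set l := deriv_in _ _ _ in H.
have [d d0 Hd] := H 1 ltr01.
pose K := `|l| + 1; have K0 : 0 < K by rewrite ltr_wpDl.
exists (Num.min d (e / K)); first by rewrite lt_min d0 divr_gt0.
move=> y yab; rewrite lt_min => /andP[yd ye].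
have [->|yx] := eqVneq y x; first by rewrite subrr normr0.
have := Hd y yab yx yd => qb.
have yx0 : y - x != 0 by rewrite subr_eq0.
have -> : f y - f x = diff_quot f x y * (y - x).
  by rewrite /diff_quot divfK.
have qK : `|diff_quot f x y| < K.
  rewrite -[diff_quot f x y](subrK l) /K addrC.
  by rewrite (le_lt_trans (ler_normD _ _))// ltrD2l.
rewrite normrM.
have : `|y - x| * K < e by rewrite -ltr_pdivlMr.
apply: le_lt_trans; rewrite mulrC ler_wpM2l//; exact: ltW.
Qed.

Lemma derivable_in_within a b f :
  (forall x, x \in `[a, b] -> derivable_in `[a, b] f x) ->
  {within `[a, b], continuous f}.
Proof.
move=> df; apply/within_continuousP => x xab.
by apply: derivable_in_continuous => //; apply: df.
Qed.

Lemma itvoo_near a b x : x \in `]a, b[ ->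
  exists2 d, 0 < d & forall y, `|y - x| < d -> y \in `]a, b[.
Proof.
rewrite in_itv/= => /andP[ax xb].
exists (Num.min (x - a) (b - x)); first by rewrite lt_min !subr_gt0 ax.
move=> y; rewrite lt_min !ltr_norml in_itv/= => /andP[/andP[y1 y2] /andP[y3 y4]].
by apply/andP; split; lra.
Qed.

(** A bound on the derivative inside an interval bounds the increment; only
one-sided continuity is needed at the two ends. *)
Lemma increment_le a b f (df : R -> R) (B : R) : a <= b ->
  {within `[a, b], continuous f} ->
  (forall x, x \in `]a, b[ -> is_derive x 1 f (df x)) ->
  (forall x, x \in `]a, b[ -> `|df x| <= B) ->
  `|f b - f a| <= B * (b - a).
Proof.
rewrite le_eqVlt => /predU1P[->|ab] cf Hf HB.
  by rewrite !subrr normr0 mulr0.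
have [c cab ->] := MVT ab Hf cf.
have ba : 0 <= b - a by rewrite subr_ge0 ltW.
by rewrite normrM (ger0_norm ba) ler_wpM2r// HB.
Qed.

End Interval_derivative.

(** * Bounded measurable functions *)

(** On an interval of finite length boundedness makes every product of two such
functions integrable, so that no integrability condition has to be carried along. *)
Definition bm_on (R : realType) (A : set R) (f : R -> R) : Prop :=
  measurable_fun A f /\ exists M : R, forall x, A x -> `|f x| <= M.

Notation bm := (bm_on `]0, 1[).

Section Bounded_measurable.
Context {R : realType}.
Notation mu := (@lebesgue_measure R).
Implicit Types (f g F G : R -> R) (a b x c d : R).

Lemma bm_integrable a b f : bm_on `]a, b[ f ->
  mu.-integrable `]a, b[ (EFin \o f).
Proof.
move=> [mf [M fM]]; apply: measurable_bounded_integrable => //.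
  by rewrite [ltLHS]lebesgue_measure_itv/=; case: ifP => // _; rewrite -EFinB ltry.
exists M; split; first exact: num_real.
by move=> x Mx y /= yab; rewrite (le_trans (fM y yab))// ltW.
Qed.

Lemma bm_lin (A : set R) f g c d : bm_on A f -> bm_on A g ->
  bm_on A (fun x => c * f x + d * g x).
Proof.
move=> [mf [M fM]] [mg [N gN]]; split.
  by apply: measurable_funD; apply: measurable_funM => //; exact: measurable_cst.
exists (`|c| * M + `|d| * N) => x Ax.
rewrite (le_trans (ler_normD _ _))// !normrM lerD// ler_wpM2l//.
  exact: fM.
exact: gN.
Qed.

Lemma bm_mul (A : set R) f g : bm_on A f -> bm_on A g ->
  bm_on A (fun x => f x * g x).
Proof.
move=> [mf [M fM]] [mg [N gN]]; split; first exact: measurable_funM.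
exists (M * N) => x Ax; rewrite normrM ler_pM//.
  exact: fM.
exact: gN.
Qed.

Lemma bm_cst (A : set R) c : bm_on A (fun=> c).
Proof. by split; [exact: measurable_cst|exists `|c|]. Qed.

Lemma within_continuous_bounded a b f : {within `[a, b], continuous f} ->
  exists M : R, forall x, x \in `[a, b] -> `|f x| <= M.
Proof.
move=> cf; have [ab|ba] := leP a b; last first.
  exists 0 => x; rewrite in_itv/= => /andP[ax xb].
  by have := le_lt_trans (le_trans ax xb) ba; rewrite ltxx.
have [c cab fc] := EVT_max ab cf; have [d dab fd] := EVT_min ab cf.
exists (Num.max `|f c| `|f d|) => x xab; rewrite le_max.
have [f0|f0] := leP 0 (f x).
  by rewrite (ger0_norm f0) (le_trans (fc _ xab))// ler_norm.
by rewrite (ltr0_norm f0) orbC lerNl (le_trans _ (fd _ xab))// lerNl ler_normr lexx orbT.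
Qed.

Lemma within_continuous_bm a b f : {within `[a, b], continuous f} ->
  bm_on `]a, b[ f.
Proof.
move=> cf; split; last first.
  have [M fM] := within_continuous_bounded cf.
  by exists M => x xab; apply: fM; exact: subset_itv_oo_cc.
have : mu.-integrable `[a, b] (EFin \o f).
  by apply: continuous_compact_integrable => //; exact: segment_compact.
move=> /integrableP[/measurable_EFinP mf _].
by apply: measurable_funS mf => //; exact: subset_itv_oo_cc.
Qed.

Lemma bm_eq (A : set R) f g : (forall x, A x -> f x = g x) ->
  bm_on A f -> bm_on A g.
Proof.
move=> fg [mf [M fM]]; split.
  by apply: eq_measurable_fun mf => x; rewrite inE => /fg.
by exists M => x Ax; rewrite -fg// fM.
Qed.

Lemma itvoo_split a b c : a < b -> b < c ->
  `]a, c[%classic = (`]a, b[ `|` [set b] `|` `]b, c[)%classic :> set R.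
Proof.
move=> ab bc; apply/seteqP; split=> x /=; rewrite !in_itv/=.
  move=> /andP[ax xc]; have [xb|bx|->] := ltgtP x b.
  - by left; left; rewrite ax.
  - by right; rewrite xc.
  - by left; right.
move=> [[/andP[-> xb]|->]|/andP[bx ->]].
- exact: lt_trans xb bc.
- by rewrite ab.
- by rewrite (lt_trans ab bx).
Qed.

Lemma bm_join a b c f : a < b -> b < c ->
  bm_on `]a, b[ f -> bm_on `]b, c[ f -> bm_on `]a, c[ f.
Proof.
move=> ab bc [mf [M fM]] [mg [N gN]]; split.
  rewrite (itvoo_split ab bc); apply/measurable_funU => //.
    exact: measurableU.
  split=> //; apply/measurable_funU => //; split=> //.
  exact: measurable_fun_set1.
exists (Num.max (Num.max M `|f b|) N) => x.
rewrite (itvoo_split ab bc) => -[[xab|->]|xbc]; rewrite !le_max.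
- by rewrite (fM _ xab).
- by rewrite lexx orbT.
- by rewrite (gN _ xbc) orbT.
Qed.

Lemma Rintegral_join a b c f : a < b -> b < c -> bm_on `]a, c[ f ->
  \int[mu]_(x in `]a, c[) f x =
  \int[mu]_(x in `]a, b[) f x + \int[mu]_(x in `]b, c[) f x.
Proof.
move=> ab bc bf; have iF := bm_integrable bf.
have -> : `]a, c[%classic = (`]a, b] `|` `]b, c[)%classic :> set R.
  rewrite -itv_bndbnd_setU ?bnd_simp//; exact: ltW.
rewrite Rintegral_setU//.
- rewrite (@Rintegral_itv_bndo_bndc _ _ b)//.
  by apply: integrableS iF => //; apply: subset_itvl; rewrite bnd_simp ltW.
- by rewrite -itv_bndbnd_setU ?bnd_simp//; exact: ltW.
- apply/disj_setPS => y [/=]; rewrite 2!in_itv/= => /andP[_ yx] /andP[].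
  by rewrite ltNge yx.
Qed.

End Bounded_measurable.

Lemma partition_le (R : realType) (b : R) N (t : nat -> R) i j :
  is_partition b N t -> (i <= j <= N)%N -> t i <= t j.
Proof.
case=> _ _ lt_t /andP[]; elim: j => [|j IH]; first by rewrite leqn0 => /eqP->.
rewrite leq_eqVlt => /predU1P[->//|ij jN].
exact: le_trans (IH ij (ltnW jN)) (ltW (lt_t _ jN)).
Qed.

(** * Piecewise differentiable functions on a partition of the unit interval *)

Section Piecewise.
Context {R : realType}.
Notation mu := (@lebesgue_measure R).
Variables (M : nat) (xs : nat -> R).
Hypothesis part : is_partition 1 M xs.
Implicit Types (f g F G : R -> R) (a b x c d : R).

(** The interiors of the cells, where a finite element function has a second
derivative; at the nodes [dx (dx chi)] is the limit of a divergent quotient and has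
an arbitrary value. *)
Definition opn x := exists2 i, (i < M)%N & x \in `]xs i, xs i.+1[.

Definition pcont f := forall i, (i < M)%N ->
  exists2 g, {within `[xs i, xs i.+1], continuous g} &
    forall x, x \in `]xs i, xs i.+1[ -> f x = g x.

(** Working with the pair of a function and its derivative, instead of a function
and an operator, keeps the class closed under sums and products although the
derivative is determined only off the nodes. *)
Definition pder F f := [/\ {within `[0, 1], continuous F}, pcont f &
  forall x, opn x -> is_derive x 1 F (f x)].

Lemma partition_itv i : (i < M)%N -> [/\ 0 <= xs i, xs i < xs i.+1 & xs i.+1 <= 1].
Proof.
move=> iM; case: (part) => x0 xM lt_xs; split; last 1 first.
- by rewrite -xM (partition_le part)// iM leqnn.
- by rewrite -x0 (partition_le part)//= ltnW.
- exact: lt_xs.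
Qed.

Lemma partition_gt0 : (0 < M)%N.
Proof.
case: (part) => x0; case: M => // xM _.
by move: (@ltr01 R); rewrite -xM x0 ltxx.
Qed.

Lemma opn_itv x : opn x -> x \in `]0, 1[.
Proof.
move=> [i iM]; have [a b c] := partition_itv iM; rewrite !in_itv/= => /andP[d e].
by rewrite (le_lt_trans a d) (lt_le_trans e c).
Qed.

Lemma opn_near x : opn x -> exists2 d, 0 < d & forall y, `|y - x| < d -> opn y.
Proof.
by move=> [i iM /itvoo_near[d d0 Hd]]; exists d => // y /Hd; exists i.
Qed.

Lemma pcont_bm f : pcont f -> bm f.
Proof.
move=> pf; case: (part) => x0 xM lt_xs; rewrite -xM.
suff H m : (m < M)%N -> bm_on `]0, xs m.+1[ f.
  by move: partition_gt0 H; case: M => // m _; apply.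
have piece i : (i < M)%N -> bm_on `]xs i, xs i.+1[ f.
  move=> iM; have [g cg fg] := pf i iM.
  by apply: bm_eq (within_continuous_bm cg) => x /fg.
elim: m => [|m IH] mM; first by rewrite -{1}x0; exact: piece.
apply: (@bm_join _ _ (xs m.+1)); last exact: piece.
- rewrite -x0; apply: lt_le_trans (lt_xs 0%N partition_gt0) _.
  by rewrite (partition_le part)//= ltnW.
- exact: lt_xs.
- by apply: IH; exact: ltnW.
Qed.

Lemma within_pcont f : {within `[0, 1], continuous f} -> pcont f.
Proof.
move=> cf i iM; exists f => //; apply: within_continuousW cf.
by have [a b c] := partition_itv iM; apply: subset_itv; rewrite bnd_simp.
Qed.

Lemma pcont_cst c : pcont (fun=> c).
Proof.
by apply: within_pcont; apply: continuous_subspaceT => x; exact: cvg_cst.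
Qed.

Lemma pcont_lin f g c d : pcont f -> pcont g -> pcont (fun x => c * f x + d * g x).
Proof.
move=> pf pg i iM; have [f' cf ff] := pf i iM; have [g' cg gg] := pg i iM.
exists (fun x => c * f' x + d * g' x) => [|x xi]; last by rewrite ff// gg.
by move=> x; apply: cvgD; apply: cvgMr; [exact: cf|exact: cg].
Qed.

Lemma pcont_mul f g : pcont f -> pcont g -> pcont (fun x => f x * g x).
Proof.
move=> pf pg i iM; have [f' cf ff] := pf i iM; have [g' cg gg] := pg i iM.
exists (fun x => f' x * g' x) => [|x xi]; last by rewrite ff// gg.
by move=> x; apply: cvgM; [exact: cf|exact: cg].
Qed.

Lemma pcont_eq f g : (forall x, opn x -> f x = g x) -> pcont f -> pcont g.
Proof.
move=> fg pf i iM; have [f' cf ff] := pf i iM; exists f' => // x xi.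
by rewrite -fg ?ff//; exists i.
Qed.

Lemma pder_cont F f : pder F f -> {within `[0, 1], continuous F}.
Proof. by case. Qed.

Lemma pder_pcontl F f : pder F f -> pcont F.
Proof. by case=> /within_pcont. Qed.

Lemma pder_pcontr F f : pder F f -> pcont f.
Proof. by case. Qed.

Lemma pder_lin F f G g c d : pder F f -> pder G g ->
  pder (fun x => c * F x + d * G x) (fun x => c * f x + d * g x).
Proof.
move=> [cF pf dF] [cG pg dG]; split.
- by move=> x; apply: cvgD; apply: cvgMr; [exact: cF|exact: cG].
- exact: pcont_lin.
- move=> x ox; have := dF x ox; have := dG x ox => dGx dFx.
  have := is_deriveD (is_deriveZ c dFx) (is_deriveZ d dGx).
  exact.
Qed.

Lemma pder_mul F f G g : pder F f -> pder G g ->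
  pder (fun x => F x * G x) (fun x => f x * G x + F x * g x).
Proof.
move=> PF PG; have pF := pder_pcontl PF; have pG := pder_pcontl PG.
move: PF PG => [cF pf dF] [cG pg dG]; split.
- by move=> x; apply: cvgM; [exact: cF|exact: cG].
- apply: (pcont_eq (f := fun x => 1 * (f x * G x) + 1 * (F x * g x))).
    by move=> x _; rewrite !mul1r.
  by apply: pcont_lin; exact: pcont_mul.
- move=> x ox; have := dF x ox; have := dG x ox => dGx dFx.
  have := is_deriveM dFx dGx.
  by rewrite addrC [G x *: _]mulrC.
Qed.

Lemma pder_cst c : pder (fun=> c) (fun=> 0).
Proof.
split; first by apply: continuous_subspaceT => x; exact: cvg_cst.
  exact: pcont_cst.
by move=> x _; exact: is_derive_cst.
Qed.

Lemma pder_eqr F f g : (forall x, opn x -> f x = g x) -> pder F f -> pder F g.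
Proof.
move=> fg [cF pf dF]; split=> // [|x ox]; first exact: pcont_eq pf.
by rewrite -fg//; exact: dF.
Qed.

Lemma is_derive_eql (F G : R -> R) x l d : 0 < d ->
  (forall y, `|y - x| < d -> F y = G y) -> is_derive x 1 F l -> is_derive x 1 G l.
Proof.
move=> d0 FG; apply: near_eq_is_derive; apply/nbhs_ballP; exists d => //= y.
by rewrite /ball/= distrC => /FG.
Qed.

Lemma pder_eql F G f : (forall x, x \in `[0, 1] -> F x = G x) -> pder F f -> pder G f.
Proof.
move=> FG [cF pf dF]; split=> // [|x ox].
  by apply: eq_within_continuous cF.
have [e e0 He] := opn_near ox.
apply: (is_derive_eql e0 _ (dF x ox)) => y /He /opn_itv yoo.
by apply: FG; exact: subset_itv_oo_cc.
Qed.

(** Newton-Leibniz on each piece, summed over the partition. *)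
Lemma pder_FTC F f : pder F f -> \int[mu]_(x in `]0, 1[) f x = F 1 - F 0.
Proof.
move=> [cF pf dF]; case: (part) => x0 xM lt_xs.
have piece i : (i < M)%N ->
    \int[mu]_(x in `]xs i, xs i.+1[) f x = F (xs i.+1) - F (xs i).
  move=> iM; have [g cg fg] := pf i iM; have [a b c] := partition_itv iM.
  rewrite (@eq_Rintegral _ _ _ mu _ g); last by move=> x; rewrite inE => /fg.
  have ig : mu.-integrable `[xs i, xs i.+1] (EFin \o g).
    by apply: continuous_compact_integrable => //; exact: segment_compact.
  rewrite Rintegral_itv_bndo_bndc; last first.
    by apply: integrableS ig => //; exact: subset_itv_oo_cc.
  rewrite Rintegral_itv_obnd_cbnd; last first.
    by apply: integrableS ig => //; exact: subset_itv_oc_cc.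
  rewrite /Rintegral (@continuous_FTC2 _ g F)//.
  - have cFi : {within `[xs i, xs i.+1], continuous F}.
      by apply: within_continuousW cF; apply: subset_itv; rewrite bnd_simp.
    have /continuous_within_itvP[//|_ cl cr] := cFi.
    split=> // x xi; have ox : opn x by exists i.
    by case: (dF x ox).
  - move=> x xi; have ox : opn x by exists i.
    by have := dF x ox => dFx; rewrite derive1E derive_val -fg.
suff H m : (m < M)%N -> \int[mu]_(x in `]0, xs m.+1[) f x = F (xs m.+1) - F 0.
  by rewrite -{1 2}xM; move: partition_gt0 H; case: M => // m _; apply.
elim: m => [|m IH] mM; first by rewrite -x0; exact: piece.
rewrite (@Rintegral_join _ _ (xs m.+1)).
- by rewrite IH ?(ltnW mM)// piece// addrC addrA subrK.
- rewrite -x0; apply: lt_le_trans (lt_xs 0%N partition_gt0) _.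
  by rewrite (partition_le part)//= ltnW.
- exact: lt_xs.
- have [mf [K fK]] := pcont_bm pf.
  have s : (`]0, xs m.+2[%classic : set R) `<=` `]0, 1[.
    by have [_ _ c] := partition_itv mM; apply: subset_itvl; rewrite bnd_simp.
  split; first by apply: measurable_funS mf.
  by exists K => x /s; exact: fK.
Qed.

End Piecewise.

(** * The inner product of square integrable functions *)

Section Inner_product.
Context {R : realType}.
Notation mu := (@lebesgue_measure R).
Implicit Types (f g k F G : R -> R) (a b x c d : R).

Lemma ipC f g : ip f g = ip g f.
Proof. by rewrite /ip; under eq_Rintegral do rewrite mulrC. Qed.

Lemma ip_linl f g k c d : bm f -> bm g -> bm k ->
  ip (fun x => c * f x + d * g x) k = c * ip f k + d * ip g k.
Proof.
move=> bf bg bk; rewrite /ip.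
under eq_Rintegral do rewrite mulrDl -!mulrA.
have h1 := bm_integrable (bm_mul bf bk); have h2 := bm_integrable (bm_mul bg bk).
rewrite RintegralD//; first by rewrite !RintegralZl.
- have := bm_integrable (bm_mul (bm_cst _ c) (bm_mul bf bk)); exact.
- have := bm_integrable (bm_mul (bm_cst _ d) (bm_mul bg bk)); exact.
Qed.

Lemma ip_linr f g k c d : bm f -> bm g -> bm k ->
  ip k (fun x => c * f x + d * g x) = c * ip k f + d * ip k g.
Proof. by move=> bf bg bk; rewrite ipC ip_linl// !(ipC k). Qed.

Lemma eq_ip f f' g g' : (forall x, x \in `]0, 1[ -> f x = f' x) ->
  (forall x, x \in `]0, 1[ -> g x = g' x) -> ip f g = ip f' g'.
Proof.
by move=> ff gg; apply: eq_Rintegral => x; rewrite inE => /= xi; rewrite ff// gg.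
Qed.

Lemma ip_ge0 f : 0 <= ip f f.
Proof. by apply: Rintegral_ge0 => x _; rewrite -expr2 sqr_ge0. Qed.

Lemma eq_L2norm f g : (forall x, x \in `]0, 1[ -> f x = g x) -> L2norm f = L2norm g.
Proof. by move=> fg; rewrite /L2norm (eq_ip fg fg). Qed.

Lemma L2norm_ge0 f : 0 <= L2norm f.
Proof. exact: sqrtr_ge0. Qed.

Lemma L2norm_sqr f : L2norm f ^+ 2 = ip f f.
Proof. by rewrite sqr_sqrtr// ip_ge0. Qed.

Lemma cauchy_schwarz f g : bm f -> bm g -> `|ip f g| <= L2norm f * L2norm g.
Proof.
move=> bf bg; rewrite -ler_sqr ?nnegrE ?mulr_ge0 ?L2norm_ge0//.
rewrite real_normK ?num_real// exprMn !L2norm_sqr.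
(* The quadratic form of the combination [s f + t g] is nonnegative; it is used at
   [s = <g, g>] and [t = - <f, g>]. *)
have H s t : 0 <= s ^+ 2 * ip f f + 2 * s * t * ip f g + t ^+ 2 * ip g g.
  have := ip_ge0 (fun x => s * f x + t * g x).
  rewrite ip_linl//; last exact: bm_lin.
  rewrite !ip_linr// (ipC g f).
  set A := ip f f; set B := ip f g; set D := ip g g.
  by congr (0 <= _); ring.
have := H (ip g g) (- ip f g).
have f0 := ip_ge0 f; have g0 := ip_ge0 g.
have [gz|gn] := eqVneq (ip g g) 0.
  move=> _; rewrite gz mulr0.
  (* Here the form is affine in [t], hence would take negative values. *)
  have [->|B0] := eqVneq (ip f g) 0; first by rewrite expr0n.
  have := H 1 (- (ip f f + 1) / (2 * ip f g)); rewrite gz mulr0 addr0.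
  have -> : 2 * 1 * (- (ip f f + 1) / (2 * ip f g)) * ip f g = - (ip f f + 1).
    by field.
  by rewrite expr1n mul1r => h; exfalso; lra.
have gp : 0 < ip g g by rewrite lt_def gn.
move: gp; set A := ip f f; set B := ip f g; set D := ip g g => D0 h.
rewrite -subr_ge0 -(pmulr_rge0 _ D0).
by move: h; congr (0 <= _); ring.
Qed.

Lemma le_cauchy_schwarz f g : bm f -> bm g -> ip f g <= L2norm f * L2norm g.
Proof. by move=> bf bg; rewrite (le_trans (ler_norm _))// cauchy_schwarz. Qed.

Lemma L2norm_lin f g c d : bm f -> bm g ->
  L2norm (fun x => c * f x + d * g x) <= `|c| * L2norm f + `|d| * L2norm g.
Proof.
move=> bf bg.
rewrite -ler_sqr ?nnegrE ?addr_ge0 ?mulr_ge0 ?L2norm_ge0//.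
rewrite L2norm_sqr ip_linl//; last exact: bm_lin.
rewrite !ip_linr// (ipC g f) -!L2norm_sqr.
have h := cauchy_schwarz bf bg.
have hh : c * d * ip f g <= `|c| * `|d| * (L2norm f * L2norm g).
  by rewrite (le_trans (ler_norm _))// !normrM ler_wpM2l// mulr_ge0.
have c2 : `|c| ^+ 2 = c ^+ 2 by rewrite real_normK ?num_real.
have d2 : `|d| ^+ 2 = d ^+ 2 by rewrite real_normK ?num_real.
rewrite sqrrD !exprMn c2 d2.
set A := L2norm f in hh *; set B := L2norm g in hh *; set I := ip f g in hh *.
move: hh; set C := `|c|; set D := `|d| => hh.
rewrite -subr_ge0; rewrite -subr_ge0 in hh.
have -> : c ^+ 2 * A ^+ 2 + C * A * (D * B) *+ 2 + d ^+ 2 * B ^+ 2 -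
   (c * (c * A ^+ 2 + d * I) + d * (c * I + d * B ^+ 2)) =
   2 * (C * D * (A * B) - c * d * I) by rewrite mulr2n; ring.
by rewrite mulr_ge0.
Qed.

Lemma L2norm_le f g (K : R) : 0 <= K -> bm f -> bm g ->
  (forall x, x \in `]0, 1[ -> `|f x| <= K * `|g x|) -> L2norm f <= K * L2norm g.
Proof.
move=> K0 bf bg fg; rewrite -ler_sqr ?nnegrE ?mulr_ge0 ?L2norm_ge0//.
rewrite exprMn !L2norm_sqr /ip -RintegralZl//; last exact: bm_integrable (bm_mul bg bg).
apply: le_Rintegral => //; first exact: bm_integrable (bm_mul bf bf).
  exact: bm_integrable (bm_mul (bm_cst _ _) (bm_mul bg bg)).
move=> x xi; rewrite -!expr2 -exprMn -real_normK ?num_real//.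
rewrite -[leRHS]real_normK ?num_real// ler_sqr ?nnegrE// normrM (ger0_norm K0).
exact: fg.
Qed.

Lemma ip_cst1 : ip (fun=> 1) (fun=> 1) = 1 :> R.
Proof.
rewrite /ip; under eq_Rintegral do rewrite mulr1.
rewrite Rintegral_cst// mul1r.
have := @lebesgue_measure_itv R `]0, 1[.
rewrite /= lte_fin ltr01 -EFinB subr0 => E.
by transitivity (fine (1%:E : \bar R)) => //; congr fine; exact: E.
Qed.

Lemma L2norm_cst1 : L2norm (fun=> 1) = 1 :> R.
Proof. by rewrite /L2norm ip_cst1 sqrtr1. Qed.

Lemma ip_cst0l f : ip (fun=> 0) f = 0.
Proof.
by rewrite /ip; under eq_Rintegral do rewrite mul0r; rewrite Rintegral_cst// mul0r.
Qed.

Lemma L2norm_bound f (K : R) : 0 <= K -> bm f ->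
  (forall x, x \in `]0, 1[ -> `|f x| <= K) -> L2norm f <= K.
Proof.
move=> K0 bf fK; have -> : K = K * L2norm (fun=> 1).
  by rewrite /L2norm ip_cst1 sqrtr1 mulr1.
by apply: L2norm_le => //; [exact: bm_cst|move=> x /fK; rewrite normr1 mulr1].
Qed.

End Inner_product.

(** * Integration by parts, trace and Poincare inequalities *)

Section Piecewise_integration.
Context {R : realType}.
Variables (M : nat) (xs : nat -> R).
Hypothesis part : is_partition 1 M xs.
Implicit Types (f g k F G : R -> R) (a b x c d : R).

Notation pcont := (pcont M xs).
Notation pder := (pder M xs).
Notation opn := (opn M xs).

(** The points excluded from the open pieces do not matter: the integral of a
function vanishing on the pieces is the increment of the zero function. *)
Lemma piecewise_eq_ip f f' g : (forall x, opn x -> f x = f' x) ->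
  pcont f -> pcont g -> ip f g = ip f' g.
Proof.
move=> ff pf pg; have pf' : pcont f' by exact: pcont_eq pf.
have [bf bf' bg] : [/\ bm f, bm f' & bm g].
  by split; apply: (pcont_bm part).
apply/eqP; rewrite -subr_eq0; apply/eqP.
have -> : ip f g - ip f' g = ip (fun x => 1 * f x + (- 1) * f' x) g.
  by rewrite ip_linl// mul1r mulN1r.
have := @pder_FTC _ _ _ part (fun=> 0) (fun x => (1 * f x + (- 1) * f' x) * g x).
rewrite /ip subrr => -> //; apply: (pder_eqr _ (@pder_cst _ _ _ part 0)) => x ox.
by rewrite ff// mul1r mulN1r subrr mul0r.
Qed.

Lemma ip_pder F f G g : pder F f -> pder G g ->
  ip F g + ip f G = F 1 * G 1 - F 0 * G 0.
Proof.
move=> PF PG; have := pder_FTC part (pder_mul part PF PG) => <-.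
have [bF bf bG bg] : [/\ bm F, bm f, bm G & bm g].
  by move: (pder_pcontl part PF) (pder_pcontl part PG) (pder_pcontr PF)
    (pder_pcontr PG) => *; split; apply: (pcont_bm part).
rewrite /ip RintegralD// 1?addrC//; exact: bm_integrable (bm_mul _ _).
Qed.

Lemma pder_id : pder (fun x => x) (fun=> 1).
Proof.
split.
- by apply: continuous_subspaceT => x.
- exact: (@pcont_cst _ _ _ part).
- by move=> x _; exact: is_derive_id.
Qed.

(** Integrate the derivative of [x * F x ^ 2]. *)
Lemma trace_sqr_le F f : pder F f ->
  F 1 ^+ 2 <= L2norm F ^+ 2 + 2 * L2norm F * L2norm f.
Proof.
move=> PF; have := ip_pder PF (pder_mul part pder_id PF).
have pF := pder_pcontl part PF; have pf := pder_pcontr PF.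
have px := pder_pcontl part pder_id.
have [bF bf bx] : [/\ bm F, bm f & bm (fun x : R => x)].
  by split; apply: (pcont_bm part).
have -> : ip F (fun x => 1 * F x + x * f x) = ip F F + ip F (fun x => x * f x).
  rewrite -[RHS]addr0 -[ip F F]mul1r -[ip F (fun x => x * f x)]mul1r addr0.
  rewrite -ip_linr//; last exact: bm_mul.
  by apply: eq_ip => // x _; rewrite !mul1r.
have -> : ip f (fun x => x * F x) = ip F (fun x => x * f x).
  by rewrite /ip; apply: eq_Rintegral => x _; ring.
rewrite mul1r mul0r mulr0 subr0 -expr2 => <-.
have h1 : L2norm (fun x => x * f x) <= L2norm f.
  rewrite -[leRHS]mul1r; apply: L2norm_le => //; first exact: bm_mul.
  move=> x; rewrite in_itv/= => /andP[x0 x1]; rewrite mul1r normrM (gtr0_norm x0).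
  by rewrite ler_piMl// ltW.
have h2 : ip F (fun x => x * f x) <= L2norm F * L2norm f.
  rewrite (le_trans (le_cauchy_schwarz _ _))//; first exact: bm_mul.
  by rewrite ler_wpM2l// L2norm_ge0.
rewrite L2norm_sqr -!addrA lerD2l; move: h2; lra.
Qed.

Lemma trace_le F f : pder F f -> `|F 1| <= L2norm F + L2norm f.
Proof.
move=> /trace_sqr_le h; rewrite -ler_sqr ?nnegrE ?addr_ge0 ?L2norm_ge0//.
rewrite real_normK ?num_real// (le_trans h)// sqrrD mulr2n.
have := sqr_ge0 (L2norm f); lra.
Qed.

(** Integrate the derivative of [(1 - x) * F x ^ 2], which vanishes at both ends. *)
Lemma poincare F f : pder F f -> F 0 = 0 -> L2norm F <= 2 * L2norm f.
Proof.
move=> PF F0.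
have P1 : pder (fun x => 1 * 1 + (-1) * x) (fun x => 1 * 0 + (-1) * 1).
  exact: pder_lin (@pder_cst _ _ _ part 1) pder_id.
have := ip_pder PF (pder_mul part P1 PF).
have pF := pder_pcontl part PF; have pf := pder_pcontr PF.
have px := pder_pcontl part P1.
have [bF bf bx] : [/\ bm F, bm f & bm (fun x : R => 1 * 1 + (-1) * x)].
  by split; apply: (pcont_bm part).
set q := (fun x : R => 1 * 1 + (-1) * x) in bx px *.
have -> : ip F (fun x => (1 * 0 + (-1) * 1) * F x + q x * f x) =
   (-1) * ip F F + 1 * ip F (fun x => q x * f x).
  rewrite -ip_linr//; last exact: bm_mul.
  by apply: eq_ip => // x _; ring.
have -> : ip f (fun x => q x * F x) = ip F (fun x => q x * f x).
  by rewrite /ip; apply: eq_Rintegral => x _; ring.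
have -> : F 1 * ((1 * 1 + -1 * 1) * F 1) - F 0 * ((1 * 1 + -1 * 0) * F 0) = 0.
  by rewrite F0; ring.
rewrite mul1r mulN1r => E.
have h1 : L2norm (fun x => q x * f x) <= L2norm f.
  rewrite -[leRHS]mul1r; apply: L2norm_le => //; first exact: bm_mul.
  move=> x; rewrite in_itv/= => /andP[x0 x1].
  rewrite mul1r normrM ler_piMl// ler_norml /q; apply/andP; split; lra.
have h2 : ip F (fun x => q x * f x) <= L2norm F * L2norm f.
  rewrite (le_trans (le_cauchy_schwarz _ _))//; first exact: bm_mul.
  by rewrite ler_wpM2l// L2norm_ge0.
have h3 := L2norm_ge0 F; have h4 := L2norm_ge0 f.
move: E h2; rewrite -L2norm_sqr; nra.
Qed.

Lemma endpoint_le F f : pder F f -> F 0 = 0 -> `|F 1| <= L2norm f.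
Proof.
move=> PF F0; have := ip_pder PF (@pder_cst _ _ _ part 1).
have bf : bm f by apply: (pcont_bm part); exact: pder_pcontr PF.
have bF : bm F by apply: (pcont_bm part); exact: (pder_pcontl part PF).
have -> : ip F (fun=> 0) = 0.
  by rewrite /ip; under eq_Rintegral do rewrite mulr0; rewrite Rintegral_cst// mul0r.
rewrite add0r F0 mul0r subr0 mulr1 => <-.
rewrite (le_trans (cauchy_schwarz _ _))//; first exact: bm_cst.
by rewrite {2}/L2norm ip_cst1 sqrtr1 mulr1.
Qed.

End Piecewise_integration.

(** * Weak derivatives *)

Section Weak_derivatives.
Context {R : realType}.
Variables (M : nat) (xs : nat -> R).
Hypothesis part : is_partition 1 M xs.
Implicit Types (f g k F G v : R -> R) (a b x c : R).
Notation mu := (@lebesgue_measure R).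
Notation pcont := (pcont M xs).
Notation pder := (pder M xs).
Notation opn := (opn M xs).

Lemma pder_interior F f : {within `[0, 1], continuous F} ->
  {within `[0, 1], continuous f} ->
  (forall x, x \in `]0, 1[ -> is_derive x 1 F (f x)) -> pder F f.
Proof.
move=> cF cf dF; split=> //; first exact: (within_pcont part).
by move=> x /(opn_itv part); exact: dF.
Qed.

Lemma primitive_exists f : {within `[0, 1], continuous f} ->
  exists2 G, pder G f & G 0 = 0.
Proof.
move=> cf; have itf : mu.-integrable `[0, 1] (EFin \o f).
  by apply: continuous_compact_integrable => //; exact: segment_compact.
exists (fun x => parameterized_integral mu 0 x f); last first.
  by rewrite /parameterized_integral set_itv1 Rintegral_set1.
apply: pder_interior => //; first exact: parameterized_integral_continuous.
move=> x xi; have := xi; rewrite in_itv/= => /andP[x0 x1].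
have [|dG G'] := @continuous_FTC1_closed _ f 0 x 1 x1 itf x0.
  exact: within_continuous_continuous cf xi.
apply: DeriveDef; first exact: dG.
by rewrite -derive1E; exact: G'.
Qed.

Lemma test_fun_support (phi : R -> R) a b n :
  (forall x, x \notin `[a, b] -> phi x = 0) ->
  forall x, x \notin `[a, b] -> derive1n n phi x = 0.
Proof.
move=> H; elim: n => [|n IH] x xab; first exact: H.
rewrite derive1nS derive1E; suff D : is_derive x 1 (derive1n n phi) 0 by rewrite derive_val.
move: xab; rewrite in_itv/= negb_and -!ltNge => xab.
pose e := Num.max (a - x) (x - b).
have e0 : 0 < e by rewrite lt_max !subr_gt0.
apply: (@is_derive_eql _ (fun=> 0) _ x 0 e e0) => y.
rewrite lt_max => yx; rewrite IH// in_itv/= negb_and -!ltNge.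
by move: yx => /orP[]; rewrite ltr_norml => /andP[y1 y2]; apply/orP; [left|right]; lra.
Qed.

Lemma pder_test (phi : R -> R) n : (forall n x, derivable (derive1n n phi) x 1) ->
  pder (derive1n n phi) (derive1n n.+1 phi).
Proof.
move=> H; have C m : {within `[0, 1], continuous (derive1n m phi)}.
  apply: continuous_subspaceT => x; apply: differentiable_continuous.
  by apply/derivable1_diffP; exact: H.
apply: (pder_interior (C n) (C n.+1)) => x _.
apply: DeriveDef; first exact: (H n x).
by rewrite derive1nS derive1E.
Qed.

Lemma chain_pcont s (d : nat -> R -> R) :
  (forall l, (l < s)%N -> pder (d l) (d l.+1)) -> pcont (d s) ->
  forall l, (l <= s)%N -> pcont (d l).
Proof.
move=> dd ds l; rewrite leq_eqVlt => /predU1P[->//|ls].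
exact: (pder_pcontl part (dd l ls)).
Qed.

(** Classical derivatives, even if only piecewise, are weak derivatives: this is
integration by parts against a test function. *)
Lemma chain_in_H s (d : nat -> R -> R) :
  (forall l, (l < s)%N -> pder (d l) (d l.+1)) -> pcont (d s) -> in_H s (d 0%N) d.
Proof.
move=> dd ds; split=> // l ls; have pd := chain_pcont dd ds.
split.
  have bd : bm (d l) by apply: (pcont_bm part); exact: pd.
  split; first by case: bd.
  by have := bm_integrable (bm_mul bd bd).
move=> phi [dphi [a [b [a0 b1 supp]]]].
have van n x : x = 0 \/ x = 1 -> derive1n n phi x = 0.
  move=> x01; apply: (test_fun_support n supp).
  by rewrite in_itv/= negb_and -!ltNge; case: x01 => ->; rewrite ?a0 ?b1 ?orbT.
suff H j : (j <= l)%N -> ip (d 0%N) (derive1n l phi) = (-1) ^+ j * ip (d j) (derive1n (l - j) phi).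
  by rewrite (H l (leqnn l)) subnn.
elim: j => [|j IH] jl; first by rewrite expr0 mul1r subn0.
rewrite IH ?(ltnW jl)// exprSr -mulrA; congr (_ * _).
have -> : (l - j = (l - j.+1).+1)%N by rewrite subnSK.
have := ip_pder part (dd j (leq_trans jl ls)) (pder_test (l - j.+1) dphi).
rewrite !van; [|by left|by right].
by rewrite !mulr0 subrr mulN1r => /eqP; rewrite addr_eq0 => /eqP.
Qed.

Lemma chain_in_H0 s (d : nat -> R -> R) : (0 < s)%N ->
  (forall l, (l < s)%N -> pder (d l) (d l.+1)) -> pcont (d s) -> d 0%N 0 = 0 ->
  in_H0 s (d 0%N) d.
Proof.
move=> s0 dd ds d0; split=> //; first exact: chain_in_H.
exact: pder_cont (dd 0%N s0).
Qed.

Lemma Cn_in_continuous n v l : Cn_in `[0, 1] n v -> (l <= n)%N ->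
  {within `[0, 1], continuous (derivs v l)}.
Proof.
move=> [dv cv]; rewrite leq_eqVlt => /predU1P[->//|ln].
by apply: derivable_in_within; exact: dv.
Qed.

Lemma Cn_in_pder n v l : Cn_in `[0, 1] n v -> (l < n)%N ->
  pder (derivs v l) (derivs v l.+1).
Proof.
move=> Cv ln; apply: pder_interior; [exact: Cn_in_continuous Cv (ltnW ln)
  |exact: Cn_in_continuous Cv ln|].
move=> x xi; rewrite /derivs iterS; apply: deriv_in_interior => //.
case: Cv => dv _; apply: dv => //; exact: subset_itv_oo_cc.
Qed.

(** ** Functions with two derivatives *)

(** Satisfied both by finite element functions and by smooth ones; the first
derivative exists at the end points as well, where its value enters the scheme. *)
Definition adm v := (forall x, x \in `[0, 1] -> derivable_in `[0, 1] v x) /\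
  pder (dx v) (dx (dx v)).

Lemma adm_pder v : adm v -> pder v (dx v).
Proof.
move=> [dv /pder_cont cv]; apply: pder_interior => //.
  exact: derivable_in_within.
move=> x xi; apply: deriv_in_interior => //; apply: dv; exact: subset_itv_oo_cc.
Qed.

Lemma Cn_in_adm n v : Cn_in `[0, 1] n.+2 v -> adm v.
Proof.
move=> Cv; split; last exact: (Cn_in_pder (l := 1%N) Cv).
by case: Cv => dv _; exact: (dv 0%N isT).
Qed.

Lemma piecewise_poly_adm v : Cn_in `[0, 1] 1 v ->
  (forall i, (i < M)%N -> exists p : {poly R}, forall x, x \in `[xs i, xs i.+1] -> v x = p.[x]) ->
  adm v.
Proof.
move=> Cv pv; split; first by case: Cv => dv _; exact: (dv 0%N isT).
have near i p y : (i < M)%N -> (forall x, x \in `[xs i, xs i.+1] -> v x = p.[x]) ->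
    y \in `]xs i, xs i.+1[ -> dx v y = p^`().[y].
  move=> iM Hp yi; have oy : opn y by exists i.
  have [d d0 Hd] := itvoo_near yi.
  apply: (@is_derive_deriv_in _ 0 1 v y _ (opn_itv part oy) _).2.
  apply: (@is_derive_eql _ (horner p) v y _ d d0) => z /Hd zi.
  by rewrite Hp//; exact: subset_itv_oo_cc.
have near2 i p y : (i < M)%N -> (forall x, x \in `[xs i, xs i.+1] -> v x = p.[x]) ->
    y \in `]xs i, xs i.+1[ -> is_derive y 1 (dx v) p^`()^`().[y].
  move=> iM Hp yi; have [d d0 Hd] := itvoo_near yi.
  apply: (@is_derive_eql _ (horner p^`()) (dx v) y _ d d0) => z /Hd zi.
  by rewrite (near i p).
have eq2 i p y : (i < M)%N -> (forall x, x \in `[xs i, xs i.+1] -> v x = p.[x]) ->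
    y \in `]xs i, xs i.+1[ -> dx (dx v) y = p^`()^`().[y].
  move=> iM Hp yi; have oy : opn y by exists i.
  exact: (@is_derive_deriv_in _ 0 1 _ y _ (opn_itv part oy) (near2 i p y iM Hp yi)).2.
split; first exact: Cn_in_continuous Cv (leqnn _).
- move=> i iM; have [p Hp] := pv i iM.
  exists (horner p^`()^`()) => [|x xi]; last exact: (eq2 i p).
  by apply: continuous_subspaceT => x; exact: continuous_horner.
- move=> x [i iM xi]; have [p Hp] := pv i iM.
  by rewrite (eq2 i p)//; exact: (near2 i p).
Qed.

Lemma dx_lin v w c d x : adm v -> adm w -> x \in `[0, 1] ->
  dx (fun y => c * v y + d * w y) x = c * dx v x + d * dx w x.
Proof.
by move=> [dv _] [dw _] xi; apply: (deriv_in_lin c d ltr01 xi (dv x xi) (dw x xi)).2.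
Qed.

Lemma ddx_lin v w c d x : adm v -> adm w -> opn x ->
  dx (dx (fun y => c * v y + d * w y)) x = c * dx (dx v) x + d * dx (dx w) x.
Proof.
move=> av aw ox; have xi := opn_itv part ox.
have [_ _ dd] := pder_lin c d av.2 aw.2.
apply: (@is_derive_deriv_in _ 0 1 _ x _ xi _).2.
have [e e0 He] := opn_near ox.
apply: (@is_derive_eql _ _ _ x _ e e0 _ (dd x ox)) => y /He oy.
by rewrite dx_lin//; exact/subset_itv_oo_cc/(opn_itv part).
Qed.

Lemma adm_lin v w c d : adm v -> adm w -> adm (fun y => c * v y + d * w y).
Proof.
move=> av aw; split=> [x xi|].
  by apply: (deriv_in_lin c d ltr01 xi (av.1 x xi) (aw.1 x xi)).1.
apply: (@pder_eqr _ _ _ _ (fun x => c * dx (dx v) x + d * dx (dx w) x)).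
  by move=> x ox; rewrite ddx_lin.
apply: (@pder_eql _ _ _ part (fun x => c * dx v x + d * dx w x)).
  by move=> x xi; rewrite dx_lin.
exact: (pder_lin c d av.2 aw.2).
Qed.

Lemma adm_bm1 v : adm v -> bm (dx v).
Proof. by move=> av; apply: (pcont_bm part); exact: (pder_pcontl part av.2). Qed.

Lemma adm_pcont2 v : adm v -> pcont (dx (dx v)).
Proof. by move=> av; exact: pder_pcontr av.2. Qed.

Lemma adm_bm2 v : adm v -> bm (dx (dx v)).
Proof. by move=> /adm_pcont2; exact: (pcont_bm part). Qed.

End Weak_derivatives.

Local Notation formB := Defs.formB.

(** * The energy form and the elliptic projection *)

Section Energy_form.
Context {R : realType}.
Implicit Types (f g k p q : R -> R) (c d x : R).

Lemma bm_sub (A : set R) f g : bm_on A f -> bm_on A g -> bm_on A (fun x => f x - g x).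
Proof.
move=> bf bg; apply: bm_eq (bm_lin 1 (-1) bf bg) => x _.
by rewrite mul1r mulN1r.
Qed.

Lemma ip_subl f g k : bm f -> bm g -> bm k ->
  ip (fun x => f x - g x) k = ip f k - ip g k.
Proof.
move=> bf bg bk; rewrite -[ip f k]mul1r -mulN1r -ip_linl//.
by apply: eq_ip => // x _; rewrite mul1r mulN1r.
Qed.

Lemma ip_subr f g k : bm f -> bm g -> bm k ->
  ip k (fun x => f x - g x) = ip k f - ip k g.
Proof. by move=> bf bg bk; rewrite ipC ip_subl// !(ipC k). Qed.

Lemma L2norm_sub f g : bm f -> bm g ->
  L2norm (fun x => f x - g x) <= L2norm f + L2norm g.
Proof.
move=> bf bg; have := L2norm_lin 1 (-1) bf bg; rewrite normrN normr1 !mul1r.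
apply: le_trans; rewrite /L2norm le_eqVlt; apply/orP; left; apply/eqP.
by congr Num.sqrt; apply: eq_ip => x _; rewrite mul1r mulN1r.
Qed.

Lemma L2norm_add f g : bm f -> bm g ->
  L2norm (fun x => f x + g x) <= L2norm f + L2norm g.
Proof.
move=> bf bg; have := L2norm_lin 1 1 bf bg; rewrite normr1 !mul1r.
apply: le_trans; rewrite /L2norm le_eqVlt; apply/orP; left; apply/eqP.
by congr Num.sqrt; apply: eq_ip => x _; rewrite !mul1r.
Qed.

(** The norm attached to [gammastar], as a function of the first and second
derivatives, since the dual function below is only known through its derivatives. *)
Definition energy f1 f2 := Num.sqrt (ip f2 f2 + ip f1 f1).

Lemma energy_ge0 f1 f2 : 0 <= energy f1 f2. Proof. exact: sqrtr_ge0. Qed.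

Lemma energy_sqr f1 f2 : energy f1 f2 ^+ 2 = ip f2 f2 + ip f1 f1.
Proof. by rewrite sqr_sqrtr// addr_ge0// ip_ge0. Qed.

Lemma energy_cauchy_schwarz f1 f2 g1 g2 : bm f1 -> bm f2 -> bm g1 -> bm g2 ->
  `|ip f2 g2 + ip f1 g1| <= energy f1 f2 * energy g1 g2.
Proof.
move=> bf1 bf2 bg1 bg2.
rewrite -ler_sqr ?nnegrE ?mulr_ge0 ?energy_ge0// exprMn !energy_sqr -!L2norm_sqr.
have h1 := cauchy_schwarz bf1 bg1; have h2 := cauchy_schwarz bf2 bg2.
have := le_trans (ler_normD (ip f2 g2) (ip f1 g1)) (lerD h2 h1).
have := L2norm_ge0 f1; have := L2norm_ge0 f2; have := L2norm_ge0 g1; have := L2norm_ge0 g2.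
set a := L2norm f1; set b := L2norm f2; set c := L2norm g1; set d := L2norm g2.
move=> d0 c0 b0 a0 H; apply: (@le_trans _ _ ((b * d + a * c) ^+ 2)).
  by rewrite ler_sqr ?nnegrE// addr_ge0// mulr_ge0.
rewrite -subr_ge0; have -> : (b ^+ 2 + a ^+ 2) * (d ^+ 2 + c ^+ 2) - (b * d + a * c) ^+ 2
  = (b * c - a * d) ^+ 2 by ring.
exact: sqr_ge0.
Qed.

Lemma energy_le_Hnorm (d : nat -> R -> R) : energy (d 1%N) (d 2%N) <= Hnorm 2 d.
Proof.
rewrite ler_wsqrtr// !big_ord_recl big_ord0/= addr0 -!L2norm_sqr.
by have := sqr_ge0 (L2norm (d 0%N)); lra.
Qed.

End Energy_form.

Section Galerkin.
Context {R : realType}.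
Variables (M : nat) (xs : nat -> R).
Hypothesis part : is_partition 1 M xs.
Implicit Types (f g k F G v w chi : R -> R) (a b x c d : R).
Notation pcont := (pcont M xs).
Notation pder := (pder M xs).
Notation opn := (opn M xs).
Notation adm := (adm M xs).

Lemma formBE v w : formB v w = ip (dx v) (dx w). Proof. by []. Qed.

Lemma formBstarE v w : formBstar v w = ip (dx (dx v)) (dx (dx w)). Proof. by []. Qed.

Lemma formB_linl v w chi c d : adm v -> adm w -> adm chi ->
  formB (fun x => c * v x + d * w x) chi = c * formB v chi + d * formB w chi.
Proof.
move=> av aw ac; rewrite /formB -ip_linl; [|exact: (adm_bm1 part)..].
apply: (piecewise_eq_ip part).
- by move=> x ox; rewrite (dx_lin (M := M) (xs := xs))//; exact/subset_itv_oo_cc/(opn_itv part).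
- exact: (pder_pcontl part (adm_lin part c d av aw).2).
- exact: (pder_pcontl part ac.2).
Qed.

Lemma formBstar_linl v w chi c d : adm v -> adm w -> adm chi ->
  formBstar (fun x => c * v x + d * w x) chi = c * formBstar v chi + d * formBstar w chi.
Proof.
move=> av aw ac; rewrite /formBstar -ip_linl; [|exact: (adm_bm2 part)..].
apply: (piecewise_eq_ip part).
- by move=> x ox; rewrite (ddx_lin part).
- exact: adm_pcont2 (adm_lin part c d av aw).
- exact: adm_pcont2 ac.
Qed.

Lemma formBC v w : formB v w = formB w v. Proof. exact: ipC. Qed.

Lemma gammastarE v w :
  gammastar v w = ip (dx (dx v)) (dx (dx w)) + ip (dx v) (dx w).
Proof. by []. Qed.

Lemma gammastarC v w : gammastar v w = gammastar w v.
Proof. by rewrite /gammastar /formBstar formBC ipC. Qed.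

Lemma gammastar_linl v w chi c d : adm v -> adm w -> adm chi ->
  gammastar (fun x => c * v x + d * w x) chi = c * gammastar v chi + d * gammastar w chi.
Proof.
by move=> av aw ac; rewrite /gammastar (formB_linl _ _ av aw ac) (formBstar_linl _ _ av aw ac) !mulrDr addrACA.
Qed.

Lemma adm_sum (I : Type) (s : seq I) (b : I -> R -> R) (c : I -> R) chi :
  (forall i, adm (b i)) -> adm chi ->
  adm (fun x => \sum_(i <- s) c i * b i x) /\
  gammastar (fun x => \sum_(i <- s) c i * b i x) chi = \sum_(i <- s) c i * gammastar (b i) chi.
Proof.
move=> ab ac; elim: s => [|i s [IH1 IH2]].
  have -> : (fun x => \sum_(i <- [::]) c i * b i x) = (fun x => 0 * chi x + 0 * chi x).
    by apply/funext => x; rewrite big_nil !mul0r addr0.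
  split; first exact: (adm_lin part 0 0).
  by rewrite gammastar_linl// !mul0r addr0 big_nil.
have -> : (fun x => \sum_(j <- i :: s) c j * b j x) =
    (fun x => c i * b i x + 1 * \sum_(j <- s) c j * b j x).
  by apply/funext => x; rewrite big_cons mul1r.
split; first exact: (adm_lin part (c i) 1 (ab i) IH1).
by rewrite gammastar_linl// IH2 big_cons mul1r.
Qed.

(** The Gram matrix of the form may be singular, but a vector in its kernel
represents a function of zero energy, which is orthogonal to everything by the
Cauchy-Schwarz inequality; hence the normal equations are always solvable. *)
Lemma elliptic_proj_exists (S : set (R -> R)) v : finite_dim_subspace S ->
  (forall chi, S chi -> adm chi) -> adm v -> exists w, is_elliptic_proj S v w.
Proof.
move=> [m [b Sb]] Sadm av.
have ab i : adm (b i).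
  apply: Sadm; rewrite Sb; exists (fun j => (j == i)%:R) => //.
  apply/funext => x; rewrite (bigD1 i)//= eqxx mul1r big1 ?addr0// => j /negbTE->.
  by rewrite mul0r.
pose A := \matrix_(i < m, j < m) gammastar (b i) (b j).
pose l := \row_(j < m) gammastar v (b j).
have [c cA] : exists c : 'rV[R]_m, c *m A = l.
  suff /submxP[c ->] : (l <= A)%MS by exists c.
  rewrite submxE; apply/eqP/matrixP => i k; rewrite !mxE.
  pose d j := cokermx A j k; pose D := fun x => \sum_(j < m) d j * b j x.
  have aD : adm D by exact: (adm_sum (index_enum _) d ab av).1.
  have gb j : gammastar (b j) D = 0.
    rewrite gammastarC (adm_sum _ d ab (ab j)).2.
    have /matrixP/(_ j k) := mulmx_coker A; rewrite !mxE => E; rewrite -[RHS]E.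
    by apply: eq_bigr => i' _; rewrite mxE mulrC gammastarC.
  have gDD : gammastar D D = 0.
    by rewrite (adm_sum _ d ab aD).2 big1// => j _; rewrite gb mulr0.
  have gvD : gammastar v D = 0.
    have := energy_cauchy_schwarz (adm_bm1 part av) (adm_bm2 part av)
      (adm_bm1 part aD) (adm_bm2 part aD).
    rewrite /energy -[X in _ <= _ * Num.sqrt X]/(gammastar D D) gDD sqrtr0 mulr0.
    by rewrite normr_le0 => /eqP.
  rewrite -[RHS]gvD gammastarC (adm_sum _ d ab av).2.
  by apply: eq_bigr => j _; rewrite mxE mulrC gammastarC.
exists (fun x => \sum_(i < m) c 0 i * b i x); split.
  by rewrite Sb; exists (c 0).
move=> chi Schi; have achi := Sadm _ Schi; move: Schi; rewrite Sb => -[e _ echi].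
rewrite -echi gammastarC (adm_sum _ e ab _).2; last exact: (adm_sum _ _ ab av).1.
rewrite [RHS]gammastarC (adm_sum _ e ab av).2; apply: eq_bigr => j _; congr (_ * _).
rewrite gammastarC (adm_sum _ (c 0) ab (ab j)).2.
have /matrixP/(_ 0 j) := cA; rewrite !mxE gammastarC => <-.
by apply: eq_bigr => i _; rewrite mxE.
Qed.

End Galerkin.

(** * Functions on the space-time rectangle *)

Lemma near_common_point (R : realType) (p q s e : R) :
  `|s - p| < e / 2 -> `|s - q| < e / 2 -> `|p - q| <= e.
Proof.
move=> sp sq; have -> : p - q = (s - q) - (s - p) by ring.
by rewrite (le_trans (ler_normB _ _))// [leRHS](splitr e) lerD// ltW.
Qed.

Section Rectangle.
Context {R : realType}.
Variable T : R.
Hypothesis T0 : 0 < T.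
Implicit Types (w z : R -> R -> R) (s t x y : R).

Definition rect_eq w z := forall t x, t \in `[0, T] -> x \in `[0, 1] -> w t x = z t x.

Lemma rect_continuousP w :
  {within `[0, T] `*` `[0, 1], continuous (fun q : R * R => w q.1 q.2)} <->
  (forall t x, t \in `[0, T] -> x \in `[0, 1] -> forall e, 0 < e -> exists2 d, 0 < d &
    forall s y, s \in `[0, T] -> y \in `[0, 1] -> `|s - t| < d -> `|y - x| < d ->
      `|w s y - w t x| < e).
Proof.
split=> [/subspace_continuousP H t x tT x1 e e0|H].
  have /cvgrPdist_lt/(_ e e0) := H (t, x) (conj tT x1).
  rewrite near_withinE => /nbhs_ballP[d /= d0 Hd].
  exists d => // s y sT y1 sd yd; rewrite distrC; apply: (Hd (s, y)) => //.
  by split; rewrite /ball/= distrC.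
apply/subspace_continuousP => -[t x] [/= tT x1]; apply/cvgrPdist_lt => e e0.
have [d d0 Hd] := H t x tT x1 e e0.
rewrite near_withinE; apply/nbhs_ballP; exists d => //= -[s y] [/= sd yd] [/= sT y1].
by rewrite distrC; apply: Hd => //; rewrite distrC.
Qed.

Lemma Cn_rect_continuous n w : Cn_rect T n w ->
  {within `[0, T] `*` `[0, 1], continuous (fun q : R * R => w q.1 q.2)}.
Proof. by case: n => [|n] []. Qed.

Lemma Cn_rectS n w : Cn_rect T n.+1 w -> Cn_rect T n w.
Proof.
elim: n w => [|n IH] w; first by move=> [cw _]; split.
move=> [cw [dw tw xw]]; split; first exact: cw.
by split; [exact: dw|exact: (IH _ tw)|exact: (IH _ xw)].
Qed.

Lemma Cn_rectW m n w : (m <= n)%N -> Cn_rect T n w -> Cn_rect T m w.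
Proof.
move=> mn; rewrite -(subnKC mn); elim: (n - m)%N => [|k IH]; first by rewrite addn0.
by rewrite addnS => /Cn_rectS.
Qed.

Lemma Cn_rect_pdt n w : Cn_rect T n.+1 w -> Cn_rect T n (pdt T w).
Proof. by move=> [_ []]. Qed.

Lemma Cn_rect_pdx n w : Cn_rect T n.+1 w -> Cn_rect T n (pdx w).
Proof. by move=> [_ []]. Qed.

Lemma Cn_rect_iter_pdt i n w : Cn_rect T (i + n) w -> Cn_rect T n (iter i (pdt T) w).
Proof.
elim: i n => [//|i IH] n; rewrite addSnnS iterS => /IH; exact: Cn_rect_pdt.
Qed.

Lemma Cn_rect_iter_pdx i n w : Cn_rect T (i + n) w -> Cn_rect T n (iter i (@pdx R) w).
Proof.
elim: i n => [//|i IH] n; rewrite addSnnS iterS => /IH; exact: Cn_rect_pdx.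
Qed.

Lemma rect_eq_pdt w z : rect_eq w z -> rect_eq (pdt T w) (pdt T z).
Proof.
move=> wz t x tT x1; apply: (eq_deriv_in (A := `[0, T]) _ tT).2 => s sT.
exact: wz.
Qed.

Lemma rect_eq_pdx w z : rect_eq w z -> rect_eq (pdx w) (pdx z).
Proof.
move=> wz t x tT x1; apply: (eq_deriv_in (A := `[0, 1]) _ x1).2 => y y1.
exact: wz.
Qed.

Lemma Cn_rect_slice_continuous_t n w x : Cn_rect T n w -> x \in `[0, 1] ->
  {within `[0, T], continuous (fun t => w t x)}.
Proof.
move=> /Cn_rect_continuous/rect_continuousP cw x1; apply/within_continuousP => t tT e e0.
have [d d0 Hd] := cw t x tT x1 e e0; exists d => // s sT sd.
by apply: Hd => //; rewrite subrr normr0.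
Qed.

Lemma Cn_rect_slice_continuous_x n w t : Cn_rect T n w -> t \in `[0, T] ->
  {within `[0, 1], continuous (w t)}.
Proof.
move=> /Cn_rect_continuous/rect_continuousP cw tT; apply/within_continuousP => x x1 e e0.
have [d d0 Hd] := cw t x tT x1 e e0; exists d => // y y1 yd.
by apply: Hd => //; rewrite subrr normr0.
Qed.

Lemma Cn_rect_is_derive_t n w t x : Cn_rect T n.+1 w -> t \in `]0, T[ -> x \in `[0, 1] ->
  is_derive t 1 (fun s => w s x) (pdt T w t x).
Proof.
move=> [_ [dw _ _]] tT x1; apply: deriv_in_interior => //.
by apply: (dw t x _ x1).1; exact: subset_itv_oo_cc.
Qed.

Lemma Cn_rect_is_derive_x n w t x : Cn_rect T n.+1 w -> t \in `[0, T] -> x \in `]0, 1[ ->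
  is_derive x 1 (w t) (pdx w t x).
Proof.
move=> [_ [dw _ _]] tT x1; apply: deriv_in_interior => //.
by apply: (dw t x tT _).2; exact: subset_itv_oo_cc.
Qed.

Lemma iter_pdxE i w t : iter i (@pdx R) w t = derivs (w t) i.
Proof. by elim: i => [//|i IH]; rewrite /derivs !iterS -[in RHS]/(derivs _ i) -IH. Qed.

Lemma Cn_rect_Cn_in n w t : Cn_rect T n w -> t \in `[0, T] -> Cn_in `[0, 1] n (w t).
Proof.
move=> Cw tT; split=> [i ni x x1|].
  have := @Cn_rect_iter_pdx i 1 w (Cn_rectW _ Cw); rewrite addn1 => /(_ ni)[_ [dw _ _]].
  by have [_] := dw t x tT x1; rewrite iter_pdxE.
have := @Cn_rect_iter_pdx n 0 w; rewrite addn0 => /(_ Cw) cw.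
by have := Cn_rect_slice_continuous_x cw tT; rewrite iter_pdxE.
Qed.

Lemma rect_bounded w : Cn_rect T 0 w -> exists2 K, 0 <= K &
  forall t x, t \in `[0, T] -> x \in `[0, 1] -> `|w t x| <= K.
Proof.
move=> [cw _]; have cpt : compact (`[0, T] `*` `[0, 1] : set (R * R)).
  by apply: compact_setX; exact: segment_compact.
have ne : (`[0, T] `*` `[0, 1] : set (R * R)) !=set0.
  by exists (0, 0); split; rewrite /= in_itv/= lexx ?ler01 ?ltW.
have [c _ hc] := compact_EVT_max ne cpt cw.
have [d _ hd] := compact_EVT_min ne cpt cw.
exists (`|w c.1 c.2| + `|w d.1 d.2|) => [|t x tT x1]; first exact: addr_ge0.
have tx : (t, x) \in (`[0, T] `*` `[0, 1] : set (R * R)) by rewrite inE.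
have /= h1 := hc _ tx; have /= h2 := hd _ tx.
have h3 := ler_norm (w c.1 c.2); have h4 := lerNnormlW (lexx (`|w d.1 d.2|)).
have h5 := normr_ge0 (w c.1 c.2); have h6 := normr_ge0 (w d.1 d.2).
by rewrite ler_norml; apply/andP; split; lra.
Qed.

Lemma short_subinterval (a b x d : R) : a < b -> x \in `[a, b] -> 0 < d ->
  exists p q, [/\ a <= p, p < q, q <= b & forall s, s \in `[p, q] -> `|s - x| < d].
Proof.
rewrite in_itv/= => ab /andP[ax xb] d0; have [xb'|bx] := ltP x b.
  exists x, (Num.min (x + d / 2) b); split=> //.
  - by rewrite lt_min xb' ltrDl divr_gt0.
  - by rewrite ge_min lexx orbT.
  - move=> s; rewrite in_itv/= le_min => /and3P[s1 s2 s3].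
    by rewrite ger0_norm ?subr_ge0//; lra.
exists (Num.max (x - d / 2) a), x; split=> //.
- by rewrite le_max lexx orbT.
- by rewrite gt_max (lt_le_trans ab)// andbT; lra.
- move=> s; rewrite in_itv/= ge_max => /andP[/andP[s1 s2] s3].
  by rewrite ler0_norm ?subr_le0//; lra.
Qed.

(** Symmetry of mixed derivatives up to the boundary: the mean value theorem
applied twice, in both orders, to the increment of [w] over a small rectangle
yields a value of each mixed derivative at some nearby point. *)
Lemma mixed_derivatives_eq w : Cn_rect T 2 w -> rect_eq (pdt T (pdx w)) (pdx (pdt T w)).
Proof.
move=> Cw t0 x0 tT x1; apply/eqP; rewrite -subr_eq0 -normr_le0.
apply/ler_addgt0Pl => e e0; rewrite addr0.
have Cx := Cn_rect_pdx Cw; have Ct := Cn_rect_pdt Cw.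
have /rect_continuousP cp := Cn_rect_continuous (Cn_rect_pdt Cx).
have /rect_continuousP cq := Cn_rect_continuous (Cn_rect_pdx Ct).
have e2 : 0 < e / 2 by rewrite divr_gt0.
have [d1 d10 Hd1] := cp t0 x0 tT x1 _ e2; have [d2 d20 Hd2] := cq t0 x0 tT x1 _ e2.
pose d := Num.min d1 d2; have d0 : 0 < d by rewrite lt_min d10.
have [s1 [s2 [s1a s12 s2b Hs]]] := short_subinterval T0 tT d0.
have [y1 [y2 [y1a y12 y2b Hy]]] := short_subinterval ltr01 x1 d0.
have subs s : s \in `[s1, s2] -> s \in `[0, T].
  by rewrite !in_itv/= => /andP[a b]; rewrite (le_trans s1a) ?(le_trans b).
have suby y : y \in `[y1, y2] -> y \in `[0, 1].
  by rewrite !in_itv/= => /andP[a b]; rewrite (le_trans y1a) ?(le_trans b).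
have subso s : s \in `]s1, s2[ -> s \in `]0, T[.
  by rewrite !in_itv/= => /andP[a b]; rewrite (le_lt_trans s1a) ?(lt_le_trans b).
have subyo y : y \in `]y1, y2[ -> y \in `]0, 1[.
  by rewrite !in_itv/= => /andP[a b]; rewrite (le_lt_trans y1a) ?(lt_le_trans b).
have s1i : s1 \in `[s1, s2] by rewrite in_itv/= lexx ltW.
have s2i : s2 \in `[s1, s2] by rewrite in_itv/= lexx ltW.
have y1i : y1 \in `[y1, y2] by rewrite in_itv/= lexx ltW.
have y2i : y2 \in `[y1, y2] by rewrite in_itv/= lexx ltW.
have within_s (f : R -> R) : {within `[0, T], continuous f} -> {within `[s1, s2], continuous f}.
  by apply: within_continuousW => s; exact: subs.
have within_y (f : R -> R) : {within `[0, 1], continuous f} -> {within `[y1, y2], continuous f}.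
  by apply: within_continuousW => s; exact: suby.
have contB (A : set R) (f g : R -> R) : {within A, continuous f} -> {within A, continuous g} ->
    {within A, continuous (fun x => f x - g x)}.
  by move=> cf cg x; apply: cvgB; [exact: cf|exact: cg].
have [y yi Ey] := @MVT _ (fun x => w s2 x - w s1 x) (fun x => pdx w s2 x - pdx w s1 x) y1 y2 y12
  (fun x xi => is_deriveB (Cn_rect_is_derive_x Cw (subs _ s2i) (subyo _ xi))
     (Cn_rect_is_derive_x Cw (subs _ s1i) (subyo _ xi)))
  (contB _ _ _ (within_y _ (Cn_rect_slice_continuous_x Cw (subs _ s2i)))
     (within_y _ (Cn_rect_slice_continuous_x Cw (subs _ s1i)))).
have yc : y \in `[y1, y2] by exact: subset_itv_oo_cc.
have [s si Es] := @MVT _ (fun s => pdx w s y) (fun s => pdt T (pdx w) s y) s1 s2 s12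
  (fun s si => Cn_rect_is_derive_t Cx (subso _ si) (suby _ yc))
  (within_s _ (Cn_rect_slice_continuous_t Cx (suby _ yc))).
have [s' si' Es'] := @MVT _ (fun s => w s y2 - w s y1) (fun s => pdt T w s y2 - pdt T w s y1) s1 s2 s12
  (fun s si => is_deriveB (Cn_rect_is_derive_t Cw (subso _ si) (suby _ y2i))
     (Cn_rect_is_derive_t Cw (subso _ si) (suby _ y1i)))
  (contB _ _ _ (within_s _ (Cn_rect_slice_continuous_t Cw (suby _ y2i)))
     (within_s _ (Cn_rect_slice_continuous_t Cw (suby _ y1i)))).
have sc' : s' \in `[s1, s2] by exact: subset_itv_oo_cc.
have [y' yi' Ey'] := @MVT _ (pdt T w s') (pdx (pdt T w) s') y1 y2 y12
  (fun x xi => Cn_rect_is_derive_x Ct (subs _ sc') (subyo _ xi))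
  (within_y _ (Cn_rect_slice_continuous_x Ct (subs _ sc'))).
have sc : s \in `[s1, s2] by exact: subset_itv_oo_cc.
have yc' : y' \in `[y1, y2] by exact: subset_itv_oo_cc.
have pq : pdt T (pdx w) s y = pdx (pdt T w) s' y'.
  have n0 : (s2 - s1) * (y2 - y1) != 0 by rewrite mulf_neq0// subr_eq0 gt_eqF.
  apply: (mulIf n0); rewrite mulrA -Es -Ey [(s2 - s1) * _]mulrC mulrA -Ey' -Es'.
  by move: (w s2 y2) (w s2 y1) (w s1 y2) (w s1 y1) => *; ring.
have := Hd1 s y (subs _ sc) (suby _ yc); have := Hd2 s' y' (subs _ sc') (suby _ yc').
have := Hs _ sc; have := Hs _ sc'; have := Hy _ yc; have := Hy _ yc'.
rewrite !lt_min => /andP[? ?] /andP[? ?] /andP[? ?] /andP[? ?].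
move=> /(_ _ _) h2 /(_ _ _) h1; have {}h1 := h1 ltac:(assumption) ltac:(assumption).
have {}h2 := h2 ltac:(assumption) ltac:(assumption).
move: h1 h2; rewrite pq.
by move=> h1 h2; exact: near_common_point h1 h2.
Qed.

Lemma pdt_iter_pdx j w : Cn_rect T j.+1 w ->
  rect_eq (pdt T (iter j (@pdx R) w)) (iter j (@pdx R) (pdt T w)).
Proof.
elim: j => [//|j IH] Cw t x tT x1; rewrite !iterS.
rewrite (mixed_derivatives_eq _ tT x1); last by apply: Cn_rect_iter_pdx; rewrite addn2.
by apply: rect_eq_pdx => //; apply: IH; exact: Cn_rectS.
Qed.

Lemma iter_pdt_iter_pdx i j w : Cn_rect T (i + j) w ->
  rect_eq (iter i (pdt T) (iter j (@pdx R) w)) (iter j (@pdx R) (iter i (pdt T) w)).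
Proof.
elim: i => [//|i IH] Cw t x tT x1; rewrite !iterS.
rewrite (rect_eq_pdt (IH _) tT x1); last by apply: Cn_rectS; rewrite -addSn.
apply: pdt_iter_pdx => //; apply: Cn_rect_iter_pdt; by rewrite -addSnnS.
Qed.

End Rectangle.

(** * Expansion in time *)

Section Time_derivative.
Context {R : realType}.
Variable T : R.
Hypothesis T0 : 0 < T.
Implicit Types (w : R -> R -> R) (s t x : R) (f g : R -> R).
Notation mu := (@lebesgue_measure R).

Lemma Cn_rect_bm n w t : Cn_rect T n w -> t \in `[0, T] -> bm (w t).
Proof. by move=> Cw tT; apply: within_continuous_bm; exact: Cn_rect_slice_continuous_x Cw tT. Qed.

Lemma is_derive_ip_t w g t : Cn_rect T 1 w -> bm g -> t \in `]0, T[ ->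
  is_derive t 1 (fun s => ip (w s) g) (ip (pdt T w t) g).
Proof.
move=> Cw bg tT; have [K K0 Kw] := rect_bounded T0 (Cn_rect_pdt Cw).
have [mg [L gL]] := bg.
have L0 : 0 <= L.
  apply: le_trans (gL (1 / 2) _); first exact: normr_ge0.
  by rewrite /= in_itv/=; apply/andP; split; lra.
have oc s : s \in `]0, T[ -> s \in `[0, T] by exact: subset_itv_oo_cc.
have oc1 x : x \in `]0, 1[ -> x \in `[0, 1] by exact: subset_itv_oo_cc.
pose f s x := w s x * g x.
have df s x : s \in `]0, T[ -> x \in `]0, 1[ ->
    is_derive s 1 (f ^~ x) (pdt T w s x * g x).
  move=> sT x1; have D := Cn_rect_is_derive_t Cw sT (oc1 _ x1).
  have := is_deriveM D (is_derive_cst (g x) s 1).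
  by rewrite /GRing.scale/= mulr0 add0r [X in is_derive _ _ _ X]mulrC.
have E s x : s \in `]0, T[ -> x \in `]0, 1[ -> partial1of2 f s x = pdt T w s x * g x.
  by move=> sT x1; have D := df s x sT x1; rewrite partial1of2E derive_val.
have intf s : `]0, T[%classic s -> mu.-integrable `]0, 1[ (EFin \o f s).
  by move=> sT; exact: bm_integrable (bm_mul (Cn_rect_bm Cw (oc _ sT)) bg).
have der s x : `]0, T[%classic s -> `]0, 1[%classic x -> derivable (f ^~ x) s 1.
  by move=> sT x1; case: (df s x sT x1).
have ub s x : `]0, T[%classic s -> `]0, 1[%classic x -> `|partial1of2 f s x| <= cst (K * L) x.
  move=> sT x1; rewrite E//= normrM ler_pM//; first exact: Kw (oc _ sT) (oc1 _ x1).
  exact: gL.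
have KL0 (x : R) : 0 <= cst (K * L) x by rewrite /= mulr_ge0.
have intKL : mu.-integrable `]0, 1[ (EFin \o cst (K * L)).
  exact: bm_integrable (bm_cst _ (K * L)).
have mD : measurable (`]0, 1[%classic : set R) by [].
have C := @cvg_differentiation_under_integral R _ _ mu f _ mD t 0 T tT intf der _ KL0 intKL ub.
have dF : derivable (fun s => ip (w s) g) t 1.
  exact: (@derivable_under_integral R _ _ mu f _ mD t 0 T tT intf der _ KL0 intKL ub).
apply: DeriveDef => //.
have := @differentiation_under_integral R _ _ mu f _ mD t 0 T tT intf der _ KL0 intKL ub.
rewrite derive1E => ->; apply: eq_Rintegral => x; rewrite inE => x1.
by rewrite E.
Qed.

Lemma ip_t_continuous w g : Cn_rect T 1 w -> bm g ->
  {within `[0, T], continuous (fun s => ip (w s) g)}.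
Proof.
move=> Cw bg; have [K K0 Kw] := rect_bounded T0 (Cn_rect_pdt Cw).
have oc s : s \in `]0, T[ -> s \in `[0, T] by exact: subset_itv_oo_cc.
have oc1 x : x \in `]0, 1[ -> x \in `[0, 1] by exact: subset_itv_oo_cc.
have lip0 s t x : s \in `[0, T] -> t \in `[0, T] -> x \in `[0, 1] -> s <= t ->
    `|w t x - w s x| <= K * (t - s).
  rewrite !in_itv/= => /andP[s0 sT] /andP[t0 tT] x1 st.
  have sub r : r \in `]s, t[ -> r \in `]0, T[.
    by rewrite !in_itv/= => /andP[a b]; rewrite (le_lt_trans s0) ?(lt_le_trans b).
  notypeclasses refine (@increment_le _ s t (w ^~ x) (fun r => pdt T w r x) K _ _ _ _) => //.
  - apply: within_continuousW (Cn_rect_slice_continuous_t Cw x1).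
    by apply: subset_itv; rewrite bnd_simp.
  - by move=> r /sub rT; exact: Cn_rect_is_derive_t Cw rT x1.
  - by move=> r /sub/oc rT; exact: Kw.
have lip s t x : s \in `[0, T] -> t \in `[0, T] -> x \in `[0, 1] ->
    `|w s x - w t x| <= K * `|s - t|.
  move=> sT tT x1; have [st|ts] := leP s t.
    by rewrite distrC (distrC s) [`|t - s|]ger0_norm ?subr_ge0//; exact: lip0.
  have st0 : 0 <= s - t by rewrite subr_ge0 ltW.
  by rewrite (ger0_norm st0); apply: lip0 => //; exact: ltW.
apply/within_continuousP => t tT e e0; pose L := L2norm g.
have L0 : 0 <= L := L2norm_ge0 _.
have KL0 : 0 < K * L + 1 by rewrite ltr_wpDl// mulr_ge0.
exists (e / (K * L + 1)); first by rewrite divr_gt0.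
move=> s sT; rewrite ltr_pdivlMr// => se.
have bs := Cn_rect_bm Cw sT; have bt := Cn_rect_bm Cw tT.
rewrite -ip_subl//; apply: le_lt_trans (cauchy_schwarz (bm_sub bs bt) bg) _.
have h : L2norm (fun x => w s x - w t x) <= K * `|s - t|.
  apply: L2norm_bound; first by rewrite mulr_ge0.
    exact: bm_sub.
  by move=> x /oc1 x1; exact: lip.
apply: le_lt_trans se; apply: (@le_trans _ _ (K * `|s - t| * L)); first exact: ler_wpM2r.
have := normr_ge0 (s - t); set a := `|s - t| => a0.
by rewrite mulrDr mulr1 mulrCA mulrA lerDl.
Qed.

(** Expansions in time are needed only for scalar functions: the values at a point,
or the inner products with a fixed function. *)
Definition time_chain n (phi : nat -> R -> R) :=
  forall j, (j < n)%N -> {within `[0, T], continuous (phi j)} /\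
    forall t, t \in `]0, T[ -> is_derive t 1 (phi j) (phi j.+1 t).

Lemma time_chain_ip n w g : Cn_rect T n w -> bm g ->
  time_chain n (fun j t => ip (iter j (pdt T) w t) g).
Proof.
move=> Cw bg j jn; have C1 : Cn_rect T 1 (iter j (pdt T) w).
  by apply: Cn_rect_iter_pdt; rewrite addn1; exact: Cn_rectW Cw.
by split=> [|t tT]; [exact: ip_t_continuous|rewrite iterS; exact: is_derive_ip_t].
Qed.

Lemma time_chain_value n w x : Cn_rect T n w -> x \in `[0, 1] ->
  time_chain n (fun j t => iter j (pdt T) w t x).
Proof.
move=> Cw x1 j jn; have C1 : Cn_rect T 1 (iter j (pdt T) w).
  by apply: Cn_rect_iter_pdt; rewrite addn1; exact: Cn_rectW Cw.
split=> [|t tT]; first exact: Cn_rect_slice_continuous_t C1 x1.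
by rewrite iterS; exact: Cn_rect_is_derive_t C1 tT x1.
Qed.

Section Midpoint.
Variables (t0 t1 : R).
Hypotheses (t00 : 0 <= t0) (t01 : t0 < t1) (t1T : t1 <= T).
Let k := t1 - t0.
Let m := (t0 + t1) / 2.
Let k0 : 0 < k. Proof. by rewrite subr_gt0. Qed.

Lemma midpoint_in : m \in `]0, T[.
Proof.
by rewrite in_itv/= /m; move: t00 t01 t1T => ? ? ?; apply/andP; split; lra.
Qed.

Lemma time_chain_increment (phi : nat -> R -> R) (B : R) : time_chain 1 phi ->
  (forall t, t \in `]0, T[ -> `|phi 1%N t| <= B) -> `|phi 0%N t1 - phi 0%N t0| <= B * k.
Proof.
move=> H HB; have [c0 d0] := H 0%N isT.
have sub r : r \in `]t0, t1[ -> r \in `]0, T[.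
  move: t00 t01 t1T => ? ? ?.
  by rewrite !in_itv/= => /andP[a b]; apply/andP; split; lra.
rewrite /k; notypeclasses refine (@increment_le _ t0 t1 (phi 0%N) (phi 1%N) B (ltW t01) _ _ _).
- by apply: within_continuousW c0; apply: subset_itv; rewrite bnd_simp.
- by move=> r /sub; exact: d0.
- by move=> r /sub; exact: HB.
Qed.

Let sym_in s : s \in `[0, k / 2] -> m + s \in `[0, T] /\ m - s \in `[0, T].
Proof.
move: t00 t01 t1T => ? ? ?.
by rewrite !in_itv/= /m /k => /andP[a b]; split; apply/andP; split; lra.
Qed.

Let sym_oo s : s \in `]0, k / 2[ -> (m + s \in `]0, T[) /\ (m - s \in `]0, T[).
Proof.
move: t00 t01 t1T => ? ? ?.
by rewrite !in_itv/= /m /k => /andP[a b]; split; apply/andP; split; lra.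
Qed.

Let is_derive_sym (f f' : R -> R) s :
  (forall t, t \in `]0, T[ -> is_derive t 1 f (f' t)) -> s \in `]0, k / 2[ ->
  is_derive s 1 (fun s => f (m + s)) (f' (m + s)) /\
  is_derive s 1 (fun s => f (m - s)) (- f' (m - s)).
Proof.
move=> df si; have [a b] := sym_oo si; split.
  have D1 : is_derive s 1 (fun s => m + s) 1.
    have := is_deriveD (is_derive_cst m s 1) (is_derive_id s 1).
    by rewrite add0r.
  have := @is_derive1_comp _ f (fun s => m + s) s _ _ (df _ a) D1.
  by rewrite mulr1.
have D1 : is_derive s 1 (fun s => m - s) (-1).
  have := is_deriveB (is_derive_cst m s 1) (is_derive_id s 1).
  by rewrite add0r.
have := @is_derive1_comp _ f (fun s => m - s) s _ _ (df _ b) D1.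
by rewrite mulrN1.
Qed.

Let sym_continuous (f : R -> R) : {within `[0, T], continuous f} ->
  {within `[0, k / 2], continuous (fun s => f (m + s))} /\
  {within `[0, k / 2], continuous (fun s => f (m - s))}.
Proof.
move=> /within_continuousP cf; split; apply/within_continuousP => s si e e0.
  have [d d0 Hd] := cf _ (sym_in si).1 e e0; exists d => // y yi yd.
  apply: Hd; first exact: (sym_in yi).1.
  by rewrite opprD addrACA subrr add0r.
have [d d0 Hd] := cf _ (sym_in si).2 e e0; exists d => // y yi yd.
apply: Hd; first exact: (sym_in yi).2.
by rewrite opprB addrC addrA subrK distrC.
Qed.

Let ends : m + k / 2 = t1 /\ m - k / 2 = t0.
Proof. by rewrite /m /k; split; field. Qed.

Let diff_le (phi : nat -> R -> R) (B : R) s : time_chain 1 phi ->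
  (forall t, t \in `]0, T[ -> `|phi 1%N t| <= B) -> s \in `[0, k / 2] ->
  `|phi 0%N (m + s) - phi 0%N (m - s)| <= k * B.
Proof.
move=> H HB si; have [c0 d0] := H 0%N isT.
have [a b] := sym_in si; have := si; rewrite in_itv/= => /andP[s0 sk].
have B0 : 0 <= B by apply: le_trans (HB m midpoint_in); exact: normr_ge0.
have sub r : r \in `](m - s), (m + s)[ -> r \in `]0, T[.
  move: a b; rewrite !in_itv/= => /andP[? ?] /andP[? ?] /andP[? ?].
  by apply/andP; split; lra.
apply: (@le_trans _ _ (B * ((m + s) - (m - s)))); last first.
  by rewrite mulrC ler_wpM2r//; lra.
notypeclasses refine (@increment_le _ (m - s) (m + s) (phi 0%N) (phi 1%N) B _ _ _ _); first by lra.
- apply: within_continuousW c0; move: a b; rewrite !in_itv/= => /andP[? ?] /andP[? ?].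
  by apply: subset_itv; rewrite bnd_simp.
- by move=> r /sub; exact: d0.
- by move=> r /sub; exact: HB.
Qed.

(** The even part of a function about the midpoint differs from its central
value to second order. *)
Lemma midpoint_average (phi : nat -> R -> R) (B : R) : time_chain 2 phi ->
  (forall t, t \in `]0, T[ -> `|phi 2%N t| <= B) ->
  `|(phi 0%N t1 + phi 0%N t0) / 2 - phi 0%N m| <= k ^+ 2 * B.
Proof.
move=> H HB; have [c0 d0] := H 0%N isT.
have H1 : time_chain 1 (fun j => phi j.+1) by move=> j j1; exact: H.
pose g s := phi 0%N (m + s) + phi 0%N (m - s).
have : `|g (k / 2) - g 0| <= (k * B) * (k / 2 - 0).
  notypeclasses refine (@increment_le _ 0 (k / 2) g (fun s => phi 1%N (m + s) - phi 1%N (m - s)) _ _ _ _ _).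
  - by rewrite divr_ge0// ltW.
  - have [cp cm] := sym_continuous c0.
    by move=> s; apply: cvgD; [exact: cp|exact: cm].
  - by move=> s si; have [dp dm] := is_derive_sym d0 si; exact: is_deriveD.
  - by move=> s si; apply: (diff_le (phi := fun j => phi j.+1)) => //; exact: subset_itv_oo_cc.
have [e1 e2] := ends; rewrite /g addr0 subr0 e1 e2 subr0.
have -> : phi 0%N t1 + phi 0%N t0 - (phi 0%N m + phi 0%N m) =
  2 * ((phi 0%N t1 + phi 0%N t0) / 2 - phi 0%N m) by field.
rewrite normrM (@ger0_norm _ 2)//; set X := `|_|; set y := k.
have B0 : 0 <= B by apply: le_trans (HB m midpoint_in); exact: normr_ge0.
have : 0 <= y ^+ 2 * B by rewrite mulr_ge0// sqr_ge0.
have -> : y * B * (y / 2) = y ^+ 2 * B / 2 by field.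
move: (y ^+ 2 * B) => z z0 h; lra.
Qed.

(** The odd part of a function about the midpoint is close to linear; two
integrations of a bound on the third derivative give the third order. *)
Lemma midpoint_difference (phi : nat -> R -> R) (B : R) : time_chain 3 phi ->
  (forall t, t \in `]0, T[ -> `|phi 3%N t| <= B) ->
  `|phi 0%N t1 - phi 0%N t0 - k * phi 1%N m| <= k ^+ 3 * B.
Proof.
move=> H HB; have [c0 d0] := H 0%N isT; have [c1 d1] := H 1%N isT.
have H2 : time_chain 1 (fun j => phi j.+2) by move=> j j1; exact: H.
have B0 : 0 <= B by apply: le_trans (HB m midpoint_in); exact: normr_ge0.
have kB : 0 <= k * B by rewrite mulr_ge0// ltW.
have kk : k / 2 <= k by move: k0 => ?; lra.
pose g' s := phi 1%N (m + s) + phi 1%N (m - s) - 2 * phi 1%N m.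
have g'le s : s \in `[0, k / 2] -> `|g' s| <= k ^+ 2 * B.
  move=> si; have := si; rewrite in_itv/= => /andP[s0 sk].
  have sub r : r \in `[0, s] -> r \in `[0, k / 2].
    by rewrite !in_itv/= => /andP[-> rs]; rewrite (le_trans rs).
  have subo r : r \in `]0, s[ -> r \in `]0, k / 2[.
    by rewrite !in_itv/= => /andP[-> rs]; rewrite (lt_le_trans rs).
  have : `|g' s - g' 0| <= (k * B) * (s - 0).
    notypeclasses refine (@increment_le _ 0 s g' (fun s => phi 2%N (m + s) - phi 2%N (m - s)) _ s0 _ _ _).
    - have [cp cm] := sym_continuous c1.
      apply: within_continuousW (sub) _ => x.
      by apply: cvgB; [apply: cvgD; [exact: cp|exact: cm]|exact: cvg_cst].
    - move=> r /subo ri; have [dp dm] := is_derive_sym d1 ri.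
      have := is_deriveB (is_deriveD dp dm) (is_derive_cst (2 * phi 1%N m) r 1).
      by rewrite subr0.
    - move=> r /subo ri; apply: (diff_le (phi := fun j => phi j.+2)) => //.
      exact: subset_itv_oo_cc.
  have -> : g' 0 = 0 by rewrite /g' addr0 subr0; ring.
  rewrite !subr0 => h; apply: le_trans h _.
  have -> : k ^+ 2 * B = k * B * k by ring.
  by rewrite ler_wpM2l//; exact: le_trans sk kk.
pose g s := phi 0%N (m + s) - phi 0%N (m - s) - (2 * s) * phi 1%N m.
have : `|g (k / 2) - g 0| <= (k ^+ 2 * B) * (k / 2 - 0).
  notypeclasses refine (@increment_le _ 0 (k / 2) g g' _ _ _ _ _).
  - by rewrite divr_ge0// ltW.
  - have [cp cm] := sym_continuous c0 => s.
    have cl : {within `[0, k / 2], continuous (fun s : R => 2 * s * phi 1%N m)}.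
      by apply: continuous_subspaceT => x; apply: cvgMl; apply: cvgMr; exact: cvg_id.
    apply: cvgB; first by apply: cvgB; [exact: cp|exact: cm].
    exact: cl.
  - move=> s si; have [dp dm] := is_derive_sym d0 si.
    have D1 : is_derive s 1 (fun s : R => (2 * s) * phi 1%N m) (2 * phi 1%N m).
      have := is_deriveZ (2 * phi 1%N m) (is_derive_id s 1).
      rewrite /GRing.scale/= mulr1.
      by have -> : ((2 * phi 1%N m) \*: id) = (fun s : R => 2 * s * phi 1%N m)
        by apply/funext => y; rewrite /GRing.scale/= mulrAC.
    by have := is_deriveB (is_deriveB dp dm) D1; rewrite opprK.
  - by move=> s si; apply: g'le; exact: subset_itv_oo_cc.
have [e1 e2] := ends; rewrite /g addr0 subr0 e1 e2 subrr mulr0 mul0r !subr0.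
have -> : 2 * (k / 2) = k by field.
move=> h; apply: le_trans h _.
have -> : k ^+ 3 * B = k ^+ 2 * B * k by ring.
by rewrite ler_wpM2l// mulr_ge0// sqr_ge0.
Qed.

End Midpoint.

End Time_derivative.

(** * Error of the elliptic projection *)

(* From here on only the algebraic laws of these operations are used. *)
Opaque ip dx L2norm gammastar bm_on Defs.formB formBstar.

Lemma subr_add_eq0 (R : realType) (p q s t : R) : p + q = s + t -> p - s + (q - t) = 0.
Proof. by move=> H; lra. Qed.

Section Elliptic_estimate.
Context {R : realType}.
Variables (M : nat) (xs : nat -> R).
Hypothesis part : is_partition 1 M xs.
Implicit Types (f g k F G v w chi : R -> R) (a b x c : R).
Notation pcont := (pcont M xs).
Notation pder := (pder M xs).
Notation opn := (opn M xs).
Notation adm := (adm M xs).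
Let bmc := @pcont_bm _ _ _ part.

Lemma ip_cst_pder c F f : pder F f -> ip (fun=> c) f = c * (F 1 - F 0).
Proof.
move=> PF; have := ip_pder part (@pder_cst _ _ _ part c) PF.
by rewrite ip_cst0l addr0 -mulrBr.
Qed.

Lemma pder_sub F f G g : pder F f -> pder G g ->
  pder (fun x => F x - G x) (fun x => f x - g x).
Proof.
move=> PF PG; have := pder_lin 1 (-1) PF PG.
have E (p q : R -> R) : (fun x => 1 * p x + (-1) * q x) = (fun x => p x - q x).
  by apply/funext => x; rewrite mul1r mulN1r.
by rewrite !E.
Qed.

(** The function [W] solves the adjoint problem: its energy product with [e0]
controls the full seminorm of [e0], while [W] has one more derivative than the
energy norm sees, all of them bounded by that seminorm. Taking the second
derivative of [W] to be [e0 1 * x - e0] makes it vanish at both ends, so that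
the natural boundary conditions hold without solving a differential equation;
the mean value of [W'] is then adjusted to [e0 1]. *)
Lemma dual_function e0 e1 e2 : pder e0 e1 -> pder e1 e2 -> e0 0 = 0 ->
  exists W : nat -> R -> R,
    [/\ (forall l, (l < 3)%N -> pder (W l) (W l.+1)), pcont (W 3%N), W 0%N 0 = 0,
        L2norm e1 ^+ 2 <= ip (W 2%N) e2 + ip (W 1%N) e1 &
        Hnorm 3 W <= 30 * L2norm e1].
Proof.
move=> P0 P1 e00; pose b := e0 1.
pose W3 x := b - e1 x; pose W2 x := b * x - e0 x.
have P2 : pder W2 W3.
  have := pder_sub (pder_lin b 0 (@pder_id _ _ _ part) (@pder_cst _ _ _ part 0)) P0.
  have -> : (fun x => b * x + 0 * 0 - e0 x) = W2 by apply/funext => x; rewrite mulr0 addr0.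
  by have -> : (fun x => b * 1 + 0 * 0 - e1 x) = W3
    by apply/funext => x; rewrite mulr0 addr0 mulr1.
have [Z PZ Z0] := primitive_exists part (pder_cont P2).
pose c := b - ip Z (fun=> 1).
pose W1 x := Z x + c.
have PW1 : pder W1 W2.
  have := pder_lin 1 1 PZ (@pder_cst _ _ _ part c).
  have -> : (fun x => 1 * Z x + 1 * c) = W1 by apply/funext => x; rewrite !mul1r.
  by have -> : (fun x => 1 * W2 x + 1 * 0) = W2 by apply/funext => x; rewrite mulr0 addr0 mul1r.
have [W0 PW0 W00] := primitive_exists part (pder_cont PW1).
exists (fun l => match l with 0%N => W0 | 1%N => W1 | 2%N => W2 | _ => W3 end).
have bm0 := bmc (pder_pcontl part P0); have bm1 := bmc (pder_pcontl part P1).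
have bW2 := bmc (pder_pcontl part P2); have bW3 := bmc (pder_pcontr P2).
have bW1 := bmc (pder_pcontl part PW1); have bW0 := bmc (pder_pcontl part PW0).
have bZ := bmc (pder_pcontl part PZ).
have bc (x : R) : bm (fun=> x) by exact: bm_cst.
have W21 : W2 1 = 0 by rewrite /W2 mulr1 subrr.
have W20 : W2 0 = 0 by rewrite /W2 mulr0 e00 subrr.
split=> //.
- by case=> [|[|[|]]].
- exact: pder_pcontr P2.
- have E1 : ip W2 e2 + ip W3 e1 = 0.
    by rewrite (ip_pder part P2 P1) W21 W20 !mul0r subrr.
  have E2 : ip W3 e1 = b * b - ip e1 e1.
    by rewrite /W3 ip_subl// (ip_cst_pder b P0) e00 subr0.
  have E3 : ip W1 W3 + ip W2 W2 = 0.
    by rewrite (ip_pder part PW1 P2) W21 W20 !mulr0 subrr.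
  have E4 : ip W1 W3 = ip W1 (fun=> b) - ip W1 e1 by rewrite /W3 ip_subr.
  have E5 : ip W1 (fun=> b) = b * b.
    have -> : (fun=> b) = (fun x : R => b * 1 + 0 * 1) by apply/funext => x; ring.
    have -> : W1 = (fun x => 1 * Z x + c * 1) by apply/funext => x; rewrite mul1r mulr1.
    rewrite (ip_linr _ _ (bc 1) (bc 1)); last exact: bm_lin.
    rewrite (ip_linl _ _ bZ (bc 1) (bc 1)) ip_cst1 /c; set y := ip Z _; ring.
  have := ip_ge0 W2; rewrite L2norm_sqr; move: E1 E2 E3 E4 E5.
  move: (ip W2 e2) (ip W3 e1) (ip e1 e1) (ip W1 W3) (ip W2 W2) (ip W1 e1) (ip W1 _).
  by move=> *; lra.
- set a := L2norm e1; have a0 : 0 <= a := L2norm_ge0 _.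
  have hb : `|b| <= a by exact: (endpoint_le part P0 e00).
  have h0 : L2norm e0 <= 2 * a by exact: (poincare part P0 e00).
  have lc (x : R) : L2norm (fun=> x) <= `|x| by apply: L2norm_bound.
  have h3 : L2norm W3 <= 2 * a.
    by have := L2norm_sub (bc b) bm1; have := lc b; rewrite -/a; lra.
  have h2 : L2norm W2 <= 3 * a.
    have bx : bm (fun x => b * x).
      by apply: bm_mul => //; exact: bmc (pder_pcontl part (@pder_id _ _ _ part)).
    have hx : L2norm (fun x => b * x) <= `|b|.
      apply: L2norm_bound => // x; rewrite in_itv/= => /andP[x0 x1].
      by rewrite normrM ler_piMr// gtr0_norm// ltW.
    by have := L2norm_sub bx bm0; lra.
  have hZ : L2norm Z <= 6 * a.
    by have := poincare part PZ Z0; lra.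
  have hc : `|c| <= 7 * a.
    have := cauchy_schwarz bZ (bc 1).
    rewrite L2norm_cst1 mulr1 => hh.
    by rewrite /c (le_trans (ler_normB _ _))//; move: hh hb hZ; lra.
  have h1 : L2norm W1 <= 13 * a.
    by have := L2norm_add bZ (bc c); have := lc c; rewrite -/W1; lra.
  have h : L2norm W0 <= 26 * a.
    by have := poincare part PW0 W00; lra.
  rewrite -ler_sqr ?nnegrE ?sqrtr_ge0 ?mulr_ge0// sqr_sqrtr; last first.
    by apply: sumr_ge0 => i _; exact: sqr_ge0.
  rewrite !big_ord_recl big_ord0/= addr0.
  have sq f (y : R) : L2norm f <= y -> L2norm f ^+ 2 <= y ^+ 2.
    by move=> fy; rewrite ler_sqr ?nnegrE ?L2norm_ge0// (le_trans (L2norm_ge0 f)).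
  move: (sq _ _ h) (sq _ _ h1) (sq _ _ h2) (sq _ _ h3) (sqr_ge0 a).
  rewrite !exprMn; move: (L2norm _ ^+ 2) (L2norm _ ^+ 2) (L2norm _ ^+ 2) (L2norm _ ^+ 2) (a ^+ 2).
  by move=> *; lra.
Qed.

Variables (r : nat) (h C : R) (S : set (R -> R)).
Hypotheses (r3 : (3 <= r)%N) (h0 : 0 < h) (C0 : 0 <= C).
Hypothesis Sadm : forall chi, S chi -> adm chi.
Hypothesis S0 : forall chi, S chi -> chi 0 = 0.
Hypothesis Scube : exists2 chi, S chi & forall x, x \in `[0, 1] -> chi x = x ^+ 3.
Hypothesis Sapprox : forall s, (1 <= s <= r)%N -> forall v d, in_H0 s.+1 v d ->
  inf [set Hnorm 2 (fun l x => d l x - derivs chi l x) | chi in S]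
    <= C * h ^+ s.-1 * Hnorm s.+1 d.

(** The infimum in the approximation property need not be attained, hence the
detour through lower bounds. *)
Lemma approx_le s v d (K X : R) : (1 <= s <= r)%N -> in_H0 s.+1 v d -> 0 <= K ->
  (forall chi, S chi -> X <= K * Hnorm 2 (fun l x => d l x - derivs chi l x)) ->
  X <= K * (C * h ^+ s.-1 * Hnorm s.+1 d).
Proof.
move=> sr vd K0 H; have [chi Schi _] := Scube.
move: K0; rewrite le_eqVlt => /predU1P[K0|K0].
  by have := H chi Schi; rewrite -K0 !mul0r.
rewrite mulrC -ler_pdivrMr//; apply: le_trans (Sapprox sr vd).
apply: lb_le_inf; first by exists (Hnorm 2 (fun l x => d l x - derivs chi l x)), chi.
by move=> _ [psi Spsi <-]; rewrite ler_pdivrMr// mulrC; exact: H.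
Qed.

(** The error [e] is orthogonal to the discrete space, so its energy norm is at most
the distance of [v] to that space, of order [h ^ (r - 1)]. Pairing [e] with the dual
function and subtracting from the latter an arbitrary discrete function gains the
missing power of [h] for the first derivative. *)
Lemma elliptic_estimate v w : Cn_in `[0, 1] r.+1 v -> v 0 = 0 ->
  is_elliptic_proj S v w ->
  L2norm (fun x => dx w x - dx v x) <= 30 * C ^+ 2 * h ^+ r * Hnorm r.+1 (derivs v).
Proof.
move=> Cv v0 [Sw orth0]; have aw := Sadm Sw.
have av : adm v.
  by move: Cv; rewrite -(prednK (leq_trans (isT : 0 < 3)%N r3)) => Cv; exact: (Cn_in_adm part Cv).
pose e0 x := w x - v x; pose e1 x := dx w x - dx v x.
pose e2 x := dx (dx w) x - dx (dx v) x.
have P0 : pder e0 e1 by apply: pder_sub; exact: adm_pder.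
have P1 : pder e1 e2 by exact: (pder_sub aw.2 av.2).
have e00 : e0 0 = 0 by rewrite /e0 v0 (S0 Sw) subrr.
have be1 := bmc (pder_pcontl part P1); have be2 := bmc (pder_pcontr P1).
have b1v := adm_bm1 part av; have b2v := adm_bm2 part av.
have b1w := adm_bm1 part aw; have b2w := adm_bm2 part aw.
have E2 k : bm k -> ip e2 k = ip (dx (dx w)) k - ip (dx (dx v)) k := ip_subl b2w b2v.
have E1 k : bm k -> ip e1 k = ip (dx w) k - ip (dx v) k := ip_subl b1w b1v.
have orth chi : S chi -> ip e2 (dx (dx chi)) + ip e1 (dx chi) = 0.
  move=> Schi; have ac := Sadm Schi; have := orth0 chi Schi.
  rewrite !gammastarE (E2 _ (adm_bm2 part ac)) (E1 _ (adm_bm1 part ac)).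
  exact: subr_add_eq0.
pose N := energy e1 e2.
have N0 : 0 <= N := energy_ge0 _ _.
have sub_le (d : nat -> R -> R) chi : S chi -> bm (d 1%N) -> bm (d 2%N) ->
    `|ip (d 2%N) e2 + ip (d 1%N) e1| <= N * Hnorm 2 (fun l x => d l x - derivs chi l x).
  move=> Schi b1 b2; have ac := Sadm Schi.
  have c1 := adm_bm1 part ac; have c2 := adm_bm2 part ac.
  have <- : ip e2 (fun x => d 2%N x - dx (dx chi) x) + ip e1 (fun x => d 1%N x - dx chi x)
      = ip (d 2%N) e2 + ip (d 1%N) e1.
    rewrite (ip_subr b2 c2 be2) (ip_subr b1 c1 be1) (ipC (d 2%N)) (ipC (d 1%N)).
    by rewrite addrACA -opprD (orth chi Schi) subr0.
  apply: le_trans (energy_cauchy_schwarz be1 be2 (bm_sub b1 c1) (bm_sub b2 c2)) _.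
  by apply: (ler_wpM2l N0); exact: (energy_le_Hnorm (fun l x => d l x - derivs chi l x)).
have Nle : N <= 1 * (C * h ^+ r.-1 * Hnorm r.+1 (derivs v)).
  apply: (approx_le (v := v)) => //; first by rewrite leqnn (leq_trans _ r3).
    apply: (chain_in_H0 part (d := derivs v)) => // [l lr|].
      exact: (Cn_in_pder part Cv lr).
    exact/(within_pcont part)/(Cn_in_continuous Cv).
  move=> chi Schi; rewrite mul1r; set H2 := Hnorm _ _.
  have H20 : 0 <= H2 by exact: sqrtr_ge0.
  have : N ^+ 2 <= N * H2.
    have := sub_le (derivs v) chi Schi (adm_bm1 part av) (adm_bm2 part av).
    rewrite /derivs /= -/(derivs v) -/H2 => hv; apply: le_trans _ hv.
    have -> : N ^+ 2 = - (ip (dx (dx v)) e2 + ip (dx v) e1).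
      rewrite energy_sqr (E2 _ be2) (E1 _ be1) addrACA -opprD.
      by rewrite (ipC (dx (dx w))) (ipC (dx w)) (orth w Sw) add0r.
    by rewrite -normrN ler_norm.
  have [->|Nn] := eqVneq N 0; first by [].
  by rewrite expr2 ler_pM2l// lt_def Nn.
have [W [PW pW W0 Wlow Wup]] := dual_function P0 P1 e00.
set a := L2norm e1 in Wlow Wup *; have a0 : 0 <= a := L2norm_ge0 _.
have a2 : a ^+ 2 <= N * (C * h ^+ 1 * Hnorm 3 W).
  apply: (approx_le (s := 2%N) (v := W 0%N)) => //; first by rewrite (leq_trans _ r3).
    exact: (chain_in_H0 part).
  move=> chi Schi; apply: le_trans Wlow _; apply: le_trans (ler_norm _) _; apply: sub_le => //.
    exact: bmc (pder_pcontl part (PW 1%N isT)).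
  exact: bmc (pder_pcontl part (PW 2%N isT)).
set Hv := Hnorm _ _ in Nle *; have Hv0 : 0 <= Hv by exact: sqrtr_ge0.
have hr : h ^+ r = h * h ^+ r.-1 by rewrite -exprS prednK// (leq_trans _ r3).
have : a ^+ 2 <= a * (30 * C ^+ 2 * h ^+ r * Hv).
  apply: (le_trans a2); rewrite mul1r in Nle.
  apply: (@le_trans _ _ ((C * h ^+ r.-1 * Hv) * (C * h ^+ 1 * (30 * a)))).
    have hC : 0 <= C * h ^+ 1 by rewrite mulr_ge0// expr1 ltW.
    apply: ler_pM => //; first by rewrite mulr_ge0// sqrtr_ge0.
    exact: ler_wpM2l.
  by rewrite hr le_eqVlt; apply/orP; left; apply/eqP; ring.
have [->|an] := eqVneq a 0.
  by move=> _; rewrite !mulr_ge0// ?exprn_ge0// ltW.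
by rewrite expr2 ler_pM2l// lt_def an.
Qed.

(** The cubic lies in the discrete space; testing the orthogonality with it
expresses the slope of the error at the right end by its mean values, which
gives an order of convergence that a trace inequality would lose. *)
Lemma elliptic_endpoint v w : adm v -> is_elliptic_proj S v w ->
  `|dx w 1 - dx v 1| <= 2 * L2norm (fun x => dx w x - dx v x).
Proof.
move=> av [Sw orth0]; have aw := Sadm Sw; have [chi Schi cube] := Scube.
have ac := Sadm Schi.
pose e1 x := dx w x - dx v x.
pose e2 x := dx (dx w) x - dx (dx v) x.
have P1 : pder e1 e2 by exact: (pder_sub aw.2 av.2).
have be1 := bmc (pder_pcontl part P1); have be2 := bmc (pder_pcontr P1).
have D1 x : x \in `]0, 1[ -> dx chi x = 3 * x ^+ 2.
  move=> xi; have [d d0 Hd] := itvoo_near xi.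
  apply: (@is_derive_deriv_in _ 0 1 chi x _ xi _).2.
  have -> : 3 * x ^+ 2 = ('X^3 : {poly R})^`().[x] by rewrite derivXn hornerMn hornerXn mulr_natl.
  apply: (@is_derive_eql _ (horner 'X^3) chi x _ d d0) => z /Hd zi.
  by rewrite hornerXn cube//; exact: subset_itv_oo_cc.
have D2 x : x \in `]0, 1[ -> dx (dx chi) x = 6 * x.
  move=> xi; have [d d0 Hd] := itvoo_near xi.
  apply: (@is_derive_deriv_in _ 0 1 (dx chi) x _ xi _).2.
  have -> : 6 * x = (3 *: 'X^2 : {poly R})^`().[x].
    by rewrite derivZ derivXn hornerZ hornerMn hornerXn expr1 mulr2n; ring.
  apply: (@is_derive_eql _ (horner (3 *: 'X^2)) (dx chi) x _ d d0) => z /Hd zi.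
  by rewrite hornerZ hornerXn D1.
have P6 : pder (fun x => 6 * x) (fun=> 6).
  have := pder_lin 6 0 (@pder_id _ _ _ part) (@pder_cst _ _ _ part 0).
  have -> : (fun x => 6 * x + 0 * 0) = (fun x : R => 6 * x) by apply/funext => x; ring.
  by have -> : (fun x : R => 6 * 1 + 0 * 0 : R) = (fun=> 6) by apply/funext => x; ring.
have orth : ip e2 (fun x => 6 * x) + ip e1 (fun x => 3 * x ^+ 2) = 0.
  have := orth0 chi Schi.
  rewrite !gammastarE.
  have e6 f : ip f (dx (dx chi)) = ip f (fun x => 6 * x) by apply: eq_ip => // x /D2.
  have e3 f : ip f (dx chi) = ip f (fun x => 3 * x ^+ 2) by apply: eq_ip => // x /D1.
  have b6 := bmc (pder_pcontl part P6).
  have b3 : bm (fun x => 3 * x ^+ 2) by apply: bm_eq (adm_bm1 part ac) => x /D1.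
  have b1v := adm_bm1 part av; have b2v := adm_bm2 part av.
  have b1w := adm_bm1 part aw; have b2w := adm_bm2 part aw.
  rewrite !e6 !e3 (ip_subl b2w b2v b6) (ip_subl b1w b1v b3) .
  exact: subr_add_eq0.
have E := ip_pder part P1 P6.
rewrite -/(e1 1); set a := L2norm e1.
have h1 : `|ip e1 (fun=> 6)| <= 6 * a.
  apply: le_trans (cauchy_schwarz be1 (bm_cst _ _)) _.
  rewrite -/a mulrC ler_wpM2r ?L2norm_ge0//; apply: L2norm_bound => //; first exact: bm_cst.
  by move=> x _; rewrite ger0_norm.
have h2 : `|ip e1 (fun x => 3 * x ^+ 2)| <= 3 * a.
  have b3 : bm (fun x => 3 * x ^+ 2) by apply: bm_eq (adm_bm1 part ac) => x /D1.
  apply: le_trans (cauchy_schwarz be1 b3) _.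
  rewrite -/a mulrC ler_wpM2r ?L2norm_ge0//; apply: L2norm_bound => //.
  move=> x; rewrite in_itv/= => /andP[x0 x1].
  by rewrite normrM ger0_norm// ler_piMr// ger0_norm ?sqr_ge0// expr_le1// ltW.
move: E orth h1 h2; rewrite mulr1 mulr0 mulr0 subr0.
move: (ip e1 (fun=> 6)) (ip e2 _) (ip e1 _) => A B D E orth.
rewrite !ler_norml => /andP[? ?] /andP[? ?]; apply/andP; split; lra.
Qed.

End Elliptic_estimate.

(** * One step of the scheme *)

(** What remains of the energy inequality once the diffusion term has absorbed the
second derivative of the test function; the same number bounds the step size. *)
Definition growth_const (R : realType) (K a0 : R) : R :=
  11 * K + 1 + 9 * K ^+ 2 / (2 * a0).

(** Here [p] and [q] stand for the norms of the first and second derivatives of the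
test function, [D] and [c1] for its slope and value at the right end. The boundary
term [al * D ^ 2] is not small, but the trace inequality makes it at most linear in
[q], so that [a0 * q ^ 2] dominates it by the Young inequality. *)
Lemma energy_arith (R : realType) (K a0 aa al b1 Eb p q X D D1 e1 c1 e0 Y Z : R) :
  0 < a0 -> a0 <= aa -> aa <= K -> `|al| <= K -> `|b1| <= K -> 0 <= Eb -> 0 <= p -> 0 <= q ->
  `|X| <= Eb * p -> `|D| <= p + q -> D ^+ 2 <= p ^+ 2 + 2 * p * q -> `|c1| <= p ->
  `|e1| <= Eb -> `|e0| <= Eb -> `|Y| <= Eb * (p + q) -> `|Z| <= 3 * K * (p + Eb) * p ->
  D1 = - X + (al * (D + e1) - b1 * (c1 + e0)) * D - aa * (q ^+ 2 + Y) + Z ->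
  D1 <= growth_const K a0 * (p ^+ 2 + Eb ^+ 2).
Proof.
rewrite /growth_const.
move=> a00 aa0 aaK alK b1K E0 p0 q0 hX hD hD2 hc he1 he0 hY hZ ->.
have K0 : 0 <= K by apply: le_trans aaK; apply: le_trans aa0; exact: ltW.
have aa00 : 0 <= aa by apply: le_trans aa0; exact: ltW.
have nb (x y A B : R) : `|x| <= A -> `|y| <= B -> x * y <= A * B.
  by move=> xA yB; rewrite (le_trans (ler_norm _))// normrM ler_pM.
have nb' (x y A B : R) : `|x| <= A -> `|y| <= B -> - (x * y) <= A * B.
  by move=> xA yB; rewrite -mulNr; apply: nb => //; rewrite normrN.
have E1 : al * D ^+ 2 <= K * (p ^+ 2 + 2 * p * q).
  by apply: nb => //; rewrite ger0_norm// sqr_ge0.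
have E2 : al * e1 * D <= K * Eb * (p + q).
  by apply: nb => //; rewrite normrM ler_pM.
have E3 : - (b1 * c1 * D) <= K * p * (p + q).
  by apply: nb' => //; rewrite normrM ler_pM.
have E4 : - (b1 * e0 * D) <= K * Eb * (p + q).
  by apply: nb' => //; rewrite normrM ler_pM.
have E5 : - (aa * Y) <= K * (Eb * (p + q)) by apply: nb' => //; rewrite ger0_norm.
have E6 : a0 * q ^+ 2 <= aa * q ^+ 2 by rewrite ler_wpM2r// sqr_ge0.
have E7 : - X <= Eb * p by rewrite (le_trans _ hX)// -normrN ler_norm.
have E8 : Z <= 3 * K * (p + Eb) * p by rewrite (le_trans _ hZ)// ler_norm.
pose L := 9 * K ^+ 2 / (2 * a0).
have young x : 3 * K * x * q <= a0 / 2 * q ^+ 2 + L * x ^+ 2.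
  rewrite -subr_ge0 (_ : _ - _ = (a0 * q - 3 * K * x) ^+ 2 / (2 * a0)).
    by rewrite divr_ge0 ?sqr_ge0// mulr_ge0// ltW.
  by rewrite /L; field; rewrite gt_eqF.
have Y1 := young p; have Y2 := young Eb.
have sq : 2 * (Eb * p) <= p ^+ 2 + Eb ^+ 2.
  by rewrite -subr_ge0 (_ : _ - _ = (p - Eb) ^+ 2) ?sqr_ge0//; ring.
have sqK : 6 * K * (Eb * p) <= 3 * K * (p ^+ 2 + Eb ^+ 2).
  have -> : 6 * K * (Eb * p) = 3 * K * (2 * (Eb * p)) by ring.
  by rewrite ler_wpM2l// mulr_ge0.
have KE : 0 <= K * Eb ^+ 2 by rewrite mulr_ge0// sqr_ge0.
have Kp : 0 <= K * p ^+ 2 by rewrite mulr_ge0// sqr_ge0.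
have p2 := sqr_ge0 p; have E22 := sqr_ge0 Eb.
rewrite -/L.
have expand : - X + (al * (D + e1) - b1 * (c1 + e0)) * D - aa * (q ^+ 2 + Y) + Z =
  - X + al * D ^+ 2 + al * e1 * D + - (b1 * c1 * D) + - (b1 * e0 * D) - aa * q ^+ 2
   + - (aa * Y) + Z by ring.
rewrite expand.
have goal_eq : (11 * K + 1 + L) * (p ^+ 2 + Eb ^+ 2) =
  11 * (K * p ^+ 2) + 11 * (K * Eb ^+ 2) + (p ^+ 2 + Eb ^+ 2) + L * p ^+ 2 + L * Eb ^+ 2 by ring.
rewrite goal_eq.
have e1' : K * (p ^+ 2 + 2 * p * q) = K * p ^+ 2 + 2 * (K * p * q) by ring.
have e2' : K * Eb * (p + q) = K * (Eb * p) + K * Eb * q by ring.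
have e3' : K * p * (p + q) = K * p ^+ 2 + K * p * q by ring.
have e5' : K * (Eb * (p + q)) = K * (Eb * p) + K * Eb * q by ring.
have e8' : 3 * K * (p + Eb) * p = 3 * (K * p ^+ 2) + 3 * (K * (Eb * p)) by ring.
have y1' : 3 * K * p * q = 3 * (K * p * q) by ring.
have y2' : 3 * K * Eb * q = 3 * (K * Eb * q) by ring.
have k1 : 6 * K * (Eb * p) = 6 * (K * (Eb * p)) by ring.
have k2 : 3 * K * (p ^+ 2 + Eb ^+ 2) = 3 * (K * p ^+ 2) + 3 * (K * Eb ^+ 2) by ring.
have a2' : a0 / 2 * q ^+ 2 = a0 * q ^+ 2 / 2 by field.
rewrite e1' in E1; rewrite e2' in E2 E4; rewrite e3' in E3; rewrite e5' in E5.
rewrite e8' in E8; rewrite y1' a2' in Y1; rewrite y2' a2' in Y2; rewrite k1 k2 in sqK.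
move: E1 E2 E3 E4 E5 E6 E7 E8 Y1 Y2 sq sqK KE Kp p2 E22; clear.
move: (al * D ^+ 2) (al * e1 * D) (b1 * c1 * D) (b1 * e0 * D) (aa * Y) (aa * q ^+ 2)
  (a0 * q ^+ 2) (K * p * q) (K * Eb * q) (K * p ^+ 2) (K * Eb ^+ 2) (K * (Eb * p)) (Eb * p)
  (L * p ^+ 2) (L * Eb ^+ 2) (p ^+ 2) (Eb ^+ 2).
by move=> *; lra.
Qed.

Lemma sqr_le_mean (R : realType) (p x y : R) : 0 <= p ->
  p <= 1 / 2 * x + 1 / 2 * y -> p ^+ 2 <= 1 / 2 * (x ^+ 2 + y ^+ 2).
Proof.
move=> p0 pp; apply: (@le_trans _ _ ((1 / 2 * x + 1 / 2 * y) ^+ 2)).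
  by rewrite ler_sqr ?nnegrE// (le_trans p0).
have E : 1 / 2 * (x ^+ 2 + y ^+ 2) - (1 / 2 * x + 1 / 2 * y) ^+ 2 = ((x - y) / 2) ^+ 2 by field.
by rewrite -subr_ge0 E sqr_ge0.
Qed.

Lemma growth_const_ge0 (R : realType) (K a0 : R) : 0 < a0 -> 0 <= K -> 0 <= growth_const K a0.
Proof.
move=> a00 K0; rewrite /growth_const !addr_ge0//; first by rewrite mulr_ge0.
by rewrite divr_ge0// mulr_ge0// ?sqr_ge0// ltW.
Qed.

Lemma step_increment (R : realType) (k K4 p x y z D : R) : 0 < k -> 0 <= K4 ->
  D = 1 / 2 * (x - y) -> p ^+ 2 <= 1 / 2 * (x + y) -> k^-1 * D <= K4 * (p ^+ 2 + z) ->
  x - y <= k * K4 * (x + y) + 2 * k * K4 * z.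
Proof.
move=> k0 K40 -> hp H.
have {}H : k^-1 * (1 / 2 * (x - y)) <= K4 * (1 / 2 * (x + y) + z).
  by apply: (le_trans H); rewrite ler_wpM2l// lerD2r.
move: H; rewrite mulrC ler_pdivrMr// => H.
have : 2 * (1 / 2 * (x - y)) <= 2 * (K4 * (1 / 2 * (x + y) + z) * k) by rewrite ler_wpM2l.
have -> : 2 * (1 / 2 * (x - y)) = x - y by field.
by have -> : 2 * (K4 * (1 / 2 * (x + y) + z) * k) = k * K4 * (x + y) + 2 * k * K4 * z by field.
Qed.

Section One_step.
Context {R : realType}.
Variables (M : nat) (xs : nat -> R).
Hypothesis part : is_partition 1 M xs.
Implicit Types (f g F G v w chi V W : R -> R) (x : R).
Notation pcont := (pcont M xs).
Notation pder := (pder M xs).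
Notation opn := (opn M xs).
Notation adm := (adm M xs).

Lemma formB_mulE (be : R -> R) v chi : Cn_in `[0, 1] 1 be -> adm v -> adm chi ->
  formB (fun x => be x * v x) chi =
    ip (fun x => dx be x * v x + be x * dx v x) (dx chi).
Proof.
move=> Cbe av ac.
have Pbe : pder be (dx be) := Cn_in_pder part (l := 0%N) Cbe isT.
have P := pder_mul part Pbe (adm_pder part av).
symmetry; apply: (piecewise_eq_ip part); last exact: (pder_pcontl part ac.2).
  move=> x ox; case: P => _ _ /(_ x ox) D; symmetry.
  exact: (is_derive_deriv_in (opn_itv part ox) D).2.
exact: pder_pcontr P.
Qed.

Lemma formB_mul_sub_le (be : R -> R) V W chi (K : R) : Cn_in `[0, 1] 1 be -> 0 <= K ->
  (forall x, x \in `[0, 1] -> `|be x| <= K /\ `|dx be x| <= K) ->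
  adm V -> adm W -> adm chi -> V 0 = 0 -> W 0 = 0 ->
  `|formB (fun x => be x * V x) chi - formB (fun x => be x * W x) chi| <=
    3 * K * L2norm (fun x => dx V x - dx W x) * L2norm (dx chi).
Proof.
move=> Cbe K0 Kbe aV aW ac V0 W0.
have Pbe : pder be (dx be) := Cn_in_pder part (l := 0%N) Cbe isT.
have bb := pcont_bm part (pder_pcontl part Pbe); have bb' := pcont_bm part (pder_pcontr Pbe).
have bV := pcont_bm part (pder_pcontl part (adm_pder part aV)).
have bW := pcont_bm part (pder_pcontl part (adm_pder part aW)).
have bV1 := adm_bm1 part aV; have bW1 := adm_bm1 part aW; have bc := adm_bm1 part ac.
have P0 := pder_sub (adm_pder part aV) (adm_pder part aW).
pose q1 x := dx be x * (V x - W x); pose q2 x := be x * (dx V x - dx W x).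
have bq1 : bm q1 by apply: bm_mul => //; exact: bm_sub.
have bq2 : bm q2 by apply: bm_mul => //; exact: bm_sub.
have add_bm (f g : R -> R) : bm f -> bm g -> bm (fun x => f x + g x).
  by move=> bf bg; apply: bm_eq (bm_lin 1 1 bf bg) => x _; rewrite !mul1r.
rewrite (formB_mulE Cbe aV ac) (formB_mulE Cbe aW ac) -ip_subl//; last 2 first.
- by apply: add_bm; exact: bm_mul.
- by apply: add_bm; exact: bm_mul.
have -> : (fun x => dx be x * V x + be x * dx V x - (dx be x * W x + be x * dx W x)) =
    (fun x => q1 x + q2 x).
  apply/funext => x; rewrite /q1 /q2; move: (dx be x) (dx V x) (dx W x) => *; ring.
apply: le_trans (cauchy_schwarz (add_bm _ _ bq1 bq2) bc) _.
apply: ler_wpM2r; first exact: L2norm_ge0.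
set e := L2norm (fun x => dx V x - dx W x).
have h0 : L2norm (fun x => V x - W x) <= 2 * e.
  by apply: (poincare part P0); rewrite V0 W0 subrr.
have h1 : L2norm q1 <= K * (2 * e).
  apply: (@le_trans _ _ (K * L2norm (fun x => V x - W x))); last exact: ler_wpM2l.
  apply: L2norm_le => //; first exact: bm_sub.
  move=> x xi; rewrite normrM ler_wpM2r//.
  by apply: (Kbe x _).2; exact: subset_itv_oo_cc.
have h2 : L2norm q2 <= K * e.
  apply: L2norm_le => //; first exact: bm_sub.
  move=> x xi; rewrite normrM ler_wpM2r//.
  by apply: (Kbe x _).1; exact: subset_itv_oo_cc.
apply: le_trans (L2norm_add bq1 bq2) _; apply: le_trans (lerD h1 h2) _.
by rewrite le_eqVlt; apply/orP; left; apply/eqP; ring.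
Qed.

Variable S : set (R -> R).
Hypothesis Sadm : forall chi, S chi -> adm chi.
Hypothesis S0 : forall chi, S chi -> chi 0 = 0.
Hypothesis Slin : forall v w (c d : R), S v -> S w -> S (fun x => c * v x + d * w x).

Variables (Un Up wn wp um ut be : R -> R) (ff : (R -> R) -> R).
Variables (k al b1 ga f0 aa a0 K Eb : R).
Hypotheses (SUn : S Un) (SUp : S Up) (Swn : S wn) (Swp : S wp).
Hypotheses (aum : adm um) (um0 : um 0 = 0) (Cbe : Cn_in `[0, 1] 1 be).
Hypotheses (k0 : 0 < k) (a00 : 0 < a0) (aa0 : a0 <= aa) (aaK : aa <= K).
Hypotheses (alK : `|al| <= K) (b1K : `|b1| <= K) (E0 : 0 <= Eb).
Hypothesis Kbe : forall x, x \in `[0, 1] -> `|be x| <= K /\ `|dx be x| <= K.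

Variables (AU W thn thp : R -> R).
Hypothesis AUdef : AU = (fun x => 1 / 2 * Un x + 1 / 2 * Up x).
Hypothesis Wdef : W = (fun x => 1 / 2 * wn x + 1 / 2 * wp x).
Hypothesis thndef : thn = (fun x => 1 * Un x + (-1) * wn x).
Hypothesis thpdef : thp = (fun x => 1 * Up x + (-1) * wp x).

Hypothesis scheme : forall chi, S chi ->
  k^-1 * (formB Un chi - formB Up chi) =
  (al * dx AU 1 - b1 * AU 1 - ga) * dx chi 1 + f0 * dx chi 0
   - aa * formBstar AU chi + formB (fun x => be x * AU x) chi + ff chi.
Hypothesis exact_sol : forall chi, S chi ->
  formB ut chi =
  (al * dx um 1 - b1 * um 1 - ga) * dx chi 1 + f0 * dx chi 0
   - aa * formBstar um chi + formB (fun x => be x * um x) chi + ff chi.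
Hypothesis hX : forall chi, S chi ->
  `|k^-1 * (formB wn chi - formB wp chi) - formB ut chi| <= Eb * L2norm (dx chi).
Hypothesis h1 : `|dx W 1 - dx um 1| <= Eb.
Hypothesis h0 : `|W 1 - um 1| <= Eb.
Hypothesis hS : forall chi, S chi ->
  `|formBstar W chi - formBstar um chi| <= Eb * (L2norm (dx chi) + L2norm (dx (dx chi))).
Hypothesis hd : L2norm (fun x => dx W x - dx um x) <= Eb.

(** The scheme minus the identity satisfied by the exact solution, tested with the
average of the errors at both ends of the step: the difference quotient then becomes
a difference of squares. *)
Lemma one_step :
  L2norm (dx thn) ^+ 2 - L2norm (dx thp) ^+ 2 <=
    k * growth_const K a0 * (L2norm (dx thn) ^+ 2 + L2norm (dx thp) ^+ 2)
      + 2 * k * growth_const K a0 * Eb ^+ 2.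
Proof.
set K4 := growth_const K a0.
have one : (1 : R) \in `[0, 1] by rewrite in_itv/= ler01 lexx.
have K0 : 0 <= K by apply: le_trans aaK; apply: le_trans aa0; exact: ltW.
have Sn : S thn by rewrite thndef; exact: Slin.
have Sp : S thp by rewrite thpdef; exact: Slin.
have [c cdef] : exists c : R -> R, c = (fun x => 1 / 2 * thn x + 1 / 2 * thp x) by eexists.
have Sc : S c by rewrite cdef; exact: Slin.
have SW : S W by rewrite Wdef; exact: Slin.
have SAU : S AU by rewrite AUdef; exact: Slin.
have [an ap ac] := And3 (Sadm Sn) (Sadm Sp) (Sadm Sc).
have [aUn aUp awn awp] := And4 (Sadm SUn) (Sadm SUp) (Sadm Swn) (Sadm Swp).
have aW := Sadm SW; have aAU := Sadm SAU.
have AUE : AU = (fun x => 1 * c x + 1 * W x).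
  by apply/funext => x; rewrite AUdef cdef Wdef thndef thpdef; field.
have dAU x : x \in `[0, 1] -> dx AU x = dx c x + dx W x.
  by move=> xi; rewrite AUE (dx_lin _ _ ac aW xi) !mul1r.
have bn := adm_bm1 part an; have bp := adm_bm1 part ap; have bc := adm_bm1 part ac.
have bW := adm_bm1 part aW; have bum := adm_bm1 part aum.
pose p := L2norm (dx c); pose q := L2norm (dx (dx c)).
have Pc := ac.2.
have EUn : formB Un c = formB thn c + formB wn c.
  by rewrite [in formB thn c]thndef (formB_linl part _ _ aUn awn ac) mul1r mulN1r subrK.
have EUp : formB Up c = formB thp c + formB wp c.
  by rewrite [in formB thp c]thpdef (formB_linl part _ _ aUp awp ac) mul1r mulN1r subrK.
have qE : q ^+ 2 = formBstar c c by rewrite formBstarE -L2norm_sqr.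
have Estar : formBstar AU c = q ^+ 2 + formBstar W c.
  rewrite AUE; apply: etrans (formBstar_linl part 1 1 ac aW ac) _.
  exact: (congr2 +%R (etrans (mul1r _) (esym qE)) (mul1r _)).
have AU1 : AU 1 = c 1 + W 1 by rewrite AUE !mul1r.
have hZ : `|formB (fun x => be x * AU x) c - formB (fun x => be x * um x) c| <=
    3 * K * (p + Eb) * p.
  apply: le_trans (formB_mul_sub_le Cbe K0 Kbe aAU aum ac (S0 SAU) um0) _.
  rewrite -/p ler_wpM2r ?L2norm_ge0// ler_wpM2l ?mulr_ge0//.
  rewrite (_ : L2norm _ = L2norm (fun x => dx c x + (dx W x - dx um x))).
    apply: le_trans (L2norm_add bc (bm_sub bW bum)) _.
    by rewrite lerD2l.
  apply: eq_L2norm => x xi; rewrite dAU ?addrA//; exact: subset_itv_oo_cc.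
have D1 : k^-1 * (formB thn c - formB thp c) = - (k^-1 * (formB wn c - formB wp c) - formB ut c)
   + (al * (dx c 1 + (dx W 1 - dx um 1)) - b1 * (c 1 + (W 1 - um 1))) * dx c 1
   - aa * (q ^+ 2 + (formBstar W c - formBstar um c))
   + (formB (fun x => be x * AU x) c - formB (fun x => be x * um x) c).
  have := scheme Sc; rewrite EUn EUp Estar AU1 (dAU 1 one).
  have := exact_sol Sc.
  move: (formB thn c) (formB thp c) (formB wn c) (formB wp c) (formB ut c) (formBstar W c)
    (formBstar um c) (formB (fun x => be x * AU x) c) (formB (fun x => be x * um x) c)
    (dx c 1) (dx W 1) (dx um 1) (c 1) (W 1) (um 1) (dx c 0) (ff c) (q ^+ 2).
  move=> x1 x2 x3 x4 x5 x6 x7 x8 x9 y1 y2 y3 y4 y5 y6 y7 y8 y9 -> sch.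
  have -> : k^-1 * (x1 - x2) = k^-1 * (x1 + x3 - (x2 + x4)) - k^-1 * (x3 - x4) by ring.
  by rewrite sch; ring.
have main := energy_arith a00 aa0 aaK alK b1K E0 (L2norm_ge0 (dx c)) (L2norm_ge0 (dx (dx c)))
  (hX Sc) (trace_le part Pc) (trace_sqr_le part Pc) (endpoint_le part (adm_pder part ac) (S0 Sc))
  h1 h0 (hS Sc) hZ D1.
have half : formB thn c - formB thp c = 1 / 2 * (L2norm (dx thn) ^+ 2 - L2norm (dx thp) ^+ 2).
  rewrite (formBC thn c) (formBC thp c) cdef.
  rewrite (formB_linl part _ _ an ap an) (formB_linl part _ _ an ap ap).
  rewrite (formBC thp thn) !L2norm_sqr.
  move: (formB thn thp) => x1; rewrite !formBE.
  move: (ip (dx thn) (dx thn)) (ip (dx thp) (dx thp)) => x2 x3; ring.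
have avgle : p ^+ 2 <= 1 / 2 * (L2norm (dx thn) ^+ 2 + L2norm (dx thp) ^+ 2).
  have pp : p <= 1 / 2 * L2norm (dx thn) + 1 / 2 * L2norm (dx thp).
    have h2 : 0 <= 1 / 2 :> R by rewrite divr_ge0.
    have := L2norm_lin (1 / 2) (1 / 2) bn bp; rewrite (ger0_norm h2).
    apply: le_trans; rewrite le_eqVlt; apply/orP; left; apply/eqP.
    apply: eq_L2norm => x xi; rewrite cdef (dx_lin _ _ an ap)//; exact: subset_itv_oo_cc.
  exact: sqr_le_mean (L2norm_ge0 _) pp.
exact: step_increment k0 (growth_const_ge0 a00 K0) half avgle main.
Qed.

End One_step.

(** * Bounds by the norm of the solution *)

Section Norm_bounds.
Context {R : realType}.
Implicit Types (v w : R -> R) (W : R -> R -> R).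

Lemma derivs_lin n v w (c d : R) : Cn_in `[0, 1] n v -> Cn_in `[0, 1] n w ->
  Cn_in `[0, 1] n (fun x => c * v x + d * w x) /\
  forall l, (l <= n)%N -> forall x, x \in `[0, 1] ->
    derivs (fun x => c * v x + d * w x) l x = c * derivs v l x + d * derivs w l x.
Proof.
move=> Cv Cw; set z := (fun x => c * v x + d * w x).
have E l : (l <= n)%N -> forall x, x \in `[0, 1] ->
    derivs z l x = c * derivs v l x + d * derivs w l x.
  elim: l => [//|l IH] ln x xi.
  apply: etrans (@eq_deriv_in _ `[0, 1] _ _ x (IH (ltnW ln)) xi).2 _.
  exact: (deriv_in_lin c d ltr01 xi (Cv.1 l ln x xi) (Cw.1 l ln x xi)).2.
split=> //; split=> [i ni x xi|].
  apply: (@eq_deriv_in _ `[0, 1] (fun x => c * derivs v i x + d * derivs w i x) _ x _ xi).1.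
    by move=> y yi; rewrite -E// ltnW.
  exact: (deriv_in_lin c d ltr01 xi (Cv.1 i ni x xi) (Cw.1 i ni x xi)).1.
apply: (@eq_within_continuous _ _ (fun x => c * derivs v n x + d * derivs w n x)).
  by move=> y yi; rewrite -E.
by move=> x; apply: cvgD; apply: cvgMr; [exact: Cv.2|exact: Cw.2].
Qed.

Lemma Hnorm_sqr s (d : nat -> R -> R) :
  Hnorm s d ^+ 2 = \sum_(l < s.+1) L2norm (d l) ^+ 2.
Proof. by apply: sqr_sqrtr; apply: sumr_ge0 => i _; exact: sqr_ge0. Qed.

Lemma Hnorm_ge0 s (d : nat -> R -> R) : 0 <= Hnorm s d.
Proof. exact: sqrtr_ge0. Qed.

Lemma L2norm_le_Hnorm s (d : nat -> R -> R) l : (l <= s)%N -> L2norm (d l) <= Hnorm s d.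
Proof.
move=> ls; rewrite -ler_sqr ?nnegrE ?L2norm_ge0 ?Hnorm_ge0// Hnorm_sqr.
rewrite (bigD1 (Ordinal (ls : (l < s.+1)%N)))//= lerDl.
by apply: sumr_ge0 => i _; exact: sqr_ge0.
Qed.

Lemma Hnorm_le s (d : nat -> R -> R) (K : R) : 0 <= K ->
  (forall l, (l <= s)%N -> L2norm (d l) <= K) -> Hnorm s d <= s.+1%:R * K.
Proof.
move=> K0 dK; rewrite -ler_sqr ?nnegrE ?Hnorm_ge0 ?mulr_ge0// Hnorm_sqr.
apply: (@le_trans _ _ (\sum_(i < s.+1) K ^+ 2)).
  apply: ler_sum => i _; rewrite ler_sqr ?nnegrE ?L2norm_ge0//.
  by apply: dK; rewrite -ltnS.
rewrite sumr_const card_ord -[K ^+ 2 *+ _]mulr_natl exprMn ler_wpM2r ?sqr_ge0//.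
by rewrite expr2 ler_peMr// ler1n.
Qed.

Lemma sum_two m (F : nat -> R) : \sum_(m <= l < m.+2) F l = F m + F m.+1.
Proof. by rewrite big_ltn// big_nat1. Qed.

Lemma le_sum_parts (m1 m2 m3 m4 m5 m6 m7 : R) :
  0 <= m1 -> 0 <= m2 -> 0 <= m3 -> 0 <= m4 -> 0 <= m5 -> 0 <= m6 -> 0 <= m7 ->
  [/\ 0 <= m1 + m2 + (m3 + m4) + (m5 + m6) + m7,
    m1 <= m1 + m2 + (m3 + m4) + (m5 + m6) + m7 /\ m2 <= m1 + m2 + (m3 + m4) + (m5 + m6) + m7,
    m3 <= m1 + m2 + (m3 + m4) + (m5 + m6) + m7 /\ m4 <= m1 + m2 + (m3 + m4) + (m5 + m6) + m7,
    m5 <= m1 + m2 + (m3 + m4) + (m5 + m6) + m7 /\ m6 <= m1 + m2 + (m3 + m4) + (m5 + m6) + m7 &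
    m7 <= m1 + m2 + (m3 + m4) + (m5 + m6) + m7].
Proof. by move=> *; split; try split; lra. Qed.

Lemma maxT_ge (T : R) (F : R -> R) (K t : R) :
  (forall s, s \in `[0, T] -> F s <= K) -> t \in `[0, T] -> F t <= maxT T F.
Proof.
move=> FK tT; apply: sup_upper_bound; last by exists t.
split; first by exists (F t), t.
by exists K => _ [s sT <-]; exact: FK.
Qed.

Lemma maxT_ge0 (T : R) (F : R -> R) (K : R) : 0 <= T ->
  (forall s, s \in `[0, T] -> 0 <= F s <= K) -> 0 <= maxT T F.
Proof.
move=> T0 FK; have z : 0 \in `[0, T] by rewrite in_itv/= lexx.
have FK' s : s \in `[0, T] -> F s <= K by move=> /FK/andP[].
by apply: le_trans (maxT_ge FK' z); have /andP[] := FK 0 z.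
Qed.

Lemma le_of_sqr_le (x y : R) : 0 <= x -> 0 <= y -> x ^+ 2 <= y * x -> x <= y.
Proof.
move=> x0 y0; have [->//|xn] := eqVneq x 0.
by rewrite expr2 ler_pM2r// lt_def xn.
Qed.

End Norm_bounds.

Section Solution_norm.
Context {R : realType}.
Variables (r : nat) (T : R) (u : R -> R -> R).
Hypotheses (T0 : 0 < T) (r3 : (3 <= r)%N) (Cu : Cn_rect T r.+2 u).
Implicit Types (w : R -> R -> R) (t : R).

Lemma L2norm_rect_bounded w : Cn_rect T 0 w -> exists K : R,
  forall t, t \in `[0, T] -> 0 <= L2norm (w t) <= K.
Proof.
move=> Cw; have [K K0 wK] := rect_bounded T0 Cw; exists K => t tT.
rewrite L2norm_ge0 L2norm_bound//; first exact: Cn_rect_bm Cw tT.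
by move=> x xi; apply: wK => //; exact: subset_itv_oo_cc.
Qed.

Lemma Hnorm_rect_bounded s w : Cn_rect T s w -> exists K : R,
  forall t, t \in `[0, T] -> 0 <= Hnorm s (derivs (w t)) <= K.
Proof.
move=> Cw.
have partial n : (n <= s)%N -> exists K : R, forall t, t \in `[0, T] ->
    \sum_(l < n.+1) L2norm (derivs (w t) l) ^+ 2 <= K.
  elim: n => [|n IH] ns.
    have [K HK] := L2norm_rect_bounded (@Cn_rectW _ T 0 s w isT Cw).
    exists (K ^+ 2) => t tT; rewrite big_ord_recl big_ord0 addr0.
    have /andP[a b] := HK t tT; rewrite ler_sqr ?nnegrE//; exact: le_trans b.
  have [K HK] := IH (ltnW ns).
  have C0 : Cn_rect T 0 (iter n.+1 (@pdx R) w).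
    by apply: Cn_rect_iter_pdx; rewrite addn0; exact: Cn_rectW Cw.
  have [L HL] := L2norm_rect_bounded C0.
  exists (K + L ^+ 2) => t tT; rewrite big_ord_recr/= lerD ?HK//.
  have /andP[a b] := HL t tT; rewrite iter_pdxE in a b.
  rewrite ler_sqr ?nnegrE//; exact: le_trans b.
have [K HK] := partial s (leqnn s).
exists (Num.sqrt K) => t tT; rewrite Hnorm_ge0/=; apply: ler_wsqrtr; exact: HK.
Qed.

Let Y := Upsilon r T u.

(** The suprema over time dominate their members only because continuity on a compact
rectangle makes them finite. *)
Lemma Upsilon_bounds : [/\ 0 <= Y,
  forall t, t \in `[0, T] -> Hnorm r.+1 (derivs (u t)) <= Y /\
                             Hnorm r.+1 (derivs (pdt T u t)) <= Y,
  forall t, t \in `[0, T] -> semi1 (iter 2 (pdt T) u t) <= Y /\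
                             semi1 (iter 3 (pdt T) u t) <= Y,
  forall t, t \in `[0, T] -> `|iter 2 (pdt T) u t 1| <= Y /\
                             `|iter 2 (pdt T) (pdx u) t 1| <= Y &
  forall t, t \in `[0, T] -> semi2 (iter 2 (pdt T) u t) <= Y].
Proof.
have one : (1 : R) \in `[0, 1] by rewrite in_itv/= ler01 lexx.
have [KA HA] := Hnorm_rect_bounded (Cn_rectS Cu).
have [KB HB] := Hnorm_rect_bounded (Cn_rect_pdt Cu).
have semi1b i : (i <= 3)%N -> exists K : R, forall t, t \in `[0, T] ->
    0 <= semi1 (iter i (pdt T) u t) <= K.
  move=> i3; apply: (L2norm_rect_bounded (w := pdx (iter i (pdt T) u))).
  apply/Cn_rect_pdx/Cn_rect_iter_pdt; apply: Cn_rectW Cu.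
  by rewrite addn1 ltnS (leq_trans i3)// (leq_trans r3).
have [KC HC] := semi1b 2%N isT; have [KD HD] := semi1b 3%N isT.
have [KG HG] : exists K : R, forall t, t \in `[0, T] ->
    0 <= semi2 (iter 2 (pdt T) u t) <= K.
  apply: (L2norm_rect_bounded (w := pdx (pdx (iter 2 (pdt T) u)))).
  apply/Cn_rect_pdx/Cn_rect_pdx/Cn_rect_iter_pdt; apply: Cn_rectW Cu.
  by rewrite addn2 !ltnS (leq_trans _ r3).
have val w : Cn_rect T 2 w -> exists K : R, forall t, t \in `[0, T] ->
    0 <= `|iter 2 (pdt T) w t 1| <= K.
  move=> Cw; have C0 : Cn_rect T 0 (iter 2 (pdt T) w) by exact: Cn_rect_iter_pdt.
  have [K K0 HK] := rect_bounded T0 C0; exists K => t tT.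
  by rewrite normr_ge0 HK.
have C2 : Cn_rect T 2 u by exact: (@Cn_rectW _ T 2 r.+2 u isT Cu).
have C2x : Cn_rect T 2 (pdx u).
  by apply: Cn_rect_pdx; apply: Cn_rectW Cu; rewrite !ltnS (leq_trans _ r3).
have [KE HE] := val u C2; have [KF HF] := val (pdx u) C2x.
have T0' := ltW T0.
have ub (F : R -> R) (K : R) : (forall t, t \in `[0, T] -> 0 <= F t <= K) ->
    forall t, t \in `[0, T] -> F t <= maxT T F.
  by move=> H t tT; apply: (maxT_ge (K := K)) => // s /H/andP[].
have A0 := maxT_ge0 T0' HA; have B0 := maxT_ge0 T0' HB; have D0 := maxT_ge0 T0' HC.
have E0 := maxT_ge0 T0' HD; have F0 := maxT_ge0 T0' HE; have G0 := maxT_ge0 T0' HF.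
have H0 := maxT_ge0 T0' HG.
have A1 := ub _ _ HA; have B1 := ub _ _ HB; have C1 := ub _ _ HC; have D1 := ub _ _ HD.
have E1 := ub _ _ HE; have F1 := ub _ _ HF; have G1 := ub _ _ HG.
have YE : Y = maxT T (fun t => Hnorm r.+1 (derivs (u t)))
   + maxT T (fun t => Hnorm r.+1 (derivs (pdt T u t)))
   + (maxT T (fun t => semi1 (iter 2 (pdt T) u t)) + maxT T (fun t => semi1 (iter 3 (pdt T) u t)))
   + (maxT T (fun t => `|iter 2 (pdt T) u t 1|) + maxT T (fun t => `|iter 2 (pdt T) (pdx u) t 1|))
   + maxT T (fun t => semi2 (iter 2 (pdt T) u t)).
  by rewrite /Y /Upsilon !sum_two.
rewrite YE.
have [g0 [g1 g2] [g3 g4] [g5 g6] g7] := le_sum_parts A0 B0 D0 E0 F0 G0 H0.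
split; first exact: g0.
- by move=> t tT; split; [exact: le_trans (A1 t tT) g1|exact: le_trans (B1 t tT) g2].
- by move=> t tT; split; [exact: le_trans (C1 t tT) g3|exact: le_trans (D1 t tT) g4].
- by move=> t tT; split; [exact: le_trans (E1 t tT) g5|exact: le_trans (F1 t tT) g6].
- by move=> t tT; exact: le_trans (G1 t tT) g7.
Qed.

End Solution_norm.

(** * The weak form of the problem *)

Lemma fe_space_piecewise (R : realType) r (h : R) (S : set (R -> R)) : fe_space r h S ->
  exists M xs, [/\ is_partition 1 M xs, forall chi, S chi -> adm M xs chi /\ chi 0 = 0,
    forall v w (c d : R), S v -> S w -> S (fun x => c * v x + d * w x) &
    exists2 chi, S chi & forall x, x \in `[0, 1] -> chi x = x ^+ 3].
Proof.
move=> [[m [b Sb]] SC [M [xs [part _ Sp]]] cube]; exists M, xs; split=> //.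
  move=> chi Schi; have [C1 c0] := SC chi Schi; split=> //.
  apply: (piecewise_poly_adm part C1) => i iM.
  by have [p _ Hp] := Sp chi Schi i iM; exists p.
move=> v w c d; rewrite Sb => -[e _ <-] [e' _ <-].
exists (fun i => c * e i + d * e' i) => //; apply/funext => x.
by rewrite !big_distrr/= -big_split/=; apply: eq_bigr => i _; ring.
Qed.

Lemma rearrange_weak_form (R : realType) (al d1 g1 b1 f1 f0 v1 w1 w0 du st F B G : R) :
  st + (F - B - G) = (al * du - d1 * v1 - g1 - b1 * v1 - f1) * w1 - - f0 * w0 ->
  F = (al * du - (d1 + b1) * v1 - (g1 + f1)) * w1 + f0 * w0 - st + B + G.
Proof.
move=> E; have -> : F = st + (F - B - G) - st + B + G by ring.
by rewrite E; ring.
Qed.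

Section Exact_identity.
Context {R : realType}.
Variables (M : nat) (xs : nat -> R).
Hypothesis part : is_partition 1 M xs.
Variables (T : R) (a delta g eps : R -> R) (beta f : R -> R -> R) (u0 : R -> R).
Variable u : R -> R -> R.
Hypothesis T0 : 0 < T.
Hypothesis Cu : Cn_rect T 3 u.
Hypothesis eps_gt0 : forall t, t \in `[0, T] -> 0 < eps t.
Hypothesis u_sol : solves_P T a delta g eps beta f u0 u.
Notation adm := (adm M xs).

(** The weak form behind the scheme: the equation multiplied by [- chi''] and
integrated by parts once, the boundary condition being used to eliminate the time
derivative at the right end. *)
Lemma weak_form t chi : t \in `]0, T[ -> Cn_in `[0, 1] 1 (beta t) ->
  Cn_in `[0, 1] 1 (f t) -> adm chi ->
  formB (pdt T u t) chi =
    (a t / eps t * dx (u t) 1 - (delta t / eps t + beta t 1) * u t 1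
      - (g t / eps t + f t 1)) * dx chi 1 + f t 0 * dx chi 0
    - a t * formBstar (u t) chi + formB (fun x => beta t x * u t x) chi
    + formB (f t) chi.
Proof.
move=> tT Cb Cf ac; have [pde ubc0 ubc1 _] := u_sol.
have tT' : t \in `[0, T] by exact: subset_itv_oo_cc.
have one : (1 : R) \in `[0, 1] by rewrite in_itv/= ler01 lexx.
have zero : (0 : R) \in `[0, 1] by rewrite in_itv/= ler01 lexx.
have au : adm (u t) := Cn_in_adm part (Cn_rect_Cn_in (Cn_rectS Cu) tT').
have aut : adm (pdt T u t) := Cn_in_adm part (Cn_rect_Cn_in (Cn_rect_pdt Cu) tT').
have Pb : pder M xs (beta t) (dx (beta t)) := Cn_in_pder part (l := 0%N) Cb isT.
have Pf : pder M xs (f t) (dx (f t)) := Cn_in_pder part (l := 0%N) Cf isT.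
have Pm := pder_mul part Pb (adm_pder part au).
have PV := pder_sub (pder_sub (adm_pder part aut) Pm) Pf.
have [bu bc1 bc2] := And3 (adm_bm2 part au) (adm_bm1 part ac) (adm_bm2 part ac).
have but := adm_bm1 part aut.
have bm1 := pcont_bm part (pder_pcontr Pm); have bf1 := pcont_bm part (pder_pcontr Pf).
have I1 : ip (fun x => pdt T u t x - beta t x * u t x - f t x) (dx (dx chi)) =
    a t * formBstar (u t) chi.
  rewrite formBstarE -[RHS]addr0 -[0](mul0r (ip (dx (dx (u t))) (dx (dx chi)))).
  apply: etrans _ (ip_linl (a t) 0 bu bu bc2); apply: eq_ip => // x xi.
  rewrite (pde t x tT' (subset_itv_oo_cc xi)) mul0r addr0.
  rewrite -[iter 2 (@pdx R) u t x]/(dx (dx (u t)) x).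
  by move: (dx (dx (u t)) x) => z; ring.
have I2 : ip (fun x => dx (pdt T u t) x - (dx (beta t) x * u t x + beta t x * dx (u t) x)
      - dx (f t) x) (dx chi) =
    formB (pdt T u t) chi - formB (fun x => beta t x * u t x) chi - formB (f t) chi.
  rewrite (formBE (pdt T u t) chi) (formBE (f t) chi).
  apply: etrans (ip_subl (bm_sub but bm1) bf1 bc1) _; congr (_ - _).
  apply: etrans (ip_subl but bm1 bc1) _; congr (_ - _).
  exact: esym (formB_mulE part Cb au ac).
have := etrans (esym (congr2 +%R I1 I2)) (ip_pder part PV ac.2).
have ut0 : pdt T u t 0 = 0.
  have D := Cn_rect_is_derive_t Cu tT zero.
  have [d d0 Hd] := itvoo_near tT.
  have D0 : is_derive t 1 (fun s => u s 0) 0.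
    apply: (@is_derive_eql _ (fun=> 0) (fun s => u s 0) t 0 d d0) => s /Hd sT.
    by rewrite ubc0//; exact: subset_itv_oo_cc.
  by rewrite -(@derive_val _ _ _ _ _ _ _ D) (@derive_val _ _ _ _ _ _ _ D0).
have ut1 : pdt T u t 1 = a t / eps t * dx (u t) 1 - delta t / eps t * u t 1 - g t / eps t.
  have e0 : eps t != 0 by rewrite gt_eqF// eps_gt0.
  have := ubc1 t tT'; rewrite -[pdx u t 1]/(dx (u t) 1).
  move: (dx (u t) 1) (pdt T u t 1) => y z E.
  apply: (mulfI e0).
  have -> : eps t * (a t / eps t * y - delta t / eps t * u t 1 - g t / eps t) =
    a t * y - delta t * u t 1 - g t by field.
  by rewrite E; ring.
rewrite (ubc0 t tT') ut0 ut1 mulr0 subr0 sub0r.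
exact: rearrange_weak_form.
Qed.

End Exact_identity.

(** * Consistency errors *)

Lemma quotient_triangle (R : realType) (k A B x1 x0 y1 y0 q : R) : 0 < k ->
  `|k^-1 * (x1 - x0) - k^-1 * (y1 - y0)| <= A -> `|y1 - y0 - k * q| <= k ^+ 3 * B ->
  `|k^-1 * (x1 - x0) - q| <= A + k ^+ 2 * B.
Proof.
move=> k0 E1 E2.
have -> : k^-1 * (x1 - x0) - q = (k^-1 * (x1 - x0) - k^-1 * (y1 - y0)) + k^-1 * (y1 - y0 - k * q).
  by field; rewrite gt_eqF.
apply: le_trans (ler_normD _ _) _; apply: lerD; first exact: E1.
rewrite normrM (@gtr0_norm _ k^-1) ?invr_gt0// mulrC ler_pdivrMr//.
by apply: le_trans E2 _; rewrite le_eqVlt; apply/orP; left; apply/eqP; ring.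
Qed.

Lemma mean_triangle (R : realType) (p q p' q' z e1 e2 : R) :
  `|p - p'| <= e1 -> `|q - q'| <= e1 -> `|(p' + q') / 2 - z| <= e2 ->
  `|1 / 2 * p + 1 / 2 * q - z| <= e1 + e2.
Proof.
move=> hp hq hz.
have -> : 1 / 2 * p + 1 / 2 * q - z = (1 / 2 * (p - p') + 1 / 2 * (q - q')) + ((p' + q') / 2 - z).
  by field.
have h2 : `|1 / 2| = 1 / 2 :> R by rewrite ger0_norm// divr_ge0.
apply: le_trans (ler_normD _ _) _; apply: lerD => //.
by apply: le_trans (ler_normD _ _) _; rewrite !(normrM (1 / 2)) h2; lra.
Qed.

Section Consistency.
Context {R : realType}.
Variables (M : nat) (xs : nat -> R).
Hypothesis part : is_partition 1 M xs.
Notation adm := (adm M xs).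
Variables (r : nat) (T : R) (u : R -> R -> R).
Hypotheses (T0 : 0 < T) (r3 : (3 <= r)%N) (Cu : Cn_rect T r.+2 u).
Hypothesis u_left : forall t, t \in `[0, T] -> u t 0 = 0.
Variables (h C : R) (S : set (R -> R)).
Hypotheses (h0 : 0 < h) (C0 : 0 <= C).
Hypothesis Sadm : forall chi, S chi -> adm chi.
Hypothesis S0 : forall chi, S chi -> chi 0 = 0.
Hypothesis Slin : forall v w (c d : R), S v -> S w -> S (fun x => c * v x + d * w x).
Hypothesis Scube : exists2 chi, S chi & forall x, x \in `[0, 1] -> chi x = x ^+ 3.
Hypothesis Sapprox : forall s, (1 <= s <= r)%N -> forall v d, in_H0 s.+1 v d ->
  inf [set Hnorm 2 (fun l x => d l x - derivs chi l x) | chi in S]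
    <= C * h ^+ s.-1 * Hnorm s.+1 d.
Local Notation Y := (Upsilon r T u).
Local Notation delta := (30 * C ^+ 2 * h ^+ r * Upsilon r T u).
Implicit Types (t x : R) (g chi v w : R -> R).

Lemma ip_time_derivative_le i j t g : (i + j <= r.+2)%N -> t \in `[0, T] -> bm g ->
  L2norm (derivs (iter i (pdt T) u t) j) <= Y ->
  `|ip (iter i (pdt T) (iter j (@pdx R) u) t) g| <= Y * L2norm g.
Proof.
move=> ij tT bg le_Y; have Cij : Cn_rect T (i + j) u by exact: Cn_rectW Cu.
have E x : x \in `]0, 1[ -> iter i (pdt T) (iter j (@pdx R) u) t x =
    derivs (iter i (pdt T) u t) j x.
  move=> xi; rewrite (iter_pdt_iter_pdx T0 Cij tT) ?iter_pdxE//.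
  exact: subset_itv_oo_cc.
have -> : ip (iter i (pdt T) (iter j (@pdx R) u) t) g =
    ip (derivs (iter i (pdt T) u t) j) g by exact: eq_ip.
have bd : bm (derivs (iter i (pdt T) u t) j).
  rewrite -iter_pdxE; apply: (@Cn_rect_bm _ T 0) => //.
  by apply: Cn_rect_iter_pdx; rewrite addn0; exact: Cn_rect_iter_pdt.
apply: le_trans (cauchy_schwarz bd bg) _.
by apply: ler_wpM2r => //; exact: L2norm_ge0.
Qed.

Lemma projection_error t w : t \in `[0, T] -> is_elliptic_proj S (u t) w ->
  L2norm (fun x => dx w x - dx (u t) x) <= delta.
Proof.
move=> tT pw; have [Y0 H _ _ _] := Upsilon_bounds T0 r3 Cu.
have Cut := Cn_rect_Cn_in (Cn_rectS Cu) tT.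
apply: le_trans (elliptic_estimate part r3 h0 C0 Sadm S0 Scube Sapprox Cut (u_left tT) pw) _.
apply: ler_wpM2l; last exact: (H t tT).1.
by rewrite !mulr_ge0// ?sqr_ge0// exprn_ge0// ltW.
Qed.

Lemma formB_diff_le v w chi : adm v -> adm w -> adm chi ->
  `|formB v chi - formB w chi| <= L2norm (fun x => dx v x - dx w x) * L2norm (dx chi).
Proof.
move=> av aw ac.
have bv := adm_bm1 part av; have bw := adm_bm1 part aw; have bc := adm_bm1 part ac.
rewrite (formBE v chi) (formBE w chi).
have -> := esym (ip_subl bv bw bc).
exact: cauchy_schwarz (bm_sub bv bw) bc.
Qed.

Lemma adm_u t : t \in `[0, T] -> adm (u t).
Proof. move=> tT; exact: (Cn_in_adm part (Cn_rect_Cn_in Cu tT)). Qed.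

Variables (t0 t1 : R).
Hypotheses (t00 : 0 <= t0) (t01 : t0 < t1) (t1T : t1 <= T).
Local Notation k := (t1 - t0).
Local Notation m := ((t0 + t1) / 2).

Lemma t0_in : t0 \in `[0, T].
Proof. by rewrite in_itv/= t00 (le_trans (ltW t01)). Qed.

Lemma t1_in : t1 \in `[0, T].
Proof. by rewrite in_itv/= t1T (le_trans t00 (ltW t01)). Qed.

Lemma m_oo : m \in `]0, T[. Proof. exact: midpoint_in. Qed.

Lemma m_in : m \in `[0, T].
Proof. by have := m_oo; exact: subset_itv_oo_cc. Qed.

Lemma k_gt0 : 0 < k. Proof. by rewrite subr_gt0. Qed.

(** The quotient is paired with itself and the mean value theorem is applied to the
scalar pairing, which spares the integral in time of a norm. *)
Lemma quotient_estimate l : (l <= r.+1)%N ->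
  L2norm (derivs (fun x => k^-1 * u t1 x + (- k^-1) * u t0 x) l) <= Y.
Proof.
move=> lr; have [Y0 H _ _ _] := Upsilon_bounds T0 r3 Cu.
set v := fun x => _; have k0 := k_gt0.
have C1 := Cn_rect_Cn_in (Cn_rectS Cu) t1_in; have C2 := Cn_rect_Cn_in (Cn_rectS Cu) t0_in.
have [Cv Ev] := derivs_lin k^-1 (- k^-1) C1 C2.
pose g := derivs v l.
have bg : bm g.
  by apply: within_continuous_bm; exact: Cn_in_continuous Cv lr.
have Cl : Cn_rect T 1 (iter l (@pdx R) u).
  by apply: Cn_rect_iter_pdx; apply: Cn_rectW Cu; rewrite addn1.
have Cl0 : Cn_rect T 0 (iter l (@pdx R) u) := Cn_rectS Cl.
have b1 : bm (derivs (u t1) l) by rewrite -iter_pdxE; exact: Cn_rect_bm Cl0 t1_in.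
have b0 : bm (derivs (u t0) l) by rewrite -iter_pdxE; exact: Cn_rect_bm Cl0 t0_in.
apply: le_of_sqr_le => //; first exact: L2norm_ge0.
rewrite L2norm_sqr.
have -> : ip (derivs v l) (derivs v l) =
   k^-1 * ip (derivs (u t1) l) g + - k^-1 * ip (derivs (u t0) l) g.
  apply: etrans _ (ip_linl k^-1 (- k^-1) b1 b0 bg); apply: eq_ip => // x xi.
  by rewrite Ev//; exact: subset_itv_oo_cc.
have hb t : t \in `]0, T[ -> `|ip (iter 1 (pdt T) (iter l (@pdx R) u) t) g| <= Y * L2norm g.
  move=> tT; have tT' : t \in `[0, T] by exact: subset_itv_oo_cc.
  apply: (@ip_time_derivative_le 1 l t g) => //.
  apply: le_trans (H t tT').2; exact: L2norm_le_Hnorm.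
have := @time_chain_increment _ T t0 t1 t00 t01 t1T _ (Y * L2norm g) (time_chain_ip T0 Cl bg) hb.
rewrite /= !iter_pdxE -/g; move: (ip (derivs (u t1) l) g) (ip (derivs (u t0) l) g) => y1 y0.
move: (Y * L2norm g) => z hz; rewrite mulNr -mulrBr mulrC ler_pdivrMr//.
exact: le_trans (ler_norm _) hz.
Qed.

Variables (w1 w0 : R -> R).
Hypotheses (pw1 : is_elliptic_proj S (u t1) w1) (pw0 : is_elliptic_proj S (u t0) w0).

(** The difference quotient of the projections is the projection of the difference
quotient of the solution, so that the elliptic estimate applies to it directly. *)
Lemma difference_consistency chi : S chi ->
  `|k^-1 * (formB w1 chi - formB w0 chi) - formB (pdt T u m) chi| <=
    (r.+2%:R * delta + k ^+ 2 * Y) * L2norm (dx chi).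
Proof.
move=> Schi; have [Y0 H Hs _ _] := Upsilon_bounds T0 r3 Cu; have k0 := k_gt0.
have ac := Sadm Schi; have bc := adm_bm1 part ac.
have a1 := adm_u t1_in; have a0 := adm_u t0_in.
have aw1 := Sadm pw1.1; have aw0 := Sadm pw0.1.
have C1 := Cn_rect_Cn_in (Cn_rectS Cu) t1_in; have C2 := Cn_rect_Cn_in (Cn_rectS Cu) t0_in.
have [Cv _] := derivs_lin k^-1 (- k^-1) C1 C2.
pose v x := k^-1 * u t1 x + (- k^-1) * u t0 x.
pose w x := k^-1 * w1 x + (- k^-1) * w0 x.
have av : adm v := adm_lin part _ _ a1 a0.
have aw : adm w := adm_lin part _ _ aw1 aw0.
have pvw : is_elliptic_proj S v w.
  split; first by apply: Slin; [exact: pw1.1|exact: pw0.1].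
  move=> psi Spsi; have ap := Sadm Spsi.
  apply: etrans (gammastar_linl part _ _ aw1 aw0 ap) _.
  rewrite (pw1.2 psi Spsi) (pw0.2 psi Spsi).
  exact: esym (gammastar_linl part _ _ a1 a0 ap).
have v0 : v 0 = 0 by rewrite /v !u_left ?t0_in ?t1_in// !mulr0 addr0.
have e1 : L2norm (fun x => dx w x - dx v x) <= r.+2%:R * delta.
  apply: le_trans (elliptic_estimate part r3 h0 C0 Sadm S0 Scube Sapprox Cv v0 pvw) _.
  have -> : r.+2%:R * delta = 30 * C ^+ 2 * h ^+ r * (r.+2%:R * Y) by rewrite mulrCA.
  apply: ler_wpM2l; first by rewrite !mulr_ge0// ?sqr_ge0// exprn_ge0// ltW.
  by apply: Hnorm_le => // l lr; exact: quotient_estimate.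
have E1 := le_trans (formB_diff_le aw av ac) (ler_wpM2r (L2norm_ge0 (dx chi)) e1).
have Ew : formB w chi = k^-1 * (formB w1 chi - formB w0 chi).
  by rewrite mulrBr -mulNr; exact: (formB_linl part _ _ aw1 aw0 ac).
have Ev : formB v chi = k^-1 * (formB (u t1) chi - formB (u t0) chi).
  by rewrite mulrBr -mulNr; exact: (formB_linl part _ _ a1 a0 ac).
have C3 : Cn_rect T 3 (pdx u).
  by apply: Cn_rect_pdx; apply: Cn_rectW Cu; rewrite ltnS ltnW.
have fE t : formB (u t) chi = ip (pdx u t) (dx chi) by rewrite formBE.
have ut : formB (pdt T u m) chi = ip (pdt T (pdx u) m) (dx chi).
  rewrite formBE; apply: eq_ip => // x xi.
  have C2u : Cn_rect T (1 + 1) u by exact: Cn_rectW Cu.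
  rewrite -[RHS]/(iter 1 (pdt T) (iter 1 (@pdx R) u) m x).
  rewrite (iter_pdt_iter_pdx T0 C2u m_in)//; exact: subset_itv_oo_cc.
have hb t : t \in `]0, T[ -> `|ip (iter 3 (pdt T) (pdx u) t) (dx chi)| <= Y * L2norm (dx chi).
  move=> tT; have tT' : t \in `[0, T] by exact: subset_itv_oo_cc.
  have r2 : (3 + 1 <= r.+2)%N by rewrite !ltnS (leq_trans _ r3).
  exact: (@ip_time_derivative_le 3 1 t (dx chi) r2 tT' bc (Hs t tT').2).
have := @midpoint_difference _ T t0 t1 t00 t01 t1T _ (Y * L2norm (dx chi)) (time_chain_ip T0 C3 bc) hb.
rewrite /= -(fE t1) -(fE t0) -ut => E2.
rewrite Ew Ev in E1; rewrite [leRHS]mulrDl -[k ^+ 2 * Y * _]mulrA.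
exact: quotient_triangle k0 E1 E2.
Qed.

Local Notation W := (fun x => 1 / 2 * w1 x + 1 / 2 * w0 x).

Lemma slope_consistency : `|dx W 1 - dx (u m) 1| <= 2 * delta + k ^+ 2 * Y.
Proof.
have [_ _ _ Hv _] := Upsilon_bounds T0 r3 Cu.
have one : (1 : R) \in `[0, 1] by rewrite in_itv/= ler01 lexx.
have C2 : Cn_rect T 2 (pdx u).
  by apply: Cn_rect_pdx; apply: Cn_rectW Cu; rewrite !ltnS (leq_trans _ r3).
have hb t : t \in `]0, T[ -> `|iter 2 (pdt T) (pdx u) t 1| <= Y.
  by move=> tT; apply: (Hv t _).2; exact: subset_itv_oo_cc.
have := @midpoint_average _ T t0 t1 t00 t01 t1T _ Y (time_chain_value C2 one) hb.
rewrite /= => E; rewrite (dx_lin _ _ (Sadm pw1.1) (Sadm pw0.1) one).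
apply: mean_triangle E.
  apply: le_trans (elliptic_endpoint part Sadm Scube (adm_u t1_in) pw1) _.
  by rewrite ler_wpM2l// (projection_error t1_in).
apply: le_trans (elliptic_endpoint part Sadm Scube (adm_u t0_in) pw0) _.
by rewrite ler_wpM2l// (projection_error t0_in).
Qed.

Lemma endpoint_error t w : t \in `[0, T] -> is_elliptic_proj S (u t) w ->
  `|w 1 - u t 1| <= delta.
Proof.
move=> tT pw; apply: le_trans (projection_error tT pw).
have P := pder_sub (adm_pder part (Sadm pw.1)) (adm_pder part (adm_u tT)).
by apply: (endpoint_le part P); rewrite (S0 pw.1) u_left// subrr.
Qed.

Lemma value_consistency : `|W 1 - u m 1| <= delta + k ^+ 2 * Y.
Proof.
have [_ _ _ Hv _] := Upsilon_bounds T0 r3 Cu.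
have one : (1 : R) \in `[0, 1] by rewrite in_itv/= ler01 lexx.
have C2 : Cn_rect T 2 u by exact: (@Cn_rectW _ T 2 r.+2 u isT Cu).
have hb t : t \in `]0, T[ -> `|iter 2 (pdt T) (u) t 1| <= Y.
  by move=> tT; apply: (Hv t _).1; exact: subset_itv_oo_cc.
have := @midpoint_average _ T t0 t1 t00 t01 t1T _ Y (time_chain_value C2 one) hb.
rewrite /= => E; apply: mean_triangle E.
  exact: endpoint_error t1_in pw1.
exact: endpoint_error t0_in pw0.
Qed.

Lemma midpoint_ip_average j g : (2 + j <= r.+2)%N -> bm g ->
  (forall t, t \in `[0, T] -> L2norm (derivs (iter 2 (pdt T) u t) j) <= Y) ->
  `|(ip (derivs (u t1) j) g + ip (derivs (u t0) j) g) / 2 - ip (derivs (u m) j) g|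
    <= k ^+ 2 * (Y * L2norm g).
Proof.
move=> jr bg HY; have Cj : Cn_rect T 2 (iter j (@pdx R) u).
  by apply: Cn_rect_iter_pdx; apply: Cn_rectW Cu; rewrite addnC.
have hb t : t \in `]0, T[ -> `|ip (iter 2 (pdt T) (iter j (@pdx R) u) t) g| <= Y * L2norm g.
  move=> tT; have tT' : t \in `[0, T] by exact: subset_itv_oo_cc.
  by apply: (@ip_time_derivative_le 2 j t g) => //; exact: HY.
have := @midpoint_average _ T t0 t1 t00 t01 t1T _ (Y * L2norm g) (time_chain_ip T0 Cj bg) hb.
by rewrite /= !iter_pdxE.
Qed.

(** Orthogonality trades the second derivatives of the projection error, of order
[h ^ (r - 1)], for first derivatives, of order [h ^ r]. *)
Lemma second_order_consistency chi : S chi ->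
  `|formBstar W chi - formBstar (u m) chi| <=
    delta * L2norm (dx chi) + k ^+ 2 * Y * L2norm (dx (dx chi)).
Proof.
move=> Schi; have [_ _ _ _ H2] := Upsilon_bounds T0 r3 Cu.
have ac := Sadm Schi; have bc := adm_bm2 part ac.
have one t w : t \in `[0, T] -> is_elliptic_proj S (u t) w ->
    `|formBstar w chi - formBstar (u t) chi| <= delta * L2norm (dx chi).
  move=> tT pw; have := pw.2 chi Schi; rewrite !gammastarE -!formBstarE -!formBE => E.
  have -> : formBstar w chi - formBstar (u t) chi = - (formB w chi - formB (u t) chi).
    move: E; move: (formBstar w chi) (formBstar (u t) chi) (formB w chi) (formB (u t) chi).
    by move=> y1 y2 y3 y4 E; lra.
  rewrite normrN; apply: le_trans (formB_diff_le (Sadm pw.1) (adm_u tT) ac) _.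
  by apply: ler_wpM2r; [exact: L2norm_ge0|exact: projection_error].
rewrite (formBstar_linl part _ _ (Sadm pw1.1) (Sadm pw0.1) ac).
apply: mean_triangle; [exact: one t1_in pw1|exact: one t0_in pw0|].
rewrite !formBstarE -mulrA; apply: (midpoint_ip_average (j := 2%N)) => //.
by rewrite addn2 !ltnS (leq_trans _ r3).
Qed.

Lemma gradient_consistency :
  L2norm (fun x => dx W x - dx (u m) x) <= delta + k ^+ 2 * Y.
Proof.
have [Y0 _ Hs _ _] := Upsilon_bounds T0 r3 Cu.
have b1 := adm_bm1 part (adm_u t1_in); have b0 := adm_bm1 part (adm_u t0_in).
have bm' := adm_bm1 part (adm_u m_in).
have bw1 := adm_bm1 part (Sadm pw1.1); have bw0 := adm_bm1 part (Sadm pw0.1).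
pose g x := (1 / 2 * dx (u t1) x + 1 / 2 * dx (u t0) x) - dx (u m) x.
have bl := bm_lin (1 / 2) (1 / 2) b1 b0.
have bg : bm g by exact: bm_sub.
have hg : L2norm g <= k ^+ 2 * Y.
  apply: le_of_sqr_le; [exact: L2norm_ge0|by rewrite mulr_ge0// sqr_ge0|].
  have jr : (2 + 1 <= r.+2)%N by rewrite !ltnS (leq_trans _ r3).
  have := midpoint_ip_average jr bg (fun t tT => (Hs t tT).1).
  rewrite L2norm_sqr -mulrA => E; apply: le_trans E; apply: le_trans (ler_norm _).
  rewrite le_eqVlt; apply/orP; left; apply/eqP.
  apply: etrans (ip_subl bl bm' bg) _.
  rewrite (ip_linl _ _ b1 b0 bg).
  rewrite -[derivs (u t1) 1]/(dx (u t1)) -[derivs (u t0) 1]/(dx (u t0)) -[derivs (u m) 1]/(dx (u m)).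
  by move: (ip (dx (u t1)) g) (ip (dx (u t0)) g) (ip (dx (u m)) g) => *; field.
have d1 := bm_sub bw1 b1; have d0 := bm_sub bw0 b0.
have -> : L2norm (fun x => dx W x - dx (u m) x) =
    L2norm (fun x => (1 / 2 * (dx w1 x - dx (u t1) x) + 1 / 2 * (dx w0 x - dx (u t0) x)) + g x).
  apply: eq_L2norm => x xi; rewrite (dx_lin _ _ (Sadm pw1.1) (Sadm pw0.1)); last first.
    exact: subset_itv_oo_cc.
  rewrite /g; move: (dx w1 x) (dx w0 x) (dx (u t1) x) (dx (u t0) x) (dx (u m) x) => *; ring.
apply: le_trans (L2norm_add (bm_lin _ _ d1 d0) bg) _; apply: lerD => //.
apply: le_trans (L2norm_lin _ _ d1 d0) _.
have h2 : `|1 / 2| = 1 / 2 :> R by rewrite ger0_norm// divr_ge0.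
rewrite h2; have := projection_error t1_in pw1; have := projection_error t0_in pw0.
move: (L2norm _) (L2norm _) delta => *; lra.
Qed.

End Consistency.

(** * Gronwall inequality and the error bound *)

Lemma le_bigmax_range (R : realType) N (F : nat -> R) n : (1 <= n <= N)%N ->
  F n <= \big[Num.max/0]_(1 <= i < N.+1) F i.
Proof. by move=> nN; apply: le_bigmax_seq => //; rewrite mem_index_iota ltnS. Qed.

Lemma bigmax_range_le (R : realType) N (F : nat -> R) (K : R) : 0 <= K ->
  (forall n, (1 <= n <= N)%N -> F n <= K) -> \big[Num.max/0]_(1 <= i < N.+1) F i <= K.
Proof.
move=> K0 FK; rewrite big_nat_cond; apply: bigmax_le => // i.
by rewrite andbT ltnS => /FK.
Qed.

(** This is where a step of at most one third is needed: then
[(1 + s) / (1 - s) <= 1 + 3 s]. *)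
Lemma gronwall_step (R : realType) (s y z e : R) : 0 <= s -> s <= 1 / 3 -> 0 <= y -> 0 <= e ->
  z - y <= s * (z + y) + 2 * s * e -> z + e <= (1 + 3 * s) * (y + e).
Proof.
move=> s0 s3 y0 e0 H.
have p : 0 < 1 - s by lra.
rewrite -(ler_pM2l p).
have A : 0 <= s * (1 - 3 * s) * (y + e).
  by apply: mulr_ge0; [apply: mulr_ge0 => //; lra|exact: addr_ge0].
have -> : (1 - s) * ((1 + 3 * s) * (y + e)) = (1 + s) * y + (1 + s) * e + s * (1 - 3 * s) * (y + e).
  by ring.
have -> : (1 - s) * (z + e) = (z - y) - s * (z + y) + (1 + s) * y + (1 - s) * e by ring.
have := H; have -> : (1 + s) * e = (1 - s) * e + 2 * s * e by ring.
move: A; move: (s * (1 - 3 * s) * (y + e)) (s * (z + y)) (2 * s * e) ((1 + s) * y) ((1 - s) * e).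
by move=> *; lra.
Qed.

Lemma discrete_gronwall (R : realType) N (t : nat -> R) (y : nat -> R) (K e T : R) :
  is_partition T N t -> 0 <= K -> 0 <= e -> (forall n, 0 <= y n) -> y 0%N = 0 ->
  (forall n, (n < N)%N -> (t n.+1 - t n) * K <= 1 / 3) ->
  (forall n, (n < N)%N -> y n.+1 - y n <=
     (t n.+1 - t n) * K * (y n.+1 + y n) + 2 * (t n.+1 - t n) * K * e) ->
  forall n, (n <= N)%N -> y n <= expR (3 * K * T) * e.
Proof.
move=> pt K0 e0 y0 yz small rec n nN; case: (pt) => tz tN tlt.
have H j : (j <= N)%N -> y j + e <= expR (3 * K * t j) * e.
  elim: j => [|j IH] jN; first by rewrite yz add0r tz mulr0 expR0 mul1r.
  have s0 : 0 <= (t j.+1 - t j) * K by rewrite mulr_ge0// subr_ge0 ltW// tlt.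
  have st : y j.+1 - y j <= (t j.+1 - t j) * K * (y j.+1 + y j) + 2 * ((t j.+1 - t j) * K) * e.
    by apply: le_trans (rec j jN) _; rewrite mulrA.
  apply: le_trans (gronwall_step s0 (small j jN) (y0 j) e0 st) _.
  have -> : 3 * K * t j.+1 = 3 * ((t j.+1 - t j) * K) + 3 * K * t j by ring.
  rewrite expRD -mulrA; apply: ler_pM; last exact: IH (ltnW jN).
  - by rewrite addr_ge0// mulr_ge0.
  - by rewrite addr_ge0.
  - exact: expR_ge1Dx.
have : expR (3 * K * t n) <= expR (3 * K * T).
  rewrite ler_expR ler_wpM2l// ?mulr_ge0// -tN.
  by apply: (partition_le pt); rewrite nN leqnn.
move=> /(ler_wpM2r e0); have := H n nN.
by move: (expR _ * e) (expR _ * e) (y n) => *; lra.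
Qed.

Lemma smooth_in_bounded (R : realType) (T : R) (v : R -> R) : smooth_in `[0, T] v ->
  exists2 K : R, 0 <= K & forall t, t \in `[0, T] -> `|v t| <= K.
Proof.
move=> /(_ 0%N)[_ cv]; have [K HK] := within_continuous_bounded cv.
exists `|K| => // t tT; exact: le_trans (HK t tT) (ler_norm K).
Qed.

Lemma smooth_in_pos_min (R : realType) (T : R) (v : R -> R) : 0 <= T -> smooth_in `[0, T] v ->
  (forall t, t \in `[0, T] -> 0 < v t) ->
  exists2 c : R, 0 < c & forall t, t \in `[0, T] -> c <= v t.
Proof.
move=> T0 /(_ 0%N)[_ cv] v0; have [c cT Hc] := EVT_min T0 cv.
by exists (v c) => //; exact: v0.
Qed.

Lemma sqr_sum_le (R : realType) (x y : R) : 0 <= x -> x <= 2 * y ->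
  x ^+ 2 + y ^+ 2 <= (3 * y) ^+ 2.
Proof.
move=> x0 xy; have : x ^+ 2 <= (2 * y) ^+ 2 by rewrite ler_sqr ?nnegrE// (le_trans x0).
by rewrite !exprMn; have := sqr_ge0 y; lra.
Qed.

Section Error_bound.
Context {R : realType}.
Variables (r : nat) (T : R) (a delta g eps : R -> R) (beta f : R -> R -> R) (u0 : R -> R).
Variable u : R -> R -> R.
Hypotheses (T0 : 0 < T) (r3 : (3 <= r)%N) (Cu : Cn_rect T r.+2 u).
Hypothesis eps_gt0 : forall t, t \in `[0, T] -> 0 < eps t.
Hypothesis u_sol : solves_P T a delta g eps beta f u0 u.
Hypotheses (Cbeta : smooth_rect T beta) (Cf : smooth_rect T f).
Variables (K a0 C : R).
Hypotheses (C0 : 0 <= C) (a00 : 0 < a0).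
Hypothesis coeff : forall t, t \in `[0, T] ->
  [/\ a0 <= a t, a t <= K, `|a t / eps t| <= K & `|delta t / eps t + beta t 1| <= K].
Hypothesis beta_le : forall t x, t \in `[0, T] -> x \in `[0, 1] ->
  `|beta t x| <= K /\ `|dx (beta t) x| <= K.
Local Notation Y := (Upsilon r T u).
Local Notation K4 := (growth_const K a0).

Definition error_const : R := r.+2%:R * (30 * C ^+ 2) + 1.

Variables (N : nat) (t : nat -> R).
Hypothesis pt : is_partition T N t.
Hypothesis small : forall n, (n < N)%N -> (t n.+1 - t n) * K4 <= 1 / 3.
Variables (h : R) (S : set (R -> R)).
Hypotheses (h0 : 0 < h) (S_fe : fe_space r h S).
Hypothesis Sapprox : forall s, (1 <= s <= r)%N -> forall v d, in_H0 s.+1 v d ->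
  inf [set Hnorm 2 (fun l x => d l x - derivs chi l x) | chi in S]
    <= C * h ^+ s.-1 * Hnorm s.+1 d.
Variable U : nat -> R -> R.
Hypothesis CN : crank_nicolson a delta g eps beta f u0 S N t U.

Local Notation E := (error_const * (mesh N t ^+ 2 + h ^+ r) * Y).

Lemma error_estimate n : (1 <= n <= N)%N ->
  Hnorm 1 (derivs (fun x => U n x - u (t n) x)) <=
    3 * (expR (3 * K4 * T) + 1) * E.
Proof.
move=> nN.
have [M [xs [part SC Slin Scube]]] := fe_space_piecewise S_fe.
have Sadm chi : S chi -> adm M xs chi by move=> /SC[].
have S0 chi : S chi -> chi 0 = 0 by move=> /SC[].
have [Y0 _ _ _ _] := Upsilon_bounds T0 r3 Cu.
have [U_S U0 scheme] := CN.
have [_ u_left _ u_init] := u_sol.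
case: (pt) => tz tN tlt.
have t_in j : (j <= N)%N -> t j \in `[0, T].
  move=> jN; rewrite in_itv/= -{1}tz -tN !(partition_le pt)//.
  by rewrite jN leqnn.
have au s : s \in `[0, T] -> adm M xs (u s).
  by move=> sT; exact: (Cn_in_adm part (Cn_rect_Cn_in Cu sT)).
have ex_w j : exists v, (j <= N)%N -> is_elliptic_proj S (u (t j)) v.
  have [jN|_] := boolP (j <= N)%N; last by exists (u 0).
  have [fd _ _ _] := S_fe.
  by have [v Hv] := elliptic_proj_exists part fd Sadm (au _ (t_in j jN)); exists v.
have [w Hw] := choice ex_w.
have mesh_ge j : (j < N)%N -> t j.+1 - t j <= mesh N t.
  by move=> jN; apply: (@le_bigmax_range _ N (step t) j.+1); rewrite jN.
have K0 : 0 <= K.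
  by have [a1 a2 _ _] := coeff (t_in 0%N isT); apply: le_trans a2; apply: le_trans a1; exact: ltW.
have K40 : 0 <= K4 := growth_const_ge0 a00 K0.
have c0 : 0 <= error_const by rewrite addr_ge0// mulr_ge0// mulr_ge0// sqr_ge0.
have hr0 : 0 <= h ^+ r by rewrite exprn_ge0// ltW.
have E0 : 0 <= E by rewrite mulr_ge0// mulr_ge0// addr_ge0// sqr_ge0.
pose dl := 30 * C ^+ 2 * h ^+ r * Y.
have dl0 : 0 <= dl by rewrite /dl !mulr_ge0// sqr_ge0.
(* Every consistency error is at most [q * dl + k ^ 2 * Y] with [q <= r + 2]. *)
have budget k : 0 <= k -> k <= mesh N t -> r.+2%:R * dl + k ^+ 2 * Y <= E.
  move=> k0 km; have km2 : k ^+ 2 <= mesh N t ^+ 2 by rewrite ler_sqr ?nnegrE// (le_trans k0).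
  have q0 : 0 <= r.+2%:R * (30 * C ^+ 2) by rewrite mulr_ge0// mulr_ge0// sqr_ge0.
  have m0 := sqr_ge0 (mesh N t).
  rewrite /dl /error_const; move: (r.+2%:R) (mesh N t ^+ 2) (k ^+ 2) q0 m0 km2 => q m2 k2 q0 m0 km2.
  have p1 : 0 <= q * (30 * C ^+ 2) * m2 * Y := mulr_ge0 (mulr_ge0 q0 m0) Y0.
  have p2 : 0 <= h ^+ r * Y by rewrite mulr_ge0.
  have p3 : k2 * Y <= m2 * Y by rewrite ler_wpM2r.
  have -> : (q * (30 * C ^+ 2) + 1) * (m2 + h ^+ r) * Y =
    q * (30 * C ^+ 2 * h ^+ r * Y) + m2 * Y + q * (30 * C ^+ 2) * m2 * Y + h ^+ r * Y by ring.
  by move: p1 p2 p3; move: (q * (30 * C ^+ 2 * h ^+ r * Y)) (m2 * Y) (k2 * Y)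
    (q * (30 * C ^+ 2) * m2 * Y) (h ^+ r * Y) => *; lra.
have dl_le q k : q <= r.+2%:R -> 0 <= k -> k <= mesh N t -> q * dl + k ^+ 2 * Y <= E.
  by move=> qr k0 km; apply: le_trans (budget k k0 km); rewrite lerD2r ler_wpM2r.
have one_r : 1 <= r.+2%:R :> R by rewrite ler1n.
have two_r : 2 <= r.+2%:R :> R by rewrite ler_nat.
pose th j x := 1 * U j x + (-1) * w j x.
pose y j := L2norm (dx (th j)) ^+ 2.
(* Both start from the elliptic projection of the same function, which determines
   them up to functions of zero energy. *)
have y0 : y 0%N = 0.
  have SU := U_S 0%N isT; have pw := Hw 0%N isT.
  have Sth : S (th 0%N) by apply: Slin => //; exact: pw.1.
  have ath := Sadm _ Sth.
  have z : gammastar (th 0%N) (th 0%N) = 0.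
    have e0 : gammastar (U 0%N) (th 0%N) = gammastar (w 0%N) (th 0%N).
      rewrite (U0.2 _ Sth) (pw.2 _ Sth) tz !gammastarE.
      have e1 x : x \in `[0, 1] -> dx u0 x = dx (u 0) x.
        by move=> xi; apply: (@eq_deriv_in _ `[0, 1] _ _ x _ xi).2 => z zi; rewrite u_init.
      have e2 x : x \in `[0, 1] -> dx (dx u0) x = dx (dx (u 0)) x.
        by move=> xi; exact: (@eq_deriv_in _ `[0, 1] _ _ x e1 xi).2.
      have i1 := eq_ip (fun x xi => e1 x (subset_itv_oo_cc xi)) (fun x _ => erefl (dx (th 0%N) x)).
      have i2 := eq_ip (fun x xi => e2 x (subset_itv_oo_cc xi)) (fun x _ => erefl (dx (dx (th 0%N)) x)).
      exact: (congr2 +%R i2 i1).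
    apply: etrans (gammastar_linl part 1 (-1) (Sadm _ SU) (Sadm _ pw.1) ath) _.
    by rewrite e0 mul1r mulN1r subrr.
  move: z; rewrite gammastarE -!L2norm_sqr => /eqP.
  by rewrite paddr_eq0 ?sqr_ge0// => /andP[_ /eqP].
have rec j : (j < N)%N -> y j.+1 - y j <=
     (t j.+1 - t j) * K4 * (y j.+1 + y j) + 2 * (t j.+1 - t j) * K4 * E ^+ 2.
  move=> jN.
  have t00 : 0 <= t j by have := t_in j (ltnW jN); rewrite in_itv/= => /andP[].
  have t1T : t j.+1 <= T by have := t_in _ jN; rewrite in_itv/= => /andP[].
  have t01 := tlt j jN.
  have k0 : 0 < t j.+1 - t j by rewrite subr_gt0.
  have km := mesh_ge j jN.
  pose m := (t j + t j.+1) / 2.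
  have moo : m \in `]0, T[ := midpoint_in t00 t01 t1T.
  have mT : m \in `[0, T] by exact: subset_itv_oo_cc.
  have p1 := Hw j.+1 jN; have p0 := Hw j (ltnW jN).
  have Cbm : Cn_in `[0, 1] 1 (beta m) := Cn_rect_Cn_in (Cbeta 1%N) mT.
  have Cfm : Cn_in `[0, 1] 1 (f m) := Cn_rect_Cn_in (Cf 1%N) mT.
  have C3 : Cn_rect T 3 u := Cn_rectW (leq_trans r3 (leq_trans (leqnSn r) (leqnSn r.+1))) Cu.
  have [ca1 ca2 ca3 ca4] := coeff mT.
  have SU1 := U_S j.+1 jN; have SU0 := U_S j (ltnW jN).
  have aU1 := Sadm _ SU1; have aU0 := Sadm _ SU0.
  have AUE : avg U j.+1 = (fun x => 1 / 2 * U j.+1 x + 1 / 2 * U j x).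
    by apply/funext => x; rewrite /avg /=; field.
  have kE : step t j.+1 = t j.+1 - t j by [].
  have sch chi : S chi -> (t j.+1 - t j)^-1 * (formB (U j.+1) chi - formB (U j) chi) =
    (a m / eps m * dx (avg U j.+1) 1 - (delta m / eps m + beta m 1) * avg U j.+1 1
      - (g m / eps m + f m 1)) * dx chi 1 + f m 0 * dx chi 0
    - a m * formBstar (avg U j.+1) chi + formB (fun x => beta m x * avg U j.+1 x) chi
    + formB (f m) chi.
    move=> Schi; apply: etrans (scheme j.+1 jN chi Schi).
    have -> : (fun x => (U j.+1 x - U j.+1.-1 x) / step t j.+1) =
        (fun x => (t j.+1 - t j)^-1 * U j.+1 x + (- (t j.+1 - t j)^-1) * U j x).
      by apply/funext => x; rewrite kE /= mulrC mulrBr mulNr.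
    rewrite mulrBr -mulNr.
    exact: esym (formB_linl part _ _ aU1 aU0 (Sadm _ Schi)).
  have wf chi (Schi : S chi) := weak_form part C3 eps_gt0 u_sol moo Cbm Cfm (Sadm _ Schi).
  have k00 := ltW k0.
  apply: (@one_step _ M xs part S Sadm S0 Slin (U j.+1) (U j) (w j.+1) (w j) (u m) (pdt T u m)
    (beta m) (fun chi => formB (f m) chi) (t j.+1 - t j) (a m / eps m)
    (delta m / eps m + beta m 1) (g m / eps m + f m 1) (f m 0) (a m) a0 K E
    SU1 SU0 p1.1 p0.1 (au m mT) (u_left m mT) Cbm k0 a00 ca1 ca2 ca3 ca4 E0
    (fun x xi => beta_le mT xi) (avg U j.+1) (fun x => 1 / 2 * w j.+1 x + 1 / 2 * w j x)
    (th j.+1) (th j) AUE erefl erefl erefl sch wf).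
  - move=> chi Schi.
    apply: le_trans (difference_consistency part T0 r3 Cu u_left h0 C0 Sadm S0 Slin Scube Sapprox
      t00 t01 t1T p1 p0 Schi) _.
    by rewrite ler_wpM2r ?L2norm_ge0// budget.
  - apply: le_trans (slope_consistency part T0 r3 Cu u_left h0 C0 Sadm S0 Scube Sapprox
      t00 t01 t1T p1 p0) _.
    exact: dl_le.
  - apply: le_trans (value_consistency part T0 r3 Cu u_left h0 C0 Sadm S0 Scube Sapprox
      t00 t01 t1T p1 p0) _.
    by rewrite -[30 * C ^+ 2 * h ^+ r * Y]mul1r dl_le.
  - move=> chi Schi.
    apply: le_trans (second_order_consistency part T0 r3 Cu u_left h0 C0 Sadm S0 Scube Sapprox
      t00 t01 t1T p1 p0 Schi) _.
    have kk : (t j.+1 - t j) ^+ 2 * Y <= E.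
      by have := dl_le 0 _ (ler0n _ _) k00 km; rewrite mul0r add0r.
    have dE : 30 * C ^+ 2 * h ^+ r * Y <= E.
      have := dl_le 1 0 one_r (lexx 0) (le_trans k00 km).
      by rewrite mul1r expr0n mul0r addr0.
    by rewrite [leRHS]mulrDr; apply: lerD; apply: ler_wpM2r => //; exact: L2norm_ge0.
  - apply: le_trans (gradient_consistency part T0 r3 Cu u_left h0 C0 Sadm S0 Scube Sapprox
      t00 t01 t1T p1 p0) _.
    by rewrite -[30 * C ^+ 2 * h ^+ r * Y]mul1r dl_le.
have ybound := discrete_gronwall pt K40 (sqr_ge0 E) (fun j => sqr_ge0 _) y0 small rec.
have nN' : (n <= N)%N by case/andP: nN.
pose G := expR (3 * K4 * T).
have G1 : 1 <= G.
  by rewrite /G -expR0 ler_expR mulr_ge0// ?mulr_ge0// ltW.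
have thb : L2norm (dx (th n)) <= G * E.
  have GE0 : 0 <= G * E by rewrite mulr_ge0// (le_trans ler01).
  rewrite -ler_sqr ?nnegrE ?L2norm_ge0//; apply: le_trans (ybound n nN') _.
  rewrite [leRHS](exprMn _ G) ler_wpM2r ?sqr_ge0//.
  by rewrite -[leLHS]mulr1 expr2 ler_wpM2l// (le_trans ler01).
have rho : L2norm (fun x => dx (w n) x - dx (u (t n)) x) <= E.
  apply: le_trans (projection_error part T0 r3 Cu u_left h0 C0 Sadm S0 Scube Sapprox
    (t_in n nN') (Hw n nN')) _.
  have m0 : 0 <= mesh N t.
    have N0 : (0 < N)%N by case/andP: nN => n1 n2; exact: leq_trans n1 n2.
    by apply: le_trans (mesh_ge 0%N N0); rewrite subr_ge0 ltW// tlt.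
  have := dl_le 1 0 one_r (lexx 0) m0.
  by rewrite mul1r expr0n mul0r addr0.
have aUn := Sadm _ (U_S n nN'); have aun := au _ (t_in n nN').
have awn := Sadm _ (Hw n nN').1.
have ath := Sadm _ (Slin _ _ 1 (-1) (U_S n nN') (Hw n nN').1).
pose e x := 1 * U n x + (-1) * u (t n) x.
have ae : adm M xs e := adm_lin part 1 (-1) aUn aun.
have -> : (fun x => U n x - u (t n) x) = e by apply/funext => x; rewrite /e mul1r mulN1r.
have de : L2norm (dx e) <= G * E + E.
  have -> : L2norm (dx e) = L2norm (fun x => dx (th n) x + (dx (w n) x - dx (u (t n)) x)).
    apply: eq_L2norm => x xi; have xi' : x \in `[0, 1] by exact: subset_itv_oo_cc.
    rewrite (dx_lin 1 (-1) aUn aun xi') (dx_lin 1 (-1) aUn awn xi').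
    by move: (dx (U n) x) (dx (u (t n)) x) (dx (w n) x) => *; ring.
  apply: le_trans (L2norm_add (adm_bm1 part ath) (bm_sub (adm_bm1 part awn) (adm_bm1 part aun))) _.
  exact: lerD.
have e0 : e 0 = 0 by rewrite /e (S0 _ (U_S n nN')) u_left ?t_in// !mulr0 addr0.
have pe : L2norm e <= 2 * L2norm (dx e) := poincare part (adm_pder part ae) e0.
apply: (@le_trans _ _ (3 * L2norm (dx e))); last first.
  by rewrite -mulrA ler_wpM2l// [leRHS]mulrDl mul1r.
have ge0 := L2norm_ge0 (dx e).
rewrite -ler_sqr ?nnegrE ?Hnorm_ge0 ?mulr_ge0// Hnorm_sqr !big_ord_recl big_ord0 addr0.
rewrite -[derivs e (ord0 : 'I_2)]/e -[derivs e (lift ord0 ord0)]/(dx e).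
exact: sqr_sum_le (L2norm_ge0 e) pe.
Qed.

End Error_bound.

Unset Implicit Arguments.

Theorem theorem4p14 (R : realType) (r : nat) (hstar T : R)
    (S : R -> set (R -> R))
    (a delta g eps : R -> R) (beta f : R -> R -> R) (u0 : R -> R)
    (u : R -> R -> R)
    (r_ge3 : (3 <= r)%N) (hstar_gt0 : 0 < hstar) (T_gt0 : 0 < T)
    (S_fe : forall h, 0 < h <= hstar -> fe_space r h (S h))
    (S_approx : approx_property r hstar S)
    (data : problem_data T a delta g eps beta f u0)
    (eps_gt0 : forall t, t \in `[0, T] -> 0 < eps t)
    (u_reg : Cn_rect T r.+2 u)
    (u_sol : solves_P T a delta g eps beta f u0 u) :
  exists2 CR : R, 0 <= CR &
  exists2 C : R, 0 < C &
    forall (N : nat) (t : nat -> R), is_partition T N t ->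
      \big[Num.max/0]_(1 <= n < N.+1) (step t n * CR) <= 1 / 3 ->
      forall h, 0 < h <= hstar ->
      forall U : nat -> R -> R,
        crank_nicolson a delta g eps beta f u0 (S h) N t U ->
        \big[Num.max/0]_(1 <= n < N.+1)
            Hnorm 1 (derivs (fun x => U n x - u (t n) x))
          <= C * (mesh N t ^+ 2 + h ^+ r) * Upsilon r T u.
Proof.
have [[Cb Cf] [sa sd sg se] _ apos _] := data.
have [C S_appr] := S_approx.
have [Ka Ka0 HKa] := smooth_in_bounded sa; have [Kd Kd0 HKd] := smooth_in_bounded sd.
have [e0 e00 He0] := smooth_in_pos_min (ltW T_gt0) se eps_gt0.
have [a0 a00 Ha0] := smooth_in_pos_min (ltW T_gt0) sa apos.
have [Kb Kb0 HKb] := rect_bounded T_gt0 (Cb 0%N).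
have [Kx Kx0 HKx] := rect_bounded T_gt0 (Cn_rect_pdx (Cb 1%N)).
have one : (1 : R) \in `[0, 1] by rewrite in_itv/= ler01 lexx.
pose K := Ka + Ka / e0 + Kd / e0 + Kb + Kx.
have q1 : 0 <= Ka / e0 by rewrite divr_ge0// ltW.
have q2 : 0 <= Kd / e0 by rewrite divr_ge0// ltW.
have quot (x z B : R) : `|x| <= B -> e0 <= z -> `|x / z| <= B / e0.
  move=> xB ez; have z0 := lt_le_trans e00 ez.
  rewrite normrM normfV (gtr0_norm z0); apply: ler_pM => //; first by rewrite invr_ge0 ltW.
  by rewrite lef_pV2.
have coeff t : t \in `[0, T] ->
    [/\ a0 <= a t, a t <= K, `|a t / eps t| <= K & `|delta t / eps t + beta t 1| <= K].
  move=> tT; have h1 := HKa t tT; have h2 := quot _ _ _ h1 (He0 t tT).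
  have h3 := quot _ _ _ (HKd t tT) (He0 t tT); have h4 := HKb t 1 tT one.
  split; first exact: Ha0.
  - by apply: le_trans (ler_norm _) _; apply: le_trans h1 _; rewrite /K; lra.
  - by apply: le_trans h2 _; rewrite /K; lra.
  - by apply: le_trans (ler_normD _ _) _; apply: le_trans (lerD h3 h4) _; rewrite /K; lra.
have beta_le t x : t \in `[0, T] -> x \in `[0, 1] -> `|beta t x| <= K /\ `|dx (beta t) x| <= K.
  move=> tT xi; split; first by apply: le_trans (HKb t x tT xi) _; rewrite /K; lra.
  by apply: le_trans (HKx t x tT xi) _; rewrite /K; lra.
have K0 : 0 <= K by rewrite /K !addr_ge0.
have K40 := growth_const_ge0 a00 K0.
pose c := 3 * (expR (3 * growth_const K a0 * T) + 1) * error_const r `|C|.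
have ec : 0 < error_const r `|C|.
  by rewrite /error_const ltr_wpDl// mulr_ge0// mulr_ge0// sqr_ge0.
have c0 : 0 < c by rewrite /c mulr_gt0// mulr_gt0// addr_gt0// expR_gt0.
exists (growth_const K a0) => //; exists c => // N t pt small h hh U CN.
have h0 : 0 < h by case/andP: hh.
have [Y0 _ _ _ _] := Upsilon_bounds T_gt0 r_ge3 u_reg.
have hr0 : 0 <= h ^+ r by rewrite exprn_ge0// ltW.
apply: bigmax_range_le.
  by rewrite mulr_ge0// mulr_ge0// ?(ltW c0)// addr_ge0// sqr_ge0.
move=> n nN.
have small' j : (j < N)%N -> (t j.+1 - t j) * growth_const K a0 <= 1 / 3.
  move=> jN; apply: le_trans small.
  by apply: (@le_bigmax_range _ N (fun n => step t n * growth_const K a0) j.+1); rewrite jN.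
have appr s : (1 <= s <= r)%N -> forall v d, in_H0 s.+1 v d ->
    inf [set Hnorm 2 (fun l x => d l x - derivs chi l x) | chi in S h]
      <= `|C| * h ^+ s.-1 * Hnorm s.+1 d.
  move=> sr v d vd; apply: le_trans (S_appr h hh s sr v d vd) _.
  apply: ler_wpM2r; first exact: Hnorm_ge0.
  by apply: ler_wpM2r; [rewrite exprn_ge0// ltW|exact: ler_norm].
have := error_estimate T_gt0 r_ge3 u_reg eps_gt0 u_sol Cb Cf (normr_ge0 C) a00 coeff beta_le
  pt small' h0 (S_fe h hh) appr CN nN.
by rewrite /c !mulrA.
Qed.
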